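(* Let $G$ be a finitely presented group of geometric dimension $2$, and let $H$ be a finitely presented group which admits a coarse embedding into $G$. Then $\mathrm{Fill}_H^2(\ell) \prec \mathrm{Fill}_G^2(\ell)$.
   Context: Coarse embedding: a map $f\colon X\to Y$ of metric spaces is a coarse embedding if there are functions $\rho_-,\rho_+\colon\mathbb{R}\to\mathbb{R}$ with $\lim_{x\to\infty}\rho_-(x)=\lim_{x\to\infty}\rho_+(x)=\infty$ and $\rho_-(d(x,y))\le d(f(x),f(y))\le\rho_+(d(x,y))$ for all $x,y\in X$. Finitely generated groups carry word metrics with respect to finite generating sets. Geometric dimension: $G$ has geometric dimension $2$ if the minimal dimension of a CW complex that is a $K(G,1)$ is $2$ (the complex is not required to be finite). A group is of type $F_n$ if it admits a $K(G,1)$ with compact $n$-skeleton. Filling functions: for a cell complex $X$, $C_d(X,\mathbb{Z})$ is the cellular $d$-chain group with norm $|\sum_\sigma n_\sigma\sigma|=\sum_\sigma|n_\sigma|$ (sum over $d$-cells). For an $(n-1)$-cycle $s$ that is a boundary, $\mathrm{FVol}_X(s)=\min\{|c| : c\in C_n(X,\mathbb{Z}),\ \partial c=s\}$. The $n$-th homological filling function of $X$ is $\mathrm{Fill}_X^n(\ell)=\max\{\mathrm{FVol}_X(s) : s \text{ an } (n-1)\text{-cycle in } X,\ |s|\le\ell\}$. For a group $G$ of type $F_n$, $\mathrm{Fill}_G^n=\mathrm{Fill}_X^n$, where $X$ is an $(n-1)$-connected cell complex on which $G$ acts properly, cocompactly and by cellular automorphisms; it is well defined up to the equivalence $\sim$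 below (e.g. for $n=2$ and $G$ finitely presented, $X$ can be the universal cover of a finite presentation complex). Comparison: for $f,g\colon\mathbb{N}\to\mathbb{N}$, $f\prec g$ means there is $C>0$ with $f(n)\le C g(Cn+C)+Cn+C$ for all $n$; $f\sim g$ means $f\prec g$ and $g\prec f$. *)

(* Defs.v *)
From HB Require Import structures.
From mathcomp Require Import all_boot all_order all_algebra.
From mathcomp Require Import finmap monalg.
From mathcomp Require Import all_classical all_reals all_analysis.

Set Implicit Arguments.
Unset Strict Implicit.
Unset Printing Implicit Defensive.

Import Order.TTheory GRing.Theory Num.Theory.
Import numFieldTopology.Exports.

Local Open Scope classical_set_scope.
Local Open Scope ring_scope.

(* Both are 0 by convention when the extremum does not exist. *)
Definition nat_min (P : set nat) : nat :=
  xget 0%N [set m | P m /\ forall k, P k -> (m <= k)%N].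

Definition nat_max (P : set nat) : nat :=
  xget 0%N [set m | P m /\ forall k, P k -> (k <= m)%N].

Section WordMetric.
Variables (G : groupType) (A : seq G).

Definition word_in : pred (seq G) :=
  all (fun x => (x \in A) || (x^-1 \in A)%g).

Definition generating_set : Prop :=
  forall g : G, exists2 w : seq G, word_in w & (\prod_(x <- w) x)%g = g.

Definition word_length (g : G) : nat :=
  nat_min [set n | exists w : seq G,
    [/\ word_in w, (\prod_(x <- w) x)%g = g & size w = n]].

Definition word_dist (R : realType) (g h : G) : R :=
  (word_length (g^-1 * h)%g)%:R.

End WordMetric.

Definition coarse_embedding (R : realType) (X Y : Type)
    (dX : X -> X -> R) (dY : Y -> Y -> R) (f : X -> Y) : Prop :=
  exists rho_lo rho_hi : R -> R,
  [/\ rho_lo x @[x --> +oo] --> +oo,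
      rho_hi x @[x --> +oo] --> +oo &
      forall x y : X,
        rho_lo (dX x y) <= dY (f x) (f y) <= rho_hi (dX x y)].

Section CWComplex.
Variable R : realType.

(* 'rV[R]_n carries the product topology; the sum of squares is used because
   the library norm on 'rV[R]_n is the sup norm. *)
Definition disk (n : nat) : set 'rV[R]_n :=
  [set v | \sum_(i < n) v 0 i ^+ 2 <= 1].

Definition open_disk (n : nat) : set 'rV[R]_n :=
  [set v | \sum_(i < n) v 0 i ^+ 2 < 1].

Definition sphere (n : nat) : set 'rV[R]_n :=
  [set v | \sum_(i < n) v 0 i ^+ 2 = 1].

Arguments disk : clear implicits.
Arguments open_disk : clear implicits.
Arguments sphere : clear implicits.

(* Presentation of a CW structure by characteristic maps D^n -> X.  Only the
   restriction of [char_map e] to [disk n] is meaningful.  By compactness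
   of D^n, [char_map e] is then a homeomorphism from the open disk onto the
   open cell. *)
Record cw_structure (X : topologicalType) := CWStructure {
  cell : nat -> Type;
  char_map : forall n, cell n -> 'rV[R]_n -> X;
  open_cell : {n & cell n} -> set X :=
    fun e => @char_map _ (projT2 e) @` open_disk (projT1 e);
  cw_hausdorff : hausdorff_space X;
  char_map_continuous : forall n (e : cell n),
    {within disk n, continuous (@char_map n e)};
  char_map_inj : forall n (e : cell n),
    {in open_disk n &, injective (@char_map n e)};
  cw_partition : forall x : X, exists! e : {n & cell n}, open_cell e x;
  cw_closure_finite : forall n (e : cell n),
    exists S : set {k & cell k},
    [/\ finite_set S,
        forall c, S c -> (projT1 c < n)%N &
        @char_map n e @` sphere n `<=` \bigcup_(c in S) open_cell c];
  cw_weak_topology : forall F : set X,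
    (forall n (e : cell n), closed (disk n `&` @char_map n e @^-1` F)) ->
    closed F
}.

Definition cw_dim_le (X : topologicalType) (K : cw_structure X) (n : nat) :
    Prop :=
  forall k, (n < k)%N -> cell K k -> False.

Section Homotopy.
Variable X : topologicalType.

(* Paths are functions on R of which only the restriction to [0, 1] matters. *)
Definition is_path (x y : X) (p : R -> X) : Prop :=
  [/\ {within `[0, 1], continuous p}, p 0 = x & p 1 = y].

Definition path_connected_space : Prop :=
  forall x y : X, exists p, is_path x y p.

Definition path_homotopic (x y : X) (p q : R -> X) : Prop :=
  exists h : R * R -> X,
  [/\ {within `[0, 1] `*` `[0, 1], continuous h},
      forall s : R, s \in `[0, 1] -> h (s, 0) = p s /\ h (s, 1) = q s &
      forall t : R, t \in `[0, 1] -> h (0, t) = x /\ h (1, t) = y].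

Definition path_concat (p q : R -> X) : R -> X :=
  fun s => if s <= 2^-1 then p (2 * s) else q (2 * s - 1).

(* [phi] induces a group isomorphism from the set of homotopy classes of loops
   at [x] onto [G]. *)
Definition fundamental_group_isom (x : X) (G : groupType) : Prop :=
  exists phi : (R -> X) -> G,
  [/\ forall p q, is_path x x p -> is_path x x q ->
        phi p = phi q <-> path_homotopic x x p q,
      forall p q, is_path x x p -> is_path x x q ->
        phi (path_concat p q) = (phi p * phi q)%g &
      forall g, exists2 p, is_path x x p & phi p = g].

Definition cube (n : nat) : set 'rV[R]_n :=
  [set v | forall i, 0 <= v 0 i <= 1].

Definition cube_boundary (n : nat) : set 'rV[R]_n :=
  [set v | cube v /\ exists i, v 0 i = 0 \/ v 0 i = 1].

Arguments cube : clear implicits.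
Arguments cube_boundary : clear implicits.

Definition trivial_homotopy_group (n : nat) (x : X) : Prop :=
  forall f : 'rV[R]_n -> X,
    {within cube n, continuous f} ->
    (forall v, cube_boundary n v -> f v = x) ->
    exists h : 'rV[R]_n * R -> X,
    [/\ {within cube n `*` `[0, 1], continuous h},
        forall v, cube n v -> h (v, 0) = f v /\ h (v, 1) = x &
        forall v (t : R), cube_boundary n v -> t \in `[0, 1] -> h (v, t) = x].

Definition eilenberg_maclane_1 (G : groupType) : Prop :=
  path_connected_space /\
  exists x : X, fundamental_group_isom x G /\
    forall n, (2 <= n)%N -> trivial_homotopy_group n x.

End Homotopy.

Definition has_K1_of_dim_le (G : groupType) (n : nat) : Prop :=
  exists (X : topologicalType) (K : cw_structure X),
    eilenberg_maclane_1 X G /\ cw_dim_le K n.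

Definition geometric_dimension (G : groupType) (n : nat) : Prop :=
  has_K1_of_dim_le G n /\ forall m, has_K1_of_dim_le G m -> (n <= m)%N.

End CWComplex.

(* A letter [(s, true)] stands for s and [(s, false)] for its inverse. *)
Definition gword (S : Type) := seq (S * bool).

(* Equality of the images of two words in the group < S | rels >. *)
Inductive word_equiv (S T : Type) (rels : T -> gword S) :
    gword S -> gword S -> Prop :=
| word_equiv_refl w : word_equiv rels w w
| word_equiv_sym w w' : word_equiv rels w w' -> word_equiv rels w' w
| word_equiv_trans w1 w2 w3 :
    word_equiv rels w1 w2 -> word_equiv rels w2 w3 -> word_equiv rels w1 w3
| word_equiv_cancel u v s b :
    word_equiv rels (u ++ [:: (s, b); (s, ~~ b)] ++ v) (u ++ v)
| word_equiv_rel u v r : word_equiv rels (u ++ rels r ++ v) (u ++ v).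

Definition letter_val (G : groupType) (S : Type) (iota : S -> G)
    (x : S * bool) : G :=
  if x.2 then iota x.1 else (iota x.1)^-1%g.

Definition word_val (G : groupType) (S : Type) (iota : S -> G)
    (w : gword S) : G :=
  (\prod_(x <- w) letter_val iota x)%g.

Record finite_presentation (G : groupType) := FinitePresentation {
  pgen : finType;
  prel : finType;
  pgen_val : pgen -> G;
  prel_word : prel -> gword pgen;
  pgen_generates : forall g, exists w, word_val pgen_val w = g;
  prel_holds : forall r, word_val pgen_val (prel_word r) = 1%g;
  prel_complete : forall w,
    word_val pgen_val w = 1%g -> word_equiv prel_word w [::]
}.

Notation chain K := {malg int[K]}.

Definition chain_norm (K : choiceType) (c : chain K) : nat :=
  (\sum_(k <- msupp c) `|c@_k|)%N.

Definition boundary (K K' : choiceType) (bd : K -> chain K') (c : chain K) :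
    chain K' :=
  \sum_(k <- msupp c) bd k *~ c@_k.

Section Filling.
Variables (K0 K1 K2 : choiceType) (bd1 : K1 -> chain K0) (bd2 : K2 -> chain K1).

Definition FVol (s : chain K1) : nat :=
  nat_min [set n | exists2 c : chain K2,
    boundary bd2 c = s & chain_norm c = n].

Definition Fill2 (l : nat) : nat :=
  nat_max [set n | exists s : chain K1,
    [/\ boundary bd1 s = 0, (chain_norm s <= l)%N & FVol s = n]].

End Filling.

(* Cellular boundary maps of the universal cover of the presentation complex:
   its vertices are the elements of G, the edge (g, s) goes from g to gs, and
   the 2-cell (g, r) is attached along the path from g that reads r. *)
Section UniversalCover.
Variables (G : groupType) (P : finite_presentation G).

Definition cover_bd1 (e : G * pgen P) : chain G :=
  << (e.1 * pgen_val e.2)%g >> - << e.1 >>.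

Fixpoint path_chain (g : G) (w : gword (pgen P)) : chain (G * pgen P)%type :=
  if w is x :: w' then
    let g' := (g * letter_val (@pgen_val _ P) x)%g in
    (if x.2 then << (g, x.1) >> else - << (g', x.1) >>) + path_chain g' w'
  else 0.

Definition cover_bd2 (c : G * prel P) : chain (G * pgen P)%type :=
  path_chain c.1 (prel_word c.2).

Definition group_Fill2 : nat -> nat := Fill2 cover_bd1 cover_bd2.

End UniversalCover.

Definition fill_prec (f g : nat -> nat) : Prop :=
  exists2 C : nat, (0 < C)%N &
    forall n, (f n <= C * g (C * n + C) + C * n + C)%N.

(* Main.v *)
(* Let Z be the group of 1-cycles of the Cayley 2-complex of G.  If G has a
   2-dimensional K(G,1), then the boundary C_2 -> Z has an equivariant section,
   so there is an equivariant p : C_2 -> C_2 with bd p(c) = bd c which depends on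
   bd c only.  Given a 1-cycle s of H, let c_0 be a minimal filling of f(s) in G,
   and let c be the image in G of any filling of s in H.  Then p(c_0) = p(c): the
   left-hand side has norm at most a constant times that of c_0, the right-hand
   side is supported near f(H), where f has a coarse inverse.  Mapping p(c) back
   to H fills s up to a correction of size linear in |s|.

   The section comes from 1-chains m(g) with bd m(g) = g - 1 and a 2-cocycle
   q(g,h) of 2-chains with bd q(g,h) = m(g) + g m(h) - m(gh).  To find them, push
   the points of the K(G,1) off the centers of the cells: each point gets a
   dimension 0, 1 or 2 and a homotopy class of paths to the base point, which is
   locally constant among points of the same dimension.  Along a map of a square
   or cube to the K(G,1) this gives labels (dimension, element of G) for which
   close points of equal dimension have equal labels.  Four close points always
   repeat a dimension, so alternating 2-cochains of labels are automatically
   cocycles; sums of their primitives around the triangles given by products in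
   pi_1 define q, and the tetrahedra, filled because pi_2 = 0, show that q is a
   cocycle. *)
From HB Require Import structures.
Require Import Defs.
From mathcomp Require Import all_boot all_order all_algebra.
From mathcomp Require Import finmap monalg.
From mathcomp Require Import zify ring lra.
From mathcomp Require Import all_classical all_reals all_analysis.

Set Implicit Arguments.
Unset Strict Implicit.
Unset Printing Implicit Defensive.

Import Order.TTheory GRing.Theory Num.Theory.
Import numFieldTopology.Exports.

Local Open Scope classical_set_scope.
Local Open Scope ring_scope.

(** * Chains and fillings in the Cayley 2-complex *)

(** The difficulty is that second homology of the Cayley 2-complex of G need not vanish: a cycle has
    many fillings, the support is known only for the one coming from H, and the norm only for the
    minimal one. The map p makes the two comparable because it is blind to the choice of filling. In
    homological terms, (m, q) is a chain map in degrees 1 and 2 from the bar resolution of G to the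
    chains of the Cayley complex which extends by 0 in degree 3; this is what a resolution of length
    two provides. The K(G,1) may have infinitely many cells, and the squares and cubes mapped to it
    are merely continuous; primitives of locally defined cochains on these cubes take the place of
    cellular approximation. Sums of such a primitive along a subdivided path depend on the
    subdivision. Only sums of local cocycles stabilize, for instance of the difference of two
    primitives of one cochain, and [m] and [q] are arranged so that only such sums remain.
    Triviality of pi_2 concerns maps of a square that are constant on its boundary. A tetrahedron is
    therefore treated as a cube with one constant face, and its other five faces are laid out on a
    square. *)

Ltac chain_ring :=
  apply/malgP => ?; rewrite ?(mcoeffD, mcoeffN, mcoeff0); ring.

Lemma boundaryEw (K K' : choiceType) (bd : K -> chain K') (c : chain K) (D : {fset K}) :
  {subset msupp c <= D} -> boundary bd c = \sum_(k <- D) bd k *~ c@_k.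
Proof.
move=> sub; rewrite /boundary (big_fset_incl _ (B := D)) //; first exact/fsubsetP.
by move=> k _ kc; rewrite (mcoeff_outdom kc) mulr0z.
Qed.

Lemma boundary_is_additive (K K' : choiceType) (bd : K -> chain K') : additive (boundary bd).
Proof.
move=> c d.
have sc : {subset msupp c <= msupp c `|` msupp d}%fset.
  by move=> k kc; rewrite inE kc.
have sd : {subset msupp d <= msupp c `|` msupp d}%fset.
  by move=> k kc; rewrite inE kc orbT.
have scd : {subset msupp (c - d) <= msupp c `|` msupp d}%fset.
  by apply/fsubsetP/msuppB_le.
rewrite (boundaryEw bd sc) (boundaryEw bd sd) (boundaryEw bd scd) -sumrB.
by apply: eq_bigr => k _; rewrite mcoeffB mulrzBr.
Qed.

HB.instance Definition _ (K K' : choiceType) (bd : K -> chain K') :=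
  GRing.isAdditive.Build (chain K) (chain K') (boundary bd)
    (boundary_is_additive bd).

Section Chains.
Context {K K' K'' : choiceType}.

Lemma boundaryB (bd : K -> chain K') : {morph boundary bd : c d / c - d}.
Proof. exact: raddfB. Qed.

Lemma boundaryU (bd : K -> chain K') k : boundary bd << k >> = bd k.
Proof. by rewrite /boundary msuppU oner_eq0 big_seq_fset1 mcoeffUU. Qed.

Lemma chainE (c : chain K) : c = \sum_(k <- msupp c) << k >> *~ c@_k.
Proof.
rewrite {1}(monalgE c); apply: eq_bigr => k _.
have -> : << c@_k *g k >> = << 1 *~ c@_k *g k >> by rewrite intz.
by rewrite raddfMz.
Qed.

Lemma eq_boundary (f g : K -> chain K') c :
  {in msupp c, f =1 g} -> boundary f c = boundary g c.
Proof.
move=> fg; rewrite /boundary big_seq [RHS]big_seq.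
by apply: eq_bigr => k /fg ->.
Qed.

Lemma boundaryD_fun (f g : K -> chain K') c :
  boundary (fun k => f k + g k) c = boundary f c + boundary g c.
Proof. by rewrite /boundary -big_split; apply: eq_bigr => k _; rewrite mulrzDl. Qed.

Lemma boundaryN_fun (f : K -> chain K') c :
  boundary (fun k => - f k) c = - boundary f c.
Proof. by rewrite /boundary -sumrN; apply: eq_bigr => k _; rewrite mulNrz. Qed.

Lemma boundaryB_fun (f g : K -> chain K') c :
  boundary (fun k => f k - g k) c = boundary f c - boundary g c.
Proof. by rewrite boundaryD_fun boundaryN_fun. Qed.

Lemma boundary0_fun (f : K -> chain K') c : f =1 (fun=> 0) -> boundary f c = 0.
Proof. by move=> f0; rewrite /boundary big1 // => k _; rewrite f0 mul0rz. Qed.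

Lemma boundary_id (c : chain K) : boundary (fun k => << k >>) c = c.
Proof. by rewrite [RHS]chainE. Qed.

Lemma boundary_comp (f : K' -> chain K'') (g : K -> chain K') c :
  boundary f (boundary g c) = boundary (fun k => boundary f (g k)) c.
Proof.
transitivity (boundary f (\sum_(k <- msupp c) g k *~ c@_k)) => //; rewrite raddf_sum /=.
by apply: eq_bigr => k _; rewrite raddfMz.
Qed.

Lemma chain_normEw (c : chain K) (D : {fset K}) :
  {subset msupp c <= D} -> chain_norm c = (\sum_(k <- D) `|c@_k|)%N.
Proof.
move=> sub; rewrite /chain_norm (big_fset_incl _ (B := D)) //.
  exact/fsubsetP.
by move=> k _ kc; rewrite (mcoeff_outdom kc).
Qed.

Lemma chain_norm0 : chain_norm (0 : chain K) = 0%N.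
Proof. by rewrite /chain_norm msupp0 big_seq_fset0. Qed.

Lemma chain_normN (c : chain K) : chain_norm (- c) = chain_norm c.
Proof.
by rewrite /chain_norm msuppN; apply: eq_bigr => k _; rewrite mcoeffN abszN.
Qed.

Lemma chain_normD (c d : chain K) :
  (chain_norm (c + d) <= chain_norm c + chain_norm d)%N.
Proof.
have sc : {subset msupp c <= msupp c `|` msupp d}%fset.
  by move=> k kc; rewrite inE kc.
have sd : {subset msupp d <= msupp c `|` msupp d}%fset.
  by move=> k kc; rewrite inE kc orbT.
have scd : {subset msupp (c + d) <= msupp c `|` msupp d}%fset.
  by apply/fsubsetP/msuppD_le.
rewrite (chain_normEw sc) (chain_normEw sd) (chain_normEw scd) -big_split /=.
by apply: leq_sum => k _; rewrite mcoeffD; lia.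
Qed.

Lemma chain_normB (c d : chain K) :
  (chain_norm (c - d) <= chain_norm c + chain_norm d)%N.
Proof. by rewrite -(chain_normN d) chain_normD. Qed.

Lemma chain_normU (k : K) : chain_norm (<< k >> : chain K) = 1%N.
Proof. by rewrite /chain_norm msuppU oner_eq0 big_seq_fset1 mcoeffUU. Qed.

Lemma chain_norm_eq0 (c : chain K) : chain_norm c = 0%N -> c = 0.
Proof.
move=> c0; apply/malgP => k; rewrite mcoeff0.
have [kc|/mcoeff_outdom //] := boolP (k \in msupp c).
move: c0; rewrite /chain_norm (big_fsetD1 k) //=; lia.
Qed.

(** Here [b] is the sign of the coefficient at [k]: removing one copy of the cell with that sign
    causes no cancellation. The equality, rather than an inequality, makes the greedy extraction of
    paths below lose nothing. *)
Lemma chain_norm_incr (c : chain K) k (b : bool) :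
  (if b then 0 < c@_k else c@_k < 0) ->
  (chain_norm (c - if b then << k >> else - << k >>)).+1 = chain_norm c.
Proof.
move=> ck; set d := (if b then _ else _).
have kc : k \in msupp c by rewrite -mcoeff_neq0; case: b ck {d} => /=; lia.
have sc : {subset msupp (c - d) <= msupp c}.
  move=> j; apply: contraLR; rewrite -!mcoeff_eq0 mcoeffB => /eqP cj.
  have jk : k == j = false by apply/negP => /eqP jk; move: kc; rewrite -mcoeff_neq0 jk cj.
  by rewrite cj /d; case: (b); rewrite ?mcoeffN mcoeffU jk.
rewrite (chain_normEw sc) /chain_norm (big_fsetD1 k) //= [in RHS](big_fsetD1 k) //=.
have -> : (\sum_(i <- (msupp c `\ k)%fset) `|(c - d)@_i| =
           \sum_(i <- (msupp c `\ k)%fset) `|c@_i|)%N.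
  rewrite !big_seq; apply: eq_bigr => j; rewrite !inE => /andP[jk _].
  rewrite mcoeffB /d; case: (b); rewrite ?mcoeffN mcoeffU eq_sym (negbTE jk) /=; lia.
rewrite mcoeffB /d; move: ck; case: (b); rewrite ?mcoeffN mcoeffU eqxx /=; lia.
Qed.

End Chains.

Lemma chain_norm_sum (I : Type) (K : choiceType) (s : seq I) (P : pred I) (F : I -> chain K) :
  (chain_norm (\sum_(i <- s | P i) F i) <= \sum_(i <- s | P i) chain_norm (F i))%N.
Proof.
apply: (big_ind2 (fun (c : chain K) n => chain_norm c <= n)%N) => //.
  by rewrite chain_norm0.
by move=> c m d n cm dn; apply: leq_trans (chain_normD c d) (leq_add cm dn).
Qed.

Lemma chain_normMz (K : choiceType) (c : chain K) (n : int) :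
  (chain_norm (c *~ n) <= chain_norm c * `|n|)%N.
Proof.
have H (m : nat) : (chain_norm (c *+ m) <= chain_norm c * m)%N.
  elim: m => [|m IH]; first by rewrite mulr0n chain_norm0.
  by rewrite mulrS mulnS; apply: leq_trans (chain_normD _ _) _; rewrite leq_add2l.
case: n => m; first exact: H.
by rewrite NegzE mulrNz chain_normN; apply: leq_trans (H _) _; rewrite abszN.
Qed.

Lemma chain_norm_boundary (K K' : choiceType) (f : K -> chain K') (c : chain K) (B : nat) :
  {in msupp c, forall k, (chain_norm (f k) <= B)%N} ->
  (chain_norm (boundary f c) <= B * chain_norm c)%N.
Proof.
move=> fB; apply: leq_trans (chain_norm_sum _ _ _) _.
rewrite /chain_norm big_distrr /= big_seq [X in (_ <= X)%N]big_seq.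
apply: leq_sum => k kc; apply: leq_trans (chain_normMz _ _) _.
by rewrite leq_mul2r fB ?orbT.
Qed.

Lemma msupp_boundary (K K' : choiceType) (f : K -> chain K') (c : chain K) k' :
  k' \in msupp (boundary f c) -> exists2 k, k \in msupp c & k' \in msupp (f k).
Proof.
apply: contraPP => /forall2NP H; apply/negP; rewrite -mcoeff_eq0; apply/eqP.
transitivity ((\sum_(k <- msupp c) f k *~ c@_k)@_k') => //; rewrite raddf_sum /= big_seq big1 // => k kc.
have [//|/negP kf] := H k; rewrite raddfMz /= mcoeff_outdom ?mul0rz //.
Qed.

Lemma nat_min_le (P : set nat) n : P n -> (nat_min P <= n)%N /\ P (nat_min P).
Proof.
move=> Pn; rewrite /nat_min; case: xgetP => [m _ [Pm mP] | none].
  by split => //; apply: mP.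
have ex : exists k, `[< P k >] by exists n; apply/asboolP.
case: (ex_minnP ex) => m /asboolP Pm mP.
by have := none m; case; split => // k /asboolP; apply: mP.
Qed.

(** [nat_max] falls back to 0 on unbounded sets, so a bound must be known before any element can be
    compared with it. *)
Lemma nat_max_ge (P : set nat) B n :
  (forall k, P k -> (k <= B)%N) -> P n -> (n <= nat_max P)%N.
Proof.
move=> PB Pn; rewrite /nat_max; case: xgetP => [m _ [Pm mP] | none].
  exact: mP.
have ex : exists k, `[< P k >] by exists n; apply/asboolP.
have exB k : `[< P k >] -> (k <= B)%N by move/asboolP/PB.
case: (ex_maxnP ex exB) => m /asboolP Pm mP.
by have := none m; case; split => // k /asboolP; apply: mP.
Qed.

Lemma nat_max_le (P : set nat) B :
  (forall k, P k -> (k <= B)%N) -> (nat_max P <= B)%N.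
Proof.
by move=> PB; rewrite /nat_max; case: xgetP => [m _ [/PB]|].
Qed.

Section Cayley.
Context {G : groupType} (P : finite_presentation G).
Local Notation val := (word_val (@pgen_val G P)).
Local Notation bd1 := (cover_bd1 (P := P)).
Local Notation bd2 := (cover_bd2 (P := P)).
Local Notation pc := (path_chain (P := P)).
Implicit Types (g h : G) (w u v : gword (pgen P)).

Lemma word_val_nil : val [::] = 1%g.
Proof. by rewrite /word_val big_nil. Qed.

Lemma word_val_cons x w : val (x :: w) = (letter_val (@pgen_val G P) x * val w)%g.
Proof. by rewrite /word_val big_cons. Qed.

Lemma word_val_cat u v : val (u ++ v) = (val u * val v)%g.
Proof. by rewrite /word_val big_cat. Qed.

Definition inv_word w := rev [seq (x.1, ~~ x.2) | x <- w].

Lemma letter_val_neg x :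
  letter_val (@pgen_val G P) (x.1, ~~ x.2) = (letter_val (@pgen_val G P) x)^-1%g.
Proof. by case: x => s [] //=; rewrite /letter_val /= invgK. Qed.

Lemma inv_word_cons x w : inv_word (x :: w) = inv_word w ++ [:: (x.1, ~~ x.2)].
Proof. by rewrite /inv_word /= rev_cons cats1. Qed.

Lemma word_val_inv w : val (inv_word w) = (val w)^-1%g.
Proof.
elim: w => [|x w IH]; first by rewrite /inv_word /= word_val_nil invg1.
rewrite inv_word_cons word_val_cat !word_val_cons word_val_nil mulg1 IH.
by rewrite letter_val_neg invgM.
Qed.

Lemma path_chain_cat g u v : pc g (u ++ v) = pc g u + pc (g * val u)%g v.
Proof.
elim: u g => [|x u IH] g /=; first by rewrite word_val_nil mulg1 add0r.
by rewrite IH word_val_cons mulgA addrA.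
Qed.

Lemma boundary_path_chain g w :
  boundary bd1 (pc g w) = << (g * val w)%g >> - << g >>.
Proof.
elim: w g => [|x w IH] g /=; first by rewrite raddf0 word_val_nil mulg1 subrr.
rewrite raddfD /= IH word_val_cons mulgA; case: x => s [] /=.
  by rewrite boundaryU /cover_bd1 /letter_val /= [_ + (_ - _)]addrC addrA subrK.
rewrite raddfN /= boundaryU /cover_bd1 /letter_val /= -mulgA mulVg mulg1.
by rewrite opprB [_ + (_ - _)]addrC addrA subrK.
Qed.

Lemma path_chain_inv g w : pc (g * val w)%g (inv_word w) = - pc g w.
Proof.
elim: w g => [|x w IH] g /=; first by rewrite oppr0.
rewrite inv_word_cons path_chain_cat word_val_cons mulgA IH word_val_inv mulgK /=.
rewrite opprD addrC addr0; congr (_ - _).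
case: x => s [] /=; rewrite /letter_val /= ?invgK ?opprK ?mulgK ?mulgVK //.
Qed.

(** Left translation by [g] on chains whose cells are the translates of [S]. Written as a
    [boundary], it inherits additivity and the composition rules. *)
Definition shift (S : choiceType) g (c : chain (G * S)%type) :
  chain (G * S)%type := boundary (fun e => << ((g * e.1)%g, e.2) >>) c.
HB.instance Definition _ (S : choiceType) g :=
  GRing.Additive.copy (@shift S g) (boundary (fun e => << ((g * e.1)%g, e.2) >>)).

Lemma shiftU (S : choiceType) g (e : G * S) : shift g << e >> = << ((g * e.1)%g, e.2) >>.
Proof. exact: boundaryU. Qed.

Lemma shiftB (S : choiceType) g : {morph @shift S g : c d / c - d}.
Proof. exact: raddfB. Qed.

Lemma shiftD (S : choiceType) g : {morph @shift S g : c d / c + d}.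
Proof. exact: raddfD. Qed.

Lemma shift_boundary (K : choiceType) (S : choiceType) g (f : K -> chain (G * S)%type) c :
  shift g (boundary f c) = boundary (fun k => shift g (f k)) c.
Proof. exact: boundary_comp. Qed.

Lemma boundary_shift (K : choiceType) (S : choiceType) g (f : G * S -> chain K) c :
  boundary f (shift g c) = boundary (fun e => f ((g * e.1)%g, e.2)) c.
Proof. by rewrite boundary_comp; apply: eq_boundary => e _; rewrite boundaryU. Qed.

Lemma shift1 (S : choiceType) (c : chain (G * S)%type) : shift 1%g c = c.
Proof.
by rewrite -[RHS]boundary_id; apply: eq_boundary => -[g s] _; rewrite mul1g.
Qed.

Lemma shiftM (S : choiceType) g h (c : chain (G * S)%type) :
  shift (g * h)%g c = shift g (shift h c).
Proof.
rewrite /shift boundary_comp; apply: eq_boundary => -[k s] _ /=.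
by rewrite boundaryU mulgA.
Qed.

Lemma chain_norm_shift (S : choiceType) g (c : chain (G * S)%type) :
  (chain_norm (shift g c) <= chain_norm c)%N.
Proof.
rewrite -[X in (_ <= X)%N]mul1n; apply: chain_norm_boundary => k _.
by rewrite chain_normU.
Qed.

Lemma path_chain_shift g h w : pc (g * h)%g w = shift g (pc h w).
Proof.
elim: w h => [|[s b] w IH] h /=; first by rewrite raddf0.
rewrite raddfD /= -mulgA IH; congr (_ + _).
by case: b; rewrite ?raddfN /= shiftU.
Qed.

Lemma bd2_shift g h r : bd2 ((g * h)%g, r) = shift g (bd2 (h, r)).
Proof. exact: path_chain_shift. Qed.

Lemma boundary_bd2_shift g c : boundary bd2 (shift g c) = shift g (boundary bd2 c).
Proof.
rewrite /shift !boundary_comp; apply: eq_boundary => -[h r] _ /=.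
by rewrite boundaryU bd2_shift.
Qed.

Lemma bd1_bd2 c : boundary bd1 (boundary bd2 c) = 0.
Proof.
rewrite boundary_comp; apply: boundary0_fun => -[h r].
by rewrite boundary_path_chain prel_holds mulg1 subrr.
Qed.

(** A cancelling pair of letters contributes opposite edges, hence nothing; a relator read after [u]
    contributes the boundary of the 2-cell at [g * val u]. The remaining constructors negate and add
    fillings. *)
Lemma word_equiv_filling w w' : word_equiv (@prel_word G P) w w' ->
  val w = val w' /\ forall g, exists c, boundary bd2 c = pc g w - pc g w'.
Proof.
elim=> {w w'} [w|w w' _ [vw IH]|u v w _ [uv IH1] _ [vw IH2]|u v s b|u v r].
- by split => // g; exists 0; rewrite raddf0 subrr.
- split => // g; have [c cE] := IH g.
  by exists (- c); rewrite raddfN /= cE opprB.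
- split => [|g]; first exact: etrans vw.
  have [c cE] := IH1 g; have [d dE] := IH2 g.
  by exists (c + d); rewrite raddfD /= cE dE addrA subrK.
- have -> : [:: (s, b); (s, ~~ b)] = [:: (s, b)] ++ inv_word [:: (s, b)] by [].
  split => [|g].
    by rewrite !word_val_cat word_val_inv mulgV mul1g.
  exists 0; rewrite raddf0 !path_chain_cat path_chain_inv word_val_cat word_val_inv mulgV mulg1.
  by rewrite subrr add0r subrr.
- split => [|g]; first by rewrite !word_val_cat prel_holds mul1g.
  exists << ((g * val u)%g, r) >>; rewrite boundaryU /cover_bd2 /=.
  rewrite !path_chain_cat prel_holds mulg1 opprD addrACA subrr add0r.
  by rewrite -addrA subrr addr0.
Qed.

(** The implication is placed under the existential so that [fill_word] is a total function of
    words. *)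
Lemma loop_filling w : exists c, val w = 1%g -> boundary bd2 c = pc 1%g w.
Proof.
have [w1|w1] := EM (val w = 1%g); last by exists 0 => /w1.
have [_ /(_ 1%g) [c cE]] := word_equiv_filling (prel_complete w1).
by exists c => _; rewrite cE subr0.
Qed.

Definition fill_word w : chain (G * prel P)%type := projT1 (cid (loop_filling w)).

Lemma bd_fill_word g w : val w = 1%g -> boundary bd2 (shift g (fill_word w)) = pc g w.
Proof.
move=> w1; rewrite boundary_bd2_shift /fill_word.
by case: cid => c /= -> //; rewrite -path_chain_shift mulg1.
Qed.

(** Shortness is not asked for: this is an arbitrary chosen word with value [g]. *)
Definition geod g : gword (pgen P) := projT1 (cid (@pgen_generates G P g)).

Lemma word_val_geod g : val (geod g) = g.
Proof. by rewrite /geod; case: cid. Qed.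

(** Join every vertex to 1 by a chosen path. Replacing each edge by the loop through the paths of
    its two ends changes a chain by a function of its boundary, hence does not change a cycle, and
    each loop has a filling. *)
Lemma cycle_boundary (z : chain (G * pgen P)%type) :
  boundary bd1 z = 0 -> exists c, boundary bd2 c = z.
Proof.
move=> z0; pose tree g := pc 1%g (geod g).
pose loop (e : G * pgen P) := geod e.1 ++ (e.2, true) :: inv_word (geod (e.1 * pgen_val e.2)%g).
have loop1 e : val (loop e) = 1%g.
  by rewrite word_val_cat word_val_cons word_val_inv !word_val_geod /letter_val /= mulgA mulgV.
exists (boundary (fun e => fill_word (loop e)) z); rewrite boundary_comp.
have -> : boundary (fun e => boundary bd2 (fill_word (loop e))) z =
          z - boundary tree (boundary bd1 z).
  rewrite boundary_comp -[X in X - _]boundary_id -boundaryB_fun.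
  apply: eq_boundary => e _; rewrite -[fill_word _]shift1 bd_fill_word //.
  rewrite path_chain_cat /= word_val_geod mul1g /letter_val /=.
  have -> h : pc h (inv_word (geod h)) = - tree h.
    by rewrite /tree -path_chain_inv word_val_geod mul1g.
  rewrite raddfB /= !boundaryU -/(tree _) -surjective_pairing opprB.
  by rewrite addrCA.
by rewrite z0 raddf0 subr0.
Qed.

End Cayley.

(** * Decomposition of cycles into loops and finiteness of the filling function *)

Lemma finite_bound (T : eqType) (s : seq T) (f : T -> nat) :
  exists B, {in s, forall x, (f x <= B)%N}.
Proof. by exists (\max_(x <- s) f x) => x xs; apply: leq_bigmax_seq. Qed.

Lemma words_finite (S : finType) l :
  exists s : seq (seq S), forall w : seq S, (size w <= l)%N -> w \in s.
Proof.
elim: l => [|l [s sP]]; first by exists [:: [::]] => w; rewrite leqn0 size_eq0 inE.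
exists ([::] :: [seq x :: w | x <- enum S, w <- s]) => -[|x w] //= wl.
by rewrite inE /=; apply/allpairsP; exists (x, w); split => //=;
  [rewrite mem_enum | apply: sP].
Qed.

Section FillingBound.
Context {G : groupType} (P : finite_presentation G).
Local Notation val := (word_val (@pgen_val G P)).
Local Notation bd1 := (cover_bd1 (P := P)).
Local Notation bd2 := (cover_bd2 (P := P)).
Local Notation pc := (path_chain (P := P)).
Implicit Types (g h : G) (w u v : gword (pgen P)).

(** If no edge of [z], read with the sign of its coefficient, left [g], then every term of the
    coefficient of the boundary at [g] would be nonnegative. *)
Lemma outgoing_letter (z : chain (G * pgen P)%type) g :
  (boundary bd1 z)@_g < 0 ->
  exists x, (chain_norm (z - pc g [:: x])).+1 = chain_norm z.
Proof.
have -> : (boundary bd1 z)@_g =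
    \sum_(e <- msupp z) ((e.1 * pgen_val e.2 == g)%g%:R - (e.1 == g)%:R) *~ z@_e.
  transitivity ((\sum_(e <- msupp z) bd1 e *~ z@_e)@_g) => //.
  rewrite raddf_sum; apply: eq_bigr => e _ /=.
  by rewrite raddfMz /= /cover_bd1 mcoeffB !mcoeffU.
move=> neg; have [e ez Ne] : exists2 e, e \in msupp z &
    ((e.1 * pgen_val e.2 == g)%g%:R - (e.1 == g)%:R) *~ z@_e < 0 :> int.
  apply: contraPP neg => /forall2NP H; apply/negP; rewrite -leNgt big_seq.
  apply: sumr_ge0 => e ez; have [//|/negP] := H e; by rewrite leNgt.
move: Ne; case: (eqVneq e.1 g) => [eg|_].
  case: eqP => [_|_]; rewrite ?subrr ?mul0rz ?ltxx // sub0r mulNrz intz oppr_lt0 => ze.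
  exists (e.2, true); rewrite /= addr0 -eg -surjective_pairing.
  exact: (chain_norm_incr (b := true)).
case: eqP => [eg|_]; rewrite subr0 ?mul0rz ?ltxx // intz => ze.
exists (e.2, false); rewrite /= addr0 /letter_val /= -eg mulgK -surjective_pairing.
exact: (chain_norm_incr (b := false)).
Qed.

(** Follow outgoing letters from [g]. Each one lowers the norm by one, and the coefficient at the
    current vertex stays negative until [h] is reached, so the walk cannot stop elsewhere. *)
Lemma path_extraction (z : chain (G * pgen P)%type) g h :
  boundary bd1 z = << h >> - << g >> -> g != h ->
  exists w, (g * val w)%g = h /\
    (size w + chain_norm (z - pc g w))%N = chain_norm z.
Proof.
move nE : (chain_norm z) => n; elim: n z nE g => [|n IH] z nE g zE gh.
  move: zE; rewrite (chain_norm_eq0 nE) raddf0 => /esym /(congr1 (mcoeff g)) /eqP.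
  by rewrite mcoeffB mcoeff0 !mcoeffU eqxx [h == g]eq_sym (negbTE gh).
have [] := @outgoing_letter z g.
  by rewrite zE mcoeffB !mcoeffU eqxx [h == g]eq_sym (negbTE gh).
move=> x; rewrite nE => -[xE]; pose g' := (g * val [:: x])%g.
have zE' : boundary bd1 (z - pc g [:: x]) = << h >> - << g' >>.
  by rewrite boundaryB boundary_path_chain zE opprB addrA subrK.
have [gh'|gh'] := eqVneq g' h; first by exists [:: x]; rewrite /= -xE add1n.
have [w [vw wE]] := IH _ xE g' zE' gh'.
exists (x :: w); rewrite -cat1s word_val_cat mulgA vw; split=> //.
by rewrite path_chain_cat opprD addrA /= addSn wE.
Qed.

(** Removing one edge of [z] leaves a chain from its end back to its start, from which a returning
    path is extracted. The loop is thus subtracted without cancellation. *)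
Lemma loop_extraction (z : chain (G * pgen P)%type) :
  boundary bd1 z = 0 -> z != 0 ->
  exists g w, [/\ w != [::], val w = 1%g &
    (size w + chain_norm (z - pc g w))%N = chain_norm z].
Proof.
move=> z0 zn; have [e ez] : exists e, e \in msupp z.
  case: (fset_0Vmem (msupp z)) => [e0|[e ez]]; last by exists e.
  by move: zn; rewrite (chainE z) e0 big_seq_fset0 eqxx.
have [g [x xE]] : exists g x, (chain_norm (z - pc g [:: x])).+1 = chain_norm z.
  move: ez; rewrite -mcoeff_neq0; case: (ltrgtP z@_e 0) => // ze _.
    exists (e.1 * pgen_val e.2)%g, (e.2, false).
    rewrite /= addr0 /letter_val /= mulgK -surjective_pairing.
    exact: (chain_norm_incr (b := false)).
  exists e.1, (e.2, true); rewrite /= addr0 -surjective_pairing.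
  exact: (chain_norm_incr (b := true)).
pose g' := (g * val [:: x])%g.
have zE' : boundary bd1 (z - pc g [:: x]) = << g >> - << g' >>.
  by rewrite boundaryB boundary_path_chain z0 opprB add0r.
have [gg|gg] := eqVneq g' g.
  by exists g, [:: x]; split; [|apply: (mulgI g); rewrite mulg1|rewrite -xE add1n].
have [w [vw wE]] := path_extraction zE' gg.
exists g, (x :: w); split => //.
  by apply: (mulgI g); rewrite mulg1 -cat1s word_val_cat mulgA.
by rewrite -cat1s path_chain_cat opprD addrA size_cat -addnA wE add1n.
Qed.

(** This makes the maximum in [Fill2] a genuine one. A cycle of norm at most [l] is a sum of at most
    [l] loops of length at most [l], and up to translation there are finitely many such loops. *)
Lemma cycle_filling_bound l : exists B, forall z : chain (G * pgen P)%type,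
  boundary bd1 z = 0 -> (chain_norm z <= l)%N ->
  exists c, boundary bd2 c = z /\ (chain_norm c <= B)%N.
Proof.
have [s sP] := words_finite (pgen P * bool)%type l.
have [B BP] := finite_bound s (fun w => chain_norm (fill_word w)).
(* Each loop uses up at least one unit of norm and costs at most [B]; keeping [n <= l] ensures that
   its word is in the list [s]. *)
suff H n (z : chain (G * pgen P)%type) : boundary bd1 z = 0 -> (chain_norm z <= n)%N ->
    (n <= l)%N -> exists c, boundary bd2 c = z /\ (chain_norm c <= B * n)%N.
  by exists (B * l)%N => z z0 zl; apply: H.
elim: n z => [|n IH] z z0 zn nl.
  exists 0; rewrite raddf0 chain_norm0; split => //.
  by apply/esym/chain_norm_eq0; lia.
have [->|zn0] := eqVneq z 0; first by exists 0; rewrite raddf0 chain_norm0.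
have [g [w [wn w1 wE]]] := loop_extraction z0 zn0.
have ws : (0 < size w)%N by case: (w) wn.
have [|||c [cE cB]] := IH (z - pc g w).
- by rewrite boundaryB z0 boundary_path_chain w1 mulg1 subrr subr0.
- lia.
- lia.
exists (c + shift g (fill_word w)); rewrite raddfD /= cE bd_fill_word // subrK; split => //.
apply: leq_trans (chain_normD _ _) _; rewrite mulnS addnC leq_add //.
apply: leq_trans (chain_norm_shift _ _) _; apply: BP; apply: sP.
by apply: leq_trans nl; apply: leq_trans zn; rewrite -wE leq_addr.
Qed.

Lemma FVol_filling (z : chain (G * pgen P)%type) : boundary bd1 z = 0 ->
  exists2 c, boundary bd2 c = z & chain_norm c = FVol bd2 z.
Proof.
move=> /cycle_boundary[c cE].
by have [_] := @nat_min_le [set n | exists2 c, boundary bd2 c = z & chain_norm c = n]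
  (chain_norm c) (ex_intro2 _ _ c cE erefl).
Qed.

Lemma FVol_le (c : chain (G * prel P)%type) (z : chain (G * pgen P)%type) : boundary bd2 c = z ->
  (FVol bd2 z <= chain_norm c)%N.
Proof.
move=> cE; have [] := @nat_min_le [set n | exists2 c, boundary bd2 c = z & chain_norm c = n]
  (chain_norm c) (ex_intro2 _ _ c cE erefl) => //.
Qed.

Lemma FVol_le_Fill2 (z : chain (G * pgen P)%type) l : boundary bd1 z = 0 ->
  (chain_norm z <= l)%N -> (FVol bd2 z <= group_Fill2 P l)%N.
Proof.
move=> z0 zl; have [B BP] := cycle_filling_bound l.
apply: (nat_max_ge (B := B)); last by exists z.
move=> _ [y [y0 yl <-]]; have [c [cE cB]] := BP y y0 yl.
exact: leq_trans (FVol_le cE) cB.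
Qed.

End FillingBound.

(** * Coarse embeddings and filling functions *)

Section Splitting.
Context {G : groupType} (P : finite_presentation G).
Local Notation val := (word_val (@pgen_val G P)).
Local Notation bd1 := (cover_bd1 (P := P)).
Local Notation bd2 := (cover_bd2 (P := P)).
Local Notation pc := (path_chain (P := P)).

Definition equivariant_extension (p0 : prel P -> chain (G * prel P)%type) :
    chain (G * prel P)%type -> chain (G * prel P)%type :=
  boundary (fun e => shift e.1 (p0 e.2)).

(* An equivariant section of [cover_bd2] on its image, composed with [cover_bd2]. *)
Definition cycles_split : Prop := exists p0, forall c,
  boundary bd2 (equivariant_extension p0 c) = boundary bd2 c /\
  (boundary bd2 c = 0 -> equivariant_extension p0 c = 0).

Lemma shiftE (S : choiceType) (g h : G) (e : S) : shift g << (h, e) >> = << ((g * h)%g, e) >>.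
Proof. exact: shiftU. Qed.

(** With [theta s] a filling of the difference of [m s] and the edge of [s], send the edge [(g, s)]
    to [q g s] minus the [g]-translate of [theta s]. Its boundary is the edge up to [m] applied to
    the boundary of the edge, and by the cocycle identity translation by [g] changes it by [q g]
    applied to that boundary. Both errors vanish on cycles. *)
Lemma cocycle_cycles_split (m : G -> chain (G * pgen P)%type)
    (q : G -> G -> chain (G * prel P)%type) :
  (forall g, boundary bd1 (m g) = << g >> - << 1%g >>) ->
  (forall g h, boundary bd2 (q g h) = m g + shift g (m h) - m (g * h)%g) ->
  (forall g h k, q (g * h)%g k = shift g (q h k) + q g (h * k)%g - q g h) ->
  cycles_split.
Proof.
move=> mE qE qC.
have thetaP s : exists c, boundary bd2 c = m (pgen_val s) - << (1%g, s) >>.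
  apply: cycle_boundary; rewrite boundaryB mE boundaryU /cover_bd1 /= mul1g.
  by rewrite subrr.
pose theta s := projT1 (cid (thetaP s)).
have thetaE s : boundary bd2 (theta s) = m (pgen_val s) - << (1%g, s) >>.
  by rewrite /theta; case: cid.
(* A section of the boundary, equivariant only on cycles. *)
pose sig := boundary (fun e : G * pgen P => q e.1 (pgen_val e.2) - shift e.1 (theta e.2)).
have sigE z : boundary bd1 z = 0 -> boundary bd2 (sig z) = z.
  move=> z0; rewrite boundary_comp.
  transitivity (z - boundary m (boundary bd1 z)); last by rewrite z0 raddf0 subr0.
  rewrite boundary_comp -[X in _ = X - _]boundary_id -boundaryB_fun.
  apply: eq_boundary => -[g s] _ /=.
  rewrite !boundaryB boundary_bd2_shift thetaE qE !boundaryU.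
  by rewrite shiftB shiftE mulg1; chain_ring.
have sigS g z : boundary bd1 z = 0 -> sig (shift g z) = shift g (sig z).
  move=> z0; transitivity (shift g (sig z) + boundary (q g) (boundary bd1 z)); last first.
    by rewrite z0 raddf0 addr0.
  rewrite /sig boundary_shift shift_boundary boundary_comp -boundaryD_fun.
  apply: eq_boundary => -[h s] _; rewrite /= qC shiftM shiftB boundaryB !boundaryU.
  by chain_ring.
(* The boundary of a 2-cell is a cycle, where [sig] is equivariant; so extending equivariantly from
   the cells at 1 gives [sig] after [bd2] on all chains. *)
have p0E c : equivariant_extension (fun r => sig (bd2 (1%g, r))) c = sig (boundary bd2 c).
  rewrite /equivariant_extension /sig [RHS]boundary_comp; apply: eq_boundary => -[g r] _ /=.
  rewrite -/sig -sigS -?bd2_shift ?mulg1 //.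
  by rewrite boundary_path_chain prel_holds mulg1 subrr.
exists (fun r => sig (bd2 (1%g, r))) => c; rewrite p0E; split; last by move=> ->; exact: raddf0.
by rewrite sigE // bd1_bd2.
Qed.

End Splitting.

(** * Chain maps induced by maps between groups *)

Section InducedMap.
Context {G H : groupType} (PG : finite_presentation G) (PH : finite_presentation H).
Variable F : G -> H.
Local Notation valG := (word_val (@pgen_val G PG)).
Local Notation valH := (word_val (@pgen_val H PH)).
Local Notation letterG := (letter_val (@pgen_val G PG)).
Implicit Types (g : G) (h : H).

(** An inverse letter is sent to the inverse of the word chosen for the forward edge, not to a word
    chosen afresh; thus opposite edges have opposite images and [path_chain_image] holds on the
    nose. *)
Definition image_letter g (x : pgen PG * bool) : gword (pgen PH) :=
  if x.2 then geod PH ((F g)^-1 * F (g * letterG x))%g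
  else inv_word (geod PH ((F (g * letterG x))^-1 * F g)%g).

Fixpoint image_word g (w : gword (pgen PG)) : gword (pgen PH) :=
  if w is x :: w' then image_letter g x ++ image_word (g * letterG x)%g w'
  else [::].

Definition image_chain1 (e : G * pgen PG) : chain (H * pgen PH)%type :=
  path_chain (F e.1) (geod PH ((F e.1)^-1 * F (e.1 * pgen_val e.2))%g).

(** As [F] is not a homomorphism, the loop to be filled depends on the base point of the cell and
    not only on the relator. *)
Definition image_chain2 (c : G * prel PG) : chain (H * prel PH)%type :=
  shift (F c.1) (fill_word (image_word c.1 (prel_word c.2))).

Lemma word_val_image_letter g x :
  valH (image_letter g x) = ((F g)^-1 * F (g * letterG x))%g.
Proof.
rewrite /image_letter; case: x => s [] /=; first by rewrite word_val_geod.
by rewrite word_val_inv word_val_geod invgM invgK.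
Qed.

Lemma word_val_image g w : valH (image_word g w) = ((F g)^-1 * F (g * valG w))%g.
Proof.
elim: w g => [|x w IH] g; first by rewrite !word_val_nil mulg1 mulVg.
by rewrite /= word_val_cat IH word_val_image_letter word_val_cons !mulgA mulgK.
Qed.

Lemma path_chain_image g w :
  path_chain (F g) (image_word g w) = boundary image_chain1 (path_chain g w).
Proof.
elim: w g => [|[s b] w IH] g /=; first by rewrite raddf0.
rewrite path_chain_cat word_val_image_letter mulVKg IH raddfD /=; congr (_ + _).
rewrite /image_letter /letter_val; case: b => /=.
  by rewrite boundaryU.
rewrite raddfN /= boundaryU /image_chain1 /= mulgVK.
by rewrite -path_chain_inv word_val_geod mulVKg.
Qed.

Lemma bd_image_chain2 c : boundary (cover_bd2 (P := PH)) (boundary image_chain2 c) =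
  boundary image_chain1 (boundary (cover_bd2 (P := PG)) c).
Proof.
rewrite !boundary_comp; apply: eq_boundary => -[g r] _.
rewrite bd_fill_word; first exact: path_chain_image.
by rewrite word_val_image /= prel_holds mulg1 mulVg.
Qed.

Lemma bd_image_chain1 z : boundary (cover_bd1 (P := PH)) (boundary image_chain1 z) =
  boundary (fun g => << F g >>) (boundary (cover_bd1 (P := PG)) z).
Proof.
rewrite !boundary_comp; apply: eq_boundary => -[g s] _.
by rewrite boundary_path_chain word_val_geod mulVKg boundaryB !boundaryU.
Qed.

(** Displacements are taken along forward edges, matching [image_letter]. A finite [S] leaves
    finitely many image words for a given [w], independently of the starting point; all uniform
    constants come from this. *)
Fixpoint controlled (S : seq H) g (w : gword (pgen PG)) : Prop :=
  if w is x :: w' then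
    ((if x.2 then (F g)^-1 * F (g * letterG x) else (F (g * letterG x))^-1 * F g)%g
      \in S) /\ controlled S (g * letterG x)%g w'
  else True.

(** The set [N] is there because a coarse inverse has controlled displacements only near the image
    of the embedding; it suffices that all vertices of the path lie in [N]. *)
Lemma controlledP (N : set G) (S : seq H) g w :
  (forall g (s : pgen PG), N g -> N (g * pgen_val s)%g -> ((F g)^-1 * F (g * pgen_val s))%g \in S) ->
  (forall u v, w = u ++ v -> N (g * valG u)%g) -> controlled S g w.
Proof.
move=> NS; elim: w g => [//|x w IH] g Nw.
have N0 : N g by have := Nw [::] _ erefl; rewrite word_val_nil mulg1.
have N1 : N (g * letterG x)%g.
  by have := Nw [:: x] _ erefl; rewrite word_val_cons word_val_nil mulg1.
split.
  case: x N1 {Nw} => s []; rewrite /letter_val /= => N1; first exact: NS.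
  by have := NS (g * (pgen_val s)^-1)%g s N1; rewrite mulgVK; apply.
apply: IH => u v wE; have := Nw (x :: u) v; rewrite wE word_val_cons mulgA; exact.
Qed.

Lemma controlled_words_finite (S : seq H) w :
  exists L : seq (gword (pgen PH)), forall g, controlled S g w -> image_word g w \in L.
Proof.
elim: w => [|x w [L LP]]; first by exists [:: [::]] => g _; rewrite inE.
exists [seq (if x.2 then geod PH s else inv_word (geod PH s)) ++ v | s <- S, v <- L] => g /=.
case=> xS /LP wL; apply/allpairsP.
eexists (_, image_word (g * letterG x)%g w); split; [exact: xS|exact: wL|].
by rewrite /image_letter; case: (x.2).
Qed.

End InducedMap.

Section CoarseInequality.
Context {G H : groupType} (PG : finite_presentation G) (PH : finite_presentation H).
Local Notation valG := (word_val (@pgen_val G PG)).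
Local Notation valH := (word_val (@pgen_val H PH)).

Lemma msupp_shift (G' : groupType) (S : choiceType) (g : G') (c : chain (G' * S)%type) k :
  k \in msupp (shift g c) -> exists2 e, e \in msupp c & k = ((g * e.1)%g, e.2).
Proof.
move=> /msupp_boundary[e ec]; rewrite msuppU oner_eq0 inE => /eqP ->.
by exists e.
Qed.

Lemma chain_norm_path (G' : groupType) (P : finite_presentation G') g (w : gword (pgen P)) :
  (chain_norm (path_chain g w) <= size w)%N.
Proof.
elim: w g => [|[s b] w IH] g /=; first by rewrite chain_norm0.
apply: leq_trans (chain_normD _ _) _; rewrite -add1n leq_add //.
by case: b; rewrite ?chain_normN chain_normU.
Qed.

Lemma uniform_finite (I : finType) (T : eqType) (Q : I -> T -> Prop) :
  (forall i, exists s : seq T, forall x, Q i x -> x \in s) ->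
  exists s : seq T, forall i x, Q i x -> x \in s.
Proof.
move=> /choice[s sP]; exists (flatten [seq s i | i <- enum I]) => i x Qx.
by apply/flattenP; exists (s i); [apply/mapP; exists i; rewrite ?mem_enum | apply: sP].
Qed.

Variable f : H -> G.
(** The control functions enter only through this and the next hypothesis. Finite sets replace
    balls, so that no word metric has to be mentioned. *)
Hypothesis f_expansion : forall k : H, exists S : seq G, forall h, ((f h)^-1 * f (h * k))%g \in S.
Hypothesis f_proper : forall T : seq G, exists T' : seq H,
  forall h h', ((f h)^-1 * f h')%g \in T -> (h^-1 * h')%g \in T'.

(** Choose for [r g] any point whose image is [T]-close to [g]. If [g] and [g * s] are both close to
    the image, then the images of [r g] and [r (g * s)] differ by some [x * s * y^-1] with [x] and
    [y] in [T]; there are finitely many of these, and [f_proper] applies. *)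
Lemma coarse_retraction (T : seq G) : exists (r : G -> H) (S : seq H),
  let N := [set g | exists h, ((f h)^-1 * g)%g \in T] in
  (forall g, N g -> ((f (r g))^-1 * g)%g \in T) /\
  (forall g (s : pgen PG), N g -> N (g * pgen_val s)%g ->
     ((r g)^-1 * r (g * pgen_val s))%g \in S).
Proof.
have /choice[r rP] g : exists y,
    (exists h, ((f h)^-1 * g)%g \in T) -> ((f y)^-1 * g)%g \in T.
  by have [[h hT]|no] := EM (exists h, ((f h)^-1 * g)%g \in T); [exists h | exists 1%g].
have [S SP] := f_proper (flatten [seq [seq (x * pgen_val s * y^-1)%g | x <- T, y <- T] | s <- enum (pgen PG)]).
exists r, S; split => [//|g s /rP gT /rP gsT]; apply: SP.
apply/flattenP; eexists; first by apply/mapP; exists s; rewrite ?mem_enum.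
apply/allpairsP; exists (((f (r g))^-1 * g)%g, ((f (r (g * pgen_val s)))^-1 * (g * pgen_val s))%g).
by split => //=; rewrite invgM invgK mulgA -[X in (X / _ * _)%g]mulgA mulgK.
Qed.

Lemma coarse_fill_prec : cycles_split PG -> fill_prec (group_Fill2 PH) (group_Fill2 PG).
Proof.
move=> [p0 p0P]; set p := equivariant_extension p0 in p0P.
have [S1 S1P] : exists S1 : seq G, forall (s : pgen PH) h, ((f h)^-1 * f (h * pgen_val s))%g \in S1.
  have [|S1 S1P] := @uniform_finite (pgen PH) G
    (fun s x => exists h, x = ((f h)^-1 * f (h * pgen_val s))%g).
    by move=> s; have [S SP] := f_expansion (pgen_val s); exists S => _ [h ->].
  by exists S1 => s h; apply: (S1P s); exists h.
have [L1 L1P] : exists L1 : seq (gword (pgen PG)),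
    forall (r : prel PH) h, image_word PG f h (prel_word r) \in L1.
  have [|L LP] := @uniform_finite (prel PH) (gword (pgen PG))
    (fun r x => exists h, x = image_word PG f h (prel_word r)).
    move=> r; have [L LP] := controlled_words_finite PG f S1 (prel_word r).
    exists L => _ [h ->]; apply: LP; apply: (controlledP (N := setT)) => //.
  by exists L => r h; apply: (LP r); exists h.
(* The image of a 2-cell at [h] is the [f h]-translate of one of finitely many chains, whose cells
   are listed in [K1]. [T0] collects the positions relative to [f h] of the cells that [p] makes out
   of them. *)
pose K1 := flatten [seq (msupp (fill_word w) : seq (G * prel PG)) | w <- L1].
pose T0 := flatten [seq [seq (e.1 * u.1)%g | u <- msupp (p0 e.2)] | e <- K1].
have supp_p c k : k \in msupp (p (boundary (image_chain2 (PG := PH) PG f) c)) ->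
    exists h, ((f h)^-1 * k.1)%g \in T0.
  move=> /msupp_boundary[e /msupp_boundary[[h r] _ /msupp_shift[e' ee' eE]] /msupp_shift[u uu ->]].
  exists h; rewrite eE /= !mulgA mulVg mul1g; apply/flattenP; eexists.
    apply/mapP; exists e' => //; apply/flattenP; eexists; last exact: ee'.
    by apply/mapP; eexists; first exact: (L1P r h).
  by apply/mapP; exists u => //; move: uu; rewrite eE.
pose prefixes (w : gword (pgen PG)) := [seq valG (take i w) | i <- iota 0 (size w).+1].
have prefixP u v : valG u \in prefixes (u ++ v).
  apply/mapP; exists (size u); last by rewrite take_size_cat.
  by rewrite mem_iota size_cat; lia.
(* The neighborhood on which the retraction is needed: the points [f h] themselves, all vertices of
   the 2-cells located by [T0], and all vertices of the paths representing images of edges of H. *)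
pose T3 := 1%g :: [seq (t * v)%g | t <- T0, v <- flatten [seq prefixes (prel_word r) | r <- enum (prel PG)]] ++
  flatten [seq prefixes (geod PG a) | a <- S1].
have [r [S4 /= [rT rS]]] := coarse_retraction T3.
set N := fun g => exists h, ((f h)^-1 * g)%g \in T3 in rT rS.
have Nf h : N (f h) by exists h; rewrite mulVg inE eqxx.
have [L2 L2P] : exists L2 : seq (gword (pgen PH)), forall (k : prel PG) g,
    (exists h, ((f h)^-1 * g)%g \in T0) -> image_word PH r g (prel_word k) \in L2.
  have [|L LP] := @uniform_finite (prel PG) (gword (pgen PH))
    (fun k x => exists2 g, (exists h, ((f h)^-1 * g)%g \in T0) & x = image_word PH r g (prel_word k)).
    move=> k; have [L LP] := controlled_words_finite PH r S4 (prel_word k).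
    exists L => _ [g [h gT] ->]; apply: LP; apply: (controlledP (N := N)) => // u v wE.
    exists h; rewrite mulgA inE mem_cat; apply/orP; right; apply/orP; left.
    apply/allpairsP; exists (((f h)^-1 * g)%g, valG u); split => //=.
    apply/flattenP; exists (prefixes (prel_word k)); last by rewrite wE.
    by apply/mapP; exists k; rewrite ?mem_enum.
  by exists L => k g gT; apply: (LP k); exists g.
have [L3 L3P] : exists L3 : seq (gword (pgen PH)), forall h a, a \in S1 ->
    image_word PH r (f h) (geod PG a) \in L3.
  have [|L LP] := @uniform_finite (seq_sub S1) (gword (pgen PH))
    (fun a x => exists h, x = image_word PH r (f h) (geod PG (ssval a))).
    move=> [a aS]; have [L LP] := controlled_words_finite PH r S4 (geod PG a).
    exists L => _ [h ->]; apply: LP; apply: (controlledP (N := N)) => // u v wE.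
    exists h; rewrite mulKg inE mem_cat; apply/orP; right; apply/orP; right.
    by apply/flattenP; exists (prefixes (geod PG a)); [apply/mapP; exists a | rewrite wE].
  by exists L => h a aS; apply: (LP (SeqSub aS)); exists h.
have [S5 S5P] : exists S5 : seq H, forall h, ((r (f h))^-1 * h)%g \in S5.
  by have [S SP] := f_proper T3; exists S => h; apply: SP; apply: rT; exact: Nf.
pose jw h := inv_word (geod PH ((r (f h))^-1 * h)%g).
have jwV h : (h * valH (jw h))%g = r (f h).
  by rewrite word_val_inv word_val_geod invgM invgK mulVKg.
(* The strip over an edge between the identity and [r] after [f]: along [jw] from its start, along
   the twice-mapped edge, back along [jw] from its end, and back along the edge itself. *)
pose lw (e : H * pgen PH) := jw e.1 ++ image_word PH r (f e.1) (geod PG ((f e.1)^-1 * f (e.1 * pgen_val e.2))%g)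
  ++ inv_word (jw (e.1 * pgen_val e.2)%g) ++ [:: (e.2, false)].
have [L4 L4P] : exists L4 : seq (gword (pgen PH)), forall e, lw e \in L4.
  pose J := [seq inv_word (geod PH b) | b <- S5].
  have JP h : jw h \in J by apply: map_f.
  exists [seq x ++ y | x <- J, y <- [seq x ++ y | x <- L3, y <-
    [seq inv_word x ++ [:: (s, false)] | x <- J, s <- enum (pgen PH)]]].
  move=> [h s]; apply: (allpairs_f (fun x y => x ++ y)) => //.
  apply: (allpairs_f (fun x y => x ++ y)); first by apply: L3P; apply: S1P.
  by apply: (allpairs_f (fun x s => inv_word x ++ [:: (s, false)])); rewrite ?mem_enum.
have lw1 e : valH (lw e) = 1%g.
  rewrite !word_val_cat word_val_image word_val_inv word_val_geod word_val_cons word_val_nil mulg1.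
  have jwE h : valH (jw h) = (h^-1 * r (f h))%g by rewrite -jwV mulKg.
  by rewrite mulVKg /letter_val /= !jwE invgM invgK !mulgA !mulgK mulVg.
have [B2 B2P] := finite_bound L2 (fun w => chain_norm (fill_word w)).
have [B3 B3P] := finite_bound L4 (fun w => chain_norm (fill_word w)).
have [Bp BpP] := finite_bound (enum (prel PG)) (fun k => chain_norm (p0 k)).
have [BL BLP] := finite_bound S1 (fun a => size (geod PG a)).
(* [Bp] bounds the effect of [p] on norms, [B2] the retraction of a 2-cell, [BL] the image of an
   edge and [B3] the filling of a strip; the 1 makes the constant positive. *)
exists (B2 * Bp + BL + B3 + 1)%N => [|n]; first by lia.
apply: nat_max_le => _ [z [z0 zn <-]].
have [c cE] := cycle_boundary z0.
pose z1 := boundary (image_chain1 (PG := PH) PG f) z.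
have z10 : boundary (cover_bd1 (P := PG)) z1 = 0 by rewrite bd_image_chain1 z0 raddf0.
have z1n : (chain_norm z1 <= BL * n)%N.
  apply: leq_trans (leq_mul (leqnn _) zn); apply: chain_norm_boundary => -[h s] _.
  by apply: leq_trans (chain_norm_path _ _) _; apply: BLP; apply: S1P.
have [c0 c0E c0n] := FVol_filling z10.
pose d := p (boundary (image_chain2 (PG := PH) PG f) c).
have dE : d = p c0.
  apply/eqP; rewrite -subr_eq0 -boundaryB; apply/eqP; apply: (p0P _).2.
  by rewrite boundaryB bd_image_chain2 cE c0E subrr.
have dz1 : boundary (cover_bd2 (P := PG)) d = z1 by rewrite dE (p0P c0).1.
(* The retraction of [d] fills the image of [z] under [r] after [f]; the strips over the edges of
   [z] connect this image to [z], their ends cancelling because [z] is a cycle. *)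
pose y := boundary (image_chain2 (PG := PG) PH r) d - boundary (fun e => shift e.1 (fill_word (lw e))) z.
have yE : boundary (cover_bd2 (P := PH)) y = z.
  rewrite boundaryB bd_image_chain2 dz1 [X in _ - X]boundary_comp.
  pose J h := path_chain h (jw h).
  rewrite [X in _ - X](_ : _ = boundary (image_chain1 (PG := PG) PH r) z1 - z - boundary J (boundary (cover_bd1 (P := PH)) z)).
    by rewrite z0 raddf0 subr0 opprB addrCA subrr addr0.
  rewrite [boundary _ z1]boundary_comp [boundary J _]boundary_comp -[X in _ = _ - X - _]boundary_id -!boundaryB_fun.
  apply: eq_boundary => -[h s] _ /=; rewrite bd_fill_word // !path_chain_cat word_val_image !word_val_geod.
  rewrite !jwV mulVKg !mulVKg path_chain_image -{1}jwV path_chain_inv.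
  have vE k : (r (f k) * valH (inv_word (jw k)))%g = k.
    by rewrite word_val_inv -{1}jwV mulgK.
  rewrite vE boundaryB !boundaryU /= /letter_val /= mulgK -!/(J _).
  by chain_ring.
apply: leq_trans (FVol_le yE) _; apply: leq_trans (chain_normB _ _) _.
(* The bound [B2] uses the expression of [d] through [c], which locates its support; the bound on
   its norm uses the equality with [p c0]. *)
have H1 : (chain_norm (boundary (image_chain2 (PG := PG) PH r) d) <= B2 * (Bp * FVol (cover_bd2 (P := PG)) z1))%N.
  apply: (@leq_trans (B2 * chain_norm d)%N).
    apply: chain_norm_boundary => k /supp_p kT.
    apply: leq_trans (chain_norm_shift _ _) _; apply: B2P; exact: L2P.
  rewrite leq_mul2l dE -c0n; apply/orP; right.
  apply: chain_norm_boundary => k _; apply: leq_trans (chain_norm_shift _ _) _.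
  by apply: BpP; rewrite mem_enum.
have H2 : (chain_norm (boundary (fun e => shift e.1 (fill_word (lw e))) z) <= B3 * n)%N.
  apply: leq_trans (leq_mul (leqnn _) zn); apply: chain_norm_boundary => e _.
  by apply: leq_trans (chain_norm_shift _ _) _; apply: B3P.
set C := (_ + 1)%N; have H3 : (FVol (cover_bd2 (P := PG)) z1 <= group_Fill2 PG (C * n + C))%N.
  by apply: FVol_le_Fill2 => //; apply: leq_trans z1n _; rewrite /C; nia.
move: (FVol _ _) (group_Fill2 _ _) H1 H3 => a b H1 H3.
apply: leq_trans (leq_add H1 H2) _; rewrite /C -addnA leq_add //; last by nia.
rewrite mulnA; apply: leq_mul => //; lia.
Qed.

End CoarseInequality.

(** * From control functions to finite sets *)

Section WordBalls.
Context {G : groupType} (A : seq G).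
Hypothesis A_gen : generating_set A.

Lemma word_length_attained (g : G) :
  exists w, [/\ word_in A w, (\prod_(x <- w) x)%g = g & size w = word_length A g].
Proof.
have [w wA wg] := A_gen g.
by have [_] := @nat_min_le [set n | exists w : seq G,
    [/\ word_in A w, (\prod_(x <- w) x)%g = g & size w = n]] (size w)
    (ex_intro _ w (And3 wA wg erefl)).
Qed.

Lemma word_ball_finite (n : nat) :
  exists S : seq G, forall g, (word_length A g <= n)%N -> g \in S.
Proof.
pose A' := A ++ [seq x^-1%g | x <- A].
have wordA' w : word_in A w -> {subset w <= A'}.
  move=> /allP wA x /wA /orP[xA|xA]; rewrite mem_cat ?xA //.
  by apply/orP; right; rewrite -[x]invgK map_f.
suff [S SP] : exists S : seq G, forall w : seq G, (size w <= n)%N ->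
    {subset w <= A'} -> (\prod_(x <- w) x)%g \in S.
  exists S => g gn; have [w [/wordA' wA wg wn]] := word_length_attained g.
  by rewrite -wg; apply: SP => //; rewrite wn.
elim: n => [|n [S SP]].
  by exists [:: 1%g] => -[|//] _ _; rewrite big_nil inE.
exists (1%g :: [seq (x * y)%g | x <- A', y <- S]) => -[|x w].
  by move=> _ _; rewrite big_nil mem_head.
move=> wn wA; rewrite big_cons inE; apply/orP; right; apply: (allpairs_f (fun x y => (x * y)%g)).
  by apply: wA; rewrite inE eqxx.
by apply: SP => // y yw; apply: wA; rewrite inE yw orbT.
Qed.

End WordBalls.

Section CoarseFinite.
Context {R : realType} {G H : groupType} (A : seq G) (B : seq H).
Hypothesis A_gen : generating_set A.
Hypothesis B_gen : generating_set B.
Variable f : H -> G.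
Hypothesis f_coarse : coarse_embedding (word_dist B R) (word_dist A R) f.

(** All pairs [h], [h * k] are at the same distance, so one value of the upper control function
    bounds all displacements, and balls are finite. *)
Lemma coarse_expansion (k : H) :
  exists S : seq G, forall h, ((f h)^-1 * f (h * k))%g \in S.
Proof.
have [lo [hi [_ _ bnd]]] := f_coarse.
have [S SP] := word_ball_finite A_gen (Num.bound (hi (word_length B k)%:R)).
exists S => h; apply: SP; rewrite -(ler_nat R).
have /andP[_] := bnd h (h * k)%g; rewrite /word_dist mulKg => /le_trans; apply.
exact/ltW/unstable.ltr_bound.
Qed.

(** Past some distance [M] the lower control function exceeds the lengths of all elements of [T];
    pairs with displacement in [T] are therefore within [M] of each other. *)
Lemma coarse_proper (T : seq G) :
  exists T' : seq H, forall h h', ((f h)^-1 * f h')%g \in T -> (h^-1 * h')%g \in T'.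
Proof.
have [lo [hi [lo_oo _ bnd]]] := f_coarse.
have [N NP] := finite_bound T (word_length A).
have [M MP] : exists M, forall x : R, M < x -> N%:R < lo x.
  move/cvgryPgt : lo_oo => /(_ N%:R) [M [Mr MP]].
  by exists M => x Mx; apply: MP.
have [S SP] := word_ball_finite B_gen (Num.bound M).
exists S => h h' /NP hT; apply: SP; rewrite leqNgt; apply/negP => hM.
have /andP[+ _] := bnd h h'; apply/negP; rewrite -ltNge.
apply: (@le_lt_trans _ _ N%:R); first by rewrite ler_nat.
apply: MP; apply: (@le_lt_trans _ _ (Num.bound M)%:R); last by rewrite ltr_nat.
exact/ltW/unstable.ltr_bound.
Qed.

End CoarseFinite.

(** * Local cochains on cubes *)

(** Each equation of chains on top of the goal is specialized to the coefficient at a common cell,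
    where linear arithmetic concludes. *)
Ltac chain_lin_rec tac :=
  lazymatch goal with
  | |- (_ = _) -> _ => let H := fresh "H" in move=> H;
      chain_lin_rec ltac:(fun k => move/(congr1 (mcoeff k)): H; tac k)
  | _ => apply/malgP; let k := fresh "k" in move=> k; tac k;
      rewrite ?(mcoeffD, mcoeffN, mcoeff0); intros; lra
  end.
Ltac chain_lin := chain_lin_rec ltac:(fun k => idtac).

Section AlexanderSpanier.
Context {R : realType} {V : normedModType R} {K : choiceType}.
Local Notation A := (chain K).
Implicit Types (D : set V) (u : V -> V -> A) (w : V -> V -> V -> A).

(** Star-shaped about 0. The bound on the norm ensures that a scaling step of [M%:R^-1] moves a
    point by no more than that amount. *)
Definition unit_star D := forall x, D x ->
  `|x| <= 1 /\ forall t : R, 0 <= t <= 1 -> D (t *: x).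

(** Cochains in the sense of Alexander and Spanier: functions of tuples of points, with identities
    demanded of nearby points only. Labels are comparable only at nearby points, so nothing stronger
    could be asked of them. *)
Definition local_cocycle1 D u := exists2 e : R, 0 < e & forall x y z,
  D x -> D y -> D z -> `|x - y| < e -> `|y - z| < e -> `|x - z| < e ->
  u y z - u x z + u x y = 0.

Definition local_cocycle2 D w := exists2 e : R, 0 < e & forall x y z t,
  D x -> D y -> D z -> D t ->
  `|x - y| < e -> `|x - z| < e -> `|x - t| < e ->
  `|y - z| < e -> `|y - t| < e -> `|z - t| < e ->
  w y z t - w x z t + w x y t - w x y z = 0.

Definition local_primitive2 D w u := exists2 e : R, 0 < e & forall x y z,
  D x -> D y -> D z -> `|x - y| < e -> `|y - z| < e -> `|x - z| < e ->
  u y z - u x z + u x y = w x y z.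

Definition frac (M j : nat) : R := j%:R / M%:R.

Lemma frac_itv M j : (j <= M)%N -> 0 <= frac M j <= 1.
Proof.
move=> jM; rewrite /frac; apply/andP; split; first by rewrite divr_ge0.
case: M jM => [|M] jM; first by rewrite invr0 mulr0 ler01.
by rewrite ler_pdivrMr ?ltr0n // mul1r ler_nat.
Qed.

Lemma frac0 M : frac M 0 = 0.
Proof. by rewrite /frac mul0r. Qed.

Lemma frac1 M : (0 < M)%N -> frac M M = 1.
Proof. by move=> M0; rewrite /frac divff // pnatr_eq0 -lt0n. Qed.

Lemma frac_close D e M i j x y : unit_star D -> D x -> D y ->
  `|x - y| < e / 2 -> M%:R^-1 < e / 2 -> (i <= M)%N -> (j <= M)%N ->
  (i <= j.+1)%N -> (j <= i.+1)%N -> `|frac M i *: x - frac M j *: y| < e.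
Proof.
move=> Ds Dx Dy xy Me iM jM ij ji.
have -> : frac M i *: x - frac M j *: y =
    frac M i *: (x - y) + (frac M i - frac M j) *: y.
  by rewrite scalerBr scalerBl addrA subrK.
apply: le_lt_trans (ler_normD _ _) _; rewrite [e]splitr; apply: ltr_leD.
  rewrite normrZ; have /andP[f0 f1] := frac_itv iM; rewrite ger0_norm //.
  by apply: le_lt_trans xy; rewrite ler_piMl.
rewrite normrZ; have [y1 _] := Ds _ Dy.
apply: (@le_trans _ _ `|frac M i - frac M j|); first by rewrite ler_piMr.
apply: le_trans (ltW Me); rewrite /frac -mulrBl normrM (ger0_norm (x := M%:R^-1)) ?invr_ge0 //.
rewrite ler_piMl ?invr_ge0 // ler_norml.
have : i%:R <= j%:R + 1 :> R by rewrite natr1 ler_nat.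
have : j%:R <= i%:R + 1 :> R by rewrite natr1 ler_nat.
by move=> ? ?; apply/andP; split; lra.
Qed.

Lemma small_frac (e : R) : 0 < e -> exists2 M : nat, (0 < M)%N & M%:R^-1 < e.
Proof.
move=> e0; exists (Num.bound e^-1).+1 => //.
rewrite invf_plt ?posrE // -natr1.
by apply: lt_trans (unstable.ltr_bound _) _; rewrite ltrDl.
Qed.

Lemma near_frac (e : R) : 0 < e -> \forall M \near \oo, (0 < M)%N /\ M%:R^-1 < e.
Proof.
move=> /small_frac[M M0 Me]; exists M => // N /= MN.
have N0 : (0 < N)%N by apply: leq_trans MN.
by split => //; apply: le_lt_trans Me; rewrite lef_pV2 ?posrE ?ltr0n // ler_nat.
Qed.

Lemma local_cocycle1_exact D u : unit_star D -> local_cocycle1 D u ->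
  exists2 e : R, 0 < e & exists xi : V -> A, forall x y, D x -> D y ->
    `|x - y| < e -> u x y = xi y - xi x.
Proof.
move=> Ds [e e0 ue]; have e20 : 0 < e / 2 by rewrite divr_gt0.
have [M M0 Me] := small_frac e20; exists (e / 2) => //.
(* The sum of [u] along the segment from 0 to [x], cut into [M] steps. *)
exists (fun x => \sum_(0 <= j < M) u (frac M j *: x) (frac M j.+1 *: x)).
move=> x y Dx Dy xy; rewrite -sumrB.
transitivity (\sum_(0 <= j < M) (u (frac M j.+1 *: x) (frac M j.+1 *: y) -
                                 u (frac M j *: x) (frac M j *: y))).
  rewrite telescope_sumr // frac0 frac1 // !scale1r !scale0r.
  have D0 : D 0 by have [_ /(_ 0)] := Ds _ Dx; rewrite scale0r lexx ler01; apply.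
  have := ue 0 0 0 D0 D0 D0; rewrite subrr normr0 => /(_ e0 e0 e0).
  by rewrite subrr add0r => ->; rewrite subr0.
rewrite !big_nat; apply: eq_bigr => j /andP[_ jM].
have DS (z : V) i : D z -> (i <= M)%N -> D (frac M i *: z).
  by move=> Dz iM; have [_] := Ds _ Dz; apply; apply: frac_itv.
have jM' := ltnW jM.
have cl (a b : V) i k : D a -> D b -> `|a - b| < e / 2 -> (i <= M)%N -> (k <= M)%N ->
    (i <= k.+1)%N -> (k <= i.+1)%N -> `|frac M i *: a - frac M k *: b| < e.
  by move=> Da Db ab; apply: (frac_close Ds).
have xx (a : V) : `|a - a| < e / 2 by rewrite subrr normr0.
(* The quadrilateral spanned by [x] and [y] at two consecutive scales is cut into two triangles by
   its diagonal. *)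
have H1 : u (frac M j *: y) (frac M j.+1 *: y) - u (frac M j *: x) (frac M j.+1 *: y)
    + u (frac M j *: x) (frac M j *: y) = 0.
  by apply: ue; first [exact: DS | by apply: cl => //; lia].
have H2 : u (frac M j.+1 *: x) (frac M j.+1 *: y) - u (frac M j *: x) (frac M j.+1 *: y)
    + u (frac M j *: x) (frac M j.+1 *: x) = 0.
  by apply: ue; first [exact: DS | by apply: cl => //; lia].
by move: H1 H2; chain_lin.
Qed.

(** Vanishing on degenerate triples has two uses: the telescoped sum contributes nothing at the
    center 0, and the primitive is 0 on the diagonal. *)
Lemma local_cocycle2_exact D w : unit_star D -> local_cocycle2 D w ->
  (forall x y, w x x y = 0) -> (forall x y, w x y y = 0) ->
  exists2 u, local_primitive2 D w u & forall x, u x x = 0.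
Proof.
move=> Ds [e e0 we] wl wr; have e20 : 0 < e / 2 by rewrite divr_gt0.
have [M M0 Me] := small_frac e20.
pose s j (x : V) := frac M j *: x.
(* The prism operator of the contraction of [D] to 0, cut into [M] steps. *)
exists (fun x y => \sum_(0 <= j < M)
    (w (s j x) (s j.+1 x) (s j.+1 y) - w (s j x) (s j y) (s j.+1 y))); last first.
  by move=> x; rewrite big1 // => j _; rewrite wl wr subrr.
exists (e / 2) => // x y z Dx Dy Dz xy yz xz; rewrite -sumrB -big_split /=.
transitivity (\sum_(0 <= j < M) (w (s j.+1 x) (s j.+1 y) (s j.+1 z) -
                                 w (s j x) (s j y) (s j z))); last first.
  by rewrite telescope_sumr // /s frac0 frac1 // !scale1r !scale0r wl subr0.
rewrite !big_nat; apply: eq_bigr => j /andP[_ jM].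
have DS (a : V) i : D a -> (i <= M)%N -> D (s i a).
  by move=> Da iM; have [_] := Ds _ Da; apply; apply: frac_itv.
have jM' := ltnW jM.
have cl (a b : V) i k : D a -> D b -> `|a - b| < e / 2 -> (i <= M)%N -> (k <= M)%N ->
    (i <= k.+1)%N -> (k <= i.+1)%N -> `|s i a - s k b| < e.
  by move=> Da Db ab; apply: (frac_close Ds).
have xx (a : V) : `|a - a| < e / 2 by rewrite subrr normr0.
(* The prism between two consecutive scaled copies of the triangle is cut into three tetrahedra,
   each contributing one cocycle identity. *)
have E1 : w (s j.+1 x) (s j.+1 y) (s j.+1 z) - w (s j x) (s j.+1 y) (s j.+1 z)
    + w (s j x) (s j.+1 x) (s j.+1 z) - w (s j x) (s j.+1 x) (s j.+1 y) = 0.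
  by apply: we; first [exact: DS | by apply: cl => //; lia].
have E2 : w (s j y) (s j.+1 y) (s j.+1 z) - w (s j x) (s j.+1 y) (s j.+1 z)
    + w (s j x) (s j y) (s j.+1 z) - w (s j x) (s j y) (s j.+1 y) = 0.
  by apply: we; first [exact: DS | by apply: cl => //; lia].
have E3 : w (s j y) (s j z) (s j.+1 z) - w (s j x) (s j z) (s j.+1 z)
    + w (s j x) (s j y) (s j.+1 z) - w (s j x) (s j y) (s j z) = 0.
  by apply: we; first [exact: DS | by apply: cl => //; lia].
by move: E1 E2 E3; chain_lin.
Qed.

Definition path_sum (M : nat) u (p : R -> V) : A :=
  \sum_(0 <= j < M) u (p (frac M j)) (p (frac M j.+1)).

Lemma path_sumB M u v p :
  path_sum M (fun x y => u x y - v x y) p = path_sum M u p - path_sum M v p.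
Proof. by rewrite /path_sum -sumrB. Qed.

Lemma path_sum_exact M u (p : R -> V) (e : R) (xi : V -> A) :
  (forall s t : R, 0 <= s <= 1 -> 0 <= t <= 1 -> `|s - t| < e ->
     u (p s) (p t) = xi (p t) - xi (p s)) ->
  (0 < M)%N -> M%:R^-1 < e -> path_sum M u p = xi (p 1) - xi (p 0).
Proof.
move=> uxi M0 Me; rewrite /path_sum.
transitivity (\sum_(0 <= j < M) (xi (p (frac M j.+1)) - xi (p (frac M j)))).
  rewrite !big_nat; apply: eq_bigr => j /andP[_ jM]; apply: uxi.
  - by rewrite frac_itv // ltnW.
  - by rewrite frac_itv.
  by rewrite /frac -mulrBl -natr1 opprD addrA subrr add0r mulN1r normrN ger0_norm ?invr_ge0.
by rewrite telescope_sumr // frac0 frac1.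
Qed.

End AlexanderSpanier.

Section SumsOnCubes.
Context {R : realType} {K : choiceType}.
Local Notation A := (chain K).

Definition interval : set R := [set s | 0 <= s <= 1].
Definition square : set (R * R) := [set p | interval p.1 /\ interval p.2].

Lemma intervalM (s t : R) : interval s -> interval t -> interval (s * t).
Proof.
move=> /andP[s0 s1] /andP[t0 t1]; apply/andP; split; first exact: mulr_ge0.
by apply: le_trans t1; rewrite ler_piMl.
Qed.

Lemma interval_norm (s : R) : interval s -> `|s| <= 1.
Proof. by move=> /andP[s0 s1]; rewrite ger0_norm. Qed.

Lemma interval_star : unit_star interval.
Proof. by move=> s Is; split; [exact: interval_norm | move=> t It; apply: intervalM]. Qed.

Lemma square_star : unit_star square.
Proof.
move=> p [I1 I2]; split; last by move=> t It; split; apply: intervalM.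
by rewrite prod_normE ge_max !interval_norm.
Qed.

(** Local exactness makes the sums telescope to the same difference of end values for every fine
    subdivision. The eventual value serves as the integral of the cocycle. *)
Lemma path_sum_limit (u : R -> R -> A) : local_cocycle1 interval u ->
  exists v : A, \forall M \near \oo, path_sum M u id = v.
Proof.
move=> /(local_cocycle1_exact interval_star)[e e0 [xi uxi]].
exists (xi 1 - xi 0); near=> M.
have [M0 Me] : (0 < M)%N /\ M%:R^-1 < e by near: M; apply: near_frac.
by apply: (path_sum_exact (p := id) _ M0 Me) => s t Is It; apply: uxi.
Unshelve. all: by end_near. Qed.

(** The sum around the boundary of the unit square, counterclockwise from the origin. *)
Definition square_sum (M : nat) (u : R * R -> R * R -> A) : A :=
  path_sum M u (fun s => (s, 0)) + path_sum M u (fun s => (1, s)) -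
  path_sum M u (fun s => (s, 1)) - path_sum M u (fun s => (0, s)).

Lemma square_sumB M (u v : R * R -> R * R -> A) :
  square_sum M (fun x y => u x y - v x y) = square_sum M u - square_sum M v.
Proof.
rewrite /square_sum !path_sumB.
by move: (path_sum M v _) (path_sum M v _) (path_sum M v _) (path_sum M v _) => *; chain_ring.
Qed.

Lemma square_sum_eq0 (u : R * R -> R * R -> A) : local_cocycle1 square u ->
  \forall M \near \oo, square_sum M u = 0.
Proof.
move=> /(local_cocycle1_exact square_star)[e e0 [xi uxi]]; near=> M.
have [M0 Me] : (0 < M)%N /\ M%:R^-1 < e by near: M; apply: near_frac.
have I0 : interval (0 : R) by rewrite /interval /= lexx ler01.
have I1 : interval (1 : R) by rewrite /interval /= lexx ler01.
have pE (p : R -> R * R) : (forall s, interval s -> square (p s)) ->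
    (forall s t, `|p s - p t| <= `|s - t|) ->
    path_sum M u p = xi (p 1) - xi (p 0).
  move=> ps pl; apply: (path_sum_exact _ M0 Me) => s t Is It st.
  by apply: uxi; [exact: ps | exact: ps | exact: le_lt_trans (pl s t) st].
rewrite /square_sum !pE.
- by chain_ring.
all: try by move=> s Is; split.
all: by move=> s t; rewrite prod_normE /= subrr normr0 ge_max lexx normr_ge0.
Unshelve. all: by end_near. Qed.

End SumsOnCubes.

Section Primitives.
Context {R : realType} {V V' : normedModType R} {K : choiceType}.
Local Notation A := (chain K).

(** The Lipschitz constant 2 is the one available for [wrap]. *)
Lemma primitive_pullback (D : set V) (D' : set V') (k : V -> V')
    (w : V' -> V' -> V' -> A) (u : V' -> V' -> A) :
  (forall x, D x -> D' (k x)) ->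
  (forall x y, D x -> D y -> `|k x - k y| <= 2 * `|x - y|) ->
  local_primitive2 D' w u ->
  local_primitive2 D (fun x y z => w (k x) (k y) (k z)) (fun x y => u (k x) (k y)).
Proof.
move=> kD kl [e e0 ue]; exists (e / 2); first by rewrite divr_gt0.
have cl x y : D x -> D y -> `|x - y| < e / 2 -> `|k x - k y| < e.
  by move=> Dx Dy xy; apply: le_lt_trans (kl _ _ Dx Dy) _; rewrite mulrC -ltr_pdivlMr.
by move=> x y z Dx Dy Dz xy yz xz; apply: ue; auto.
Qed.

(** This allows a primitive chosen on a large cube to be exchanged on a face for the one chosen on
    that face: the difference is a cocycle, whose sums stabilize along paths and vanish around
    squares. *)
Lemma primitive_diff (D : set V) (w w' : V -> V -> V -> A) (u u' : V -> V -> A) :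
  local_primitive2 D w u -> local_primitive2 D w' u' ->
  (forall x y z, D x -> D y -> D z -> w x y z = w' x y z) ->
  local_cocycle1 D (fun x y => u x y - u' x y).
Proof.
move=> [e e0 ue] [e' e'0 ue'] ww'; exists (Num.min e e'); first by rewrite lt_min e0.
move=> x y z Dx Dy Dz; rewrite !lt_min => /andP[xy xy'] /andP[yz yz'] /andP[xz xz'].
have H := ue _ _ _ Dx Dy Dz xy yz xz; have H' := ue' _ _ _ Dx Dy Dz xy' yz' xz'.
have := ww' _ _ _ Dx Dy Dz; rewrite -H -H'; chain_lin.
Qed.

Lemma primitive0 (D : set V) : local_primitive2 D (fun _ _ _ => 0 : A) (fun _ _ => 0).
Proof. by exists 1 => // *; rewrite subrr addr0. Qed.

Lemma primitive_map (K' : choiceType) (f : {additive A -> chain K'}) (D : set V)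
    (w : V -> V -> V -> A) (u : V -> V -> A) :
  local_primitive2 D w u ->
  local_primitive2 D (fun x y z => f (w x y z)) (fun x y => f (u x y)).
Proof.
move=> [e e0 ue]; exists e => // x y z Dx Dy Dz xy yz xz.
by rewrite -raddfB -raddfD ue.
Qed.

Lemma eq_path_sum M (u : V -> V -> A) (v : V' -> V' -> A) p q :
  (forall s t : R, 0 <= s <= 1 -> 0 <= t <= 1 -> u (p s) (p t) = v (q s) (q t)) ->
  path_sum M u p = path_sum M v q.
Proof.
move=> uv; rewrite /path_sum !big_nat; apply: eq_bigr => j /andP[_ jM].
by apply: uv; apply: frac_itv; rewrite // ltnW.
Qed.

Lemma path_sum_eq0 M (u : V -> V -> A) p :
  (forall s t : R, 0 <= s <= 1 -> 0 <= t <= 1 -> u (p s) (p t) = 0) ->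
  path_sum M u p = 0.
Proof.
move=> u0; rewrite /path_sum big_nat big1 // => j /andP[_ jM].
by apply: u0; apply: frac_itv; rewrite // ltnW.
Qed.

Lemma boundary_path_sum (K' : choiceType) (bd : K -> chain K') M
    (u : V -> V -> A) (p : R -> V) :
  boundary bd (path_sum M u p) = path_sum M (fun x y => boundary bd (u x y)) p.
Proof. exact: raddf_sum. Qed.

End Primitives.

Lemma boundary_square_sum (R : realType) (K K' : choiceType) (bd : K -> chain K') M
    (u : R * R -> R * R -> chain K) :
  boundary bd (square_sum M u) = square_sum M (fun x y => boundary bd (u x y)).
Proof. by rewrite /square_sum !boundaryB [boundary _ (_ + _)]raddfD /= !boundary_path_sum. Qed.

(** * Alternating cochains of labels *)

Variant cell_dim := Dim0 | Dim1 | Dim2.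

Section Labels.
Context {G : groupType} (P : finite_presentation G).
Local Notation bd1 := (cover_bd1 (P := P)).
Local Notation bd2 := (cover_bd2 (P := P)).
Local Notation pc := (path_chain (P := P)).
Local Notation L := (cell_dim * G)%type.

Definition edge_chain (a b : G) := pc a (geod P (a^-1 * b)%g).

Definition triangle_chain (a b c : G) : chain (G * prel P)%type :=
  shift a (fill_word (geod P (a^-1 * b)%g ++ geod P (b^-1 * c)%g ++
                      inv_word (geod P (a^-1 * c)%g))).

Lemma bd_edge_chain a b : boundary bd1 (edge_chain a b) = << b >> - << a >>.
Proof. by rewrite boundary_path_chain word_val_geod mulVKg. Qed.

Lemma shift_edge_chain g a b : edge_chain (g * a)%g (g * b)%g = shift g (edge_chain a b).
Proof. by rewrite /edge_chain path_chain_shift invgM mulgA mulgVK. Qed.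

Lemma bd_triangle_chain a b c : boundary bd2 (triangle_chain a b c) =
  edge_chain a b + edge_chain b c - edge_chain a c.
Proof.
rewrite bd_fill_word; last first.
  rewrite !word_val_cat word_val_inv !word_val_geod invgM invgK !mulgA mulgK.
  by rewrite mulgK mulVg.
rewrite !path_chain_cat !word_val_geod !mulVKg -addrA; congr (_ + (_ + _)).
by rewrite -path_chain_inv word_val_geod mulVKg.
Qed.

Lemma shift_triangle_chain g a b c :
  triangle_chain (g * a)%g (g * b)%g (g * c)%g = shift g (triangle_chain a b c).
Proof.
have E x y : ((g * x)^-1 * (g * y) = x^-1 * y)%g by rewrite invgM mulgA mulgVK.
by rewrite /triangle_chain shiftM !E.
Qed.

Definition compatible (x y : L) := x.1 = y.1 -> x.2 = y.2.

Definition translate (g : G) (x : L) : L := (x.1, (g * x.2)%g).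

(** [edge_chain] need not be antisymmetric, as opposite elements have unrelated chosen words.
    Ordering the two ends by dimension makes the cochain alternating. *)
Definition label_edge (x y : L) : chain (G * pgen P)%type :=
  match x.1, y.1 with
  | Dim0, Dim1 | Dim0, Dim2 | Dim1, Dim2 => edge_chain x.2 y.2
  | Dim1, Dim0 | Dim2, Dim0 | Dim2, Dim1 => - edge_chain y.2 x.2
  | _, _ => 0
  end.

(* Zero as soon as a dimension is repeated; four labels always repeat one, hence
   the cocycle property below. *)
Definition label_triangle (x y z : L) : chain (G * prel P)%type :=
  match x.1, y.1, z.1 with
  | Dim0, Dim1, Dim2 => triangle_chain x.2 y.2 z.2
  | Dim1, Dim2, Dim0 => triangle_chain z.2 x.2 y.2
  | Dim2, Dim0, Dim1 => triangle_chain y.2 z.2 x.2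
  | Dim0, Dim2, Dim1 => - triangle_chain x.2 z.2 y.2
  | Dim1, Dim0, Dim2 => - triangle_chain y.2 x.2 z.2
  | Dim2, Dim1, Dim0 => - triangle_chain z.2 y.2 x.2
  | _, _, _ => 0
  end.

Ltac label_cases :=
  repeat match goal with x : (cell_dim * _)%type |- _ => case: x => [[] ?] end;
  rewrite /compatible /label_edge /label_triangle /=.

Lemma bd_label_edge x y : compatible x y ->
  boundary bd1 (label_edge x y) = << y.2 >> - << x.2 >>.
Proof.
label_cases => H; rewrite ?raddfN ?raddf0 /= ?bd_edge_chain ?opprB //.
all: by rewrite H ?subrr.
Qed.

Lemma bd_label_triangle x y z : compatible x y -> compatible y z -> compatible x z ->
  boundary bd2 (label_triangle x y z) = label_edge y z - label_edge x z + label_edge x y.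
Proof.
label_cases => H1 H2 H3; rewrite ?raddfN ?raddf0 /= ?bd_triangle_chain.
all: repeat match goal with H : ?a = ?a -> _ |- _ => rewrite {H}(H erefl) end.
all: by chain_ring.
Qed.

(** Compatibility identifies two labels of equal dimension. The faces containing both vanish, and
    the other two cancel because the cochain is alternating. *)
Lemma label_triangle_cocycle x y z t :
  compatible x y -> compatible x z -> compatible x t ->
  compatible y z -> compatible y t -> compatible z t ->
  label_triangle y z t - label_triangle x z t + label_triangle x y t - label_triangle x y z = 0.
Proof.
label_cases => H1 H2 H3 H4 H5 H6.
all: repeat match goal with H : ?a = ?a -> _ |- _ => rewrite {H}(H erefl) end.
all: by chain_ring.
Qed.

Lemma label_triangle_xxy x y : label_triangle x x y = 0.
Proof. by label_cases. Qed.

Lemma label_triangle_xyy x y : label_triangle x y y = 0.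
Proof. by label_cases. Qed.

Lemma label_edge_xx x : label_edge x x = 0.
Proof. by label_cases. Qed.

Lemma label_edge_translate g x y :
  label_edge (translate g x) (translate g y) = shift g (label_edge x y).
Proof. by label_cases; rewrite ?raddf0 ?shift_edge_chain ?raddfN. Qed.

Lemma label_triangle_translate g x y z :
  label_triangle (translate g x) (translate g y) (translate g z) =
  shift g (label_triangle x y z).
Proof. by label_cases; rewrite ?raddf0 ?shift_triangle_chain ?raddfN. Qed.

End Labels.

(** * A group cocycle from labelled cubes *)

Section LabelledCubes.
Context {R : realType} {G : groupType} (P : finite_presentation G).
Local Notation bd1 := (cover_bd1 (P := P)).
Local Notation bd2 := (cover_bd2 (P := P)).
Local Notation L := (cell_dim * G)%type.
Local Notation C1 := (chain (G * pgen P)%type).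
Local Notation C2 := (chain (G * prel P)%type).
Local Notation interval := (@interval R).
Local Notation square := (@square R).

Definition cube3 : set (R * R * R) := [set p | square p.1 /\ interval p.2].

Lemma cube3_star : unit_star cube3.
Proof.
move=> p [I1 I2]; split.
  by rewrite prod_normE ge_max interval_norm // (square_star I1).1.
move=> t It; split; last exact: intervalM.
exact: (square_star I1).2.
Qed.

Definition coherent (V : normedModType R) (D : set V) (lab : V -> L) :=
  exists2 e : R, 0 < e & forall x y, D x -> D y -> `|x - y| < e ->
    compatible (lab x) (lab y).

Lemma label_primitive (V : normedModType R) (D : set V) (lab : V -> L) :
  unit_star D -> coherent D lab ->
  exists2 u, local_primitive2 D (fun x y z => label_triangle P (lab x) (lab y) (lab z)) u
    & forall x, u x x = 0.
Proof.
move=> Ds [e e0 le]; apply: local_cocycle2_exact => //.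
- exists e => // x y z t Dx Dy Dz Dt *.
  by apply: label_triangle_cocycle; apply: le.
- by move=> x y; apply: label_triangle_xxy.
- by move=> x y; apply: label_triangle_xyy.
Qed.

(** Both terms have the same coboundary: [bd2] of the label triangles, once by [bd_label_triangle]
    and once because [u] is a primitive. The sums of this difference define [m]. *)
Lemma edge_defect_cocycle (V : normedModType R) (D : set V) (lab : V -> L) u :
  coherent D lab ->
  local_primitive2 D (fun x y z => label_triangle P (lab x) (lab y) (lab z)) u ->
  local_cocycle1 D (fun x y => label_edge P (lab x) (lab y) - boundary bd2 (u x y)).
Proof.
move=> [e e0 le] [e' e'0 ue']; exists (Num.min e e'); first by rewrite lt_min e0.
move=> x y z Dx Dy Dz; rewrite !lt_min => /andP[xy xy'] /andP[yz yz'] /andP[xz xz'].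
have H := congr1 (boundary bd2) (ue' _ _ _ Dx Dy Dz xy' yz' xz').
rewrite bd_label_triangle in H; [|by apply: le..].
move: H; rewrite raddfD raddfB /= ; chain_lin.
Qed.

(* The cube [0,1]^3 wrapped around [0,1]^2 x {0}: the face x = 1 goes to the
   inner square of side 1/2, the four faces meeting it to the surrounding
   trapezoids, and the face x = 0 to the whole square. *)
Definition wrap (x y z : R) : R * R * R :=
  (2^-1 + (1 - x / 2) * (y - 2^-1), 2^-1 + (1 - x / 2) * (z - 2^-1), 0).

Lemma wrap_cube x y z : interval x -> interval y -> interval z -> cube3 (wrap x y z).
Proof.
move=> /andP[x0 x1] /andP[y0 y1] /andP[z0 z1].
split; last by rewrite /interval /= lexx ler01.
by split; apply/andP; split => /=; nra.
Qed.

Lemma wrap_dist x y z x' y' z' (e : R) : interval x' -> interval y -> interval z ->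
  interval x -> interval y' -> interval z' ->
  `|x - x'| <= e -> `|y - y'| <= e -> `|z - z'| <= e -> 
  `|wrap x y z - wrap x' y' z'| <= 2 * e.
Proof.
move=> /andP[x'0 x'1] /andP[y0 y1] /andP[z0 z1] /andP[x0 x1] /andP[y'0 y'1] /andP[z'0 z'1].
rewrite !ler_norml => /andP[? ?] /andP[? ?] /andP[? ?].
rewrite !prod_normE /= subrr normr0 !ge_max !ler_norml; apply/andP; split; last lra.
by apply/andP; split; apply/andP; split; nra.
Qed.

(** The labels along a loop for [g], along a square for the triangle with sides [g], [h], [g * h],
    and along a cube for the tetrahedron of [g], [h], [k]. Triangles are squares with constant left
    side. The tetrahedron is wrapped around the bottom of the cube, whose other five faces are
    constant; its face y = 0 depends on x alone. *)
Variables (t0 : cell_dim) (lab1 : G -> R -> L) (lab2 : G -> G -> R * R -> L)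
  (lab3 : G -> G -> G -> R * R * R -> L).
Local Notation base := ((t0, 1%g) : L).
Hypothesis lab1_coh : forall g, coherent interval (lab1 g).
Hypothesis lab2_coh : forall g h, coherent square (lab2 g h).
Hypothesis lab3_coh : forall g h k, coherent cube3 (lab3 g h k).
Hypothesis lab1_0 : forall g, lab1 g 0 = base.
Hypothesis lab1_1 : forall g, lab1 g 1 = (t0, g).
Hypothesis lab2_bottom : forall g h s, interval s -> lab2 g h (s, 0) = lab1 g s.
Hypothesis lab2_right : forall g h s, interval s -> lab2 g h (1, s) = translate g (lab1 h s).
Hypothesis lab2_top : forall g h s, interval s -> lab2 g h (s, 1) = lab1 (g * h)%g s.
Hypothesis lab2_left : forall g h s, interval s -> lab2 g h (0, s) = base.
Hypothesis lab3_x1 : forall g h k y z, interval y -> interval z ->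
  lab3 g h k (wrap 1 y z) = translate g (lab2 h k (y, z)).
Hypothesis lab3_z0 : forall g h k x y, interval x -> interval y ->
  lab3 g h k (wrap x y 0) = lab2 g h (x, y).
Hypothesis lab3_z1 : forall g h k x y, interval x -> interval y ->
  lab3 g h k (wrap x y 1) = lab2 g (h * k)%g (x, y).
Hypothesis lab3_y0 : forall g h k x z, interval x -> interval z ->
  lab3 g h k (wrap x 0 z) = lab1 g x.
Hypothesis lab3_y1 : forall g h k x z, interval x -> interval z ->
  lab3 g h k (wrap x 1 z) = lab2 (g * h)%g k (x, z).
Hypothesis lab3_const : forall g h k y z t, interval y -> interval z -> interval t ->
  y = 0 \/ y = 1 \/ z = 0 \/ z = 1 \/ t = 1 -> lab3 g h k (y, z, t) = base.

Local Lemma I0 : interval (0 : R). Proof. by rewrite /interval /= lexx ler01. Qed.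
Local Lemma I1 : interval (1 : R). Proof. by rewrite /interval /= lexx ler01. Qed.

Definition tri (V : Type) (lab : V -> L) x y z := label_triangle P (lab x) (lab y) (lab z).

(** [m g] sums over the loop of [g] the edge cochain minus [bd2] of a primitive; [q (g, h)] sums a
    primitive around the square and subtracts the primitives chosen on its sides. The corrections
    are the same chains [S] in both, which gives the formula for [bd2] of [q]. *)
Lemma labelled_cycles_split : cycles_split P.
Proof.
have I0 := I0; have I1 := I1.
have /choice[e1 e1P] g : exists u, local_primitive2 interval (tri (lab1 g)) u /\
    forall x, u x x = 0.
  by have [u up u0] := label_primitive interval_star (lab1_coh g); exists u.
have /choice[e2 e2P] (p : G * G) :
    exists u, local_primitive2 square (tri (lab2 p.1 p.2)) u.
  by have [u up _] := label_primitive square_star (@lab2_coh p.1 p.2); exists u.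
(* [e1 g] is a primitive and in general no cocycle, so these sums need not stabilize in [M]. They
   appear only inside combinations that do. *)
pose S M g := path_sum M (e1 g) id.
have /choice[m mP] g : exists v, \forall M \near \oo,
    path_sum M (fun s t => label_edge P (lab1 g s) (lab1 g t)) id - boundary bd2 (S M g) = v.
  have [v vP] := path_sum_limit (edge_defect_cocycle (lab1_coh g) (e1P g).1).
  exists v; apply: filterS vP => M <-.
  by rewrite path_sumB /S boundary_path_sum.
have sh_prim g h : local_primitive2 interval (tri (fun s => translate g (lab1 h s)))
    (fun s t => shift g (e1 h s t)).
  have [e e0 ue] := primitive_map (@shift G (prel P) g) (e1P h).1.
  exists e => // x y z Dx Dy Dz xy yz xz; rewrite ue //.
  by rewrite /tri label_triangle_translate.
(* On a side of the square, [e2] and the primitive [u] chosen for that side have the same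
   coboundary. *)
have side p (k : R -> R * R) u w : (forall s, interval s -> square (k s)) ->
    (forall s t, interval s -> interval t -> `|k s - k t| <= `|s - t|) ->
    local_primitive2 interval w u ->
    (forall x y z, interval x -> interval y -> interval z ->
      tri (lab2 p.1 p.2) (k x) (k y) (k z) = w x y z) ->
    local_cocycle1 interval (fun s t => e2 p (k s) (k t) - u s t).
  move=> kD kl wu E; apply: primitive_diff (wu) E; apply: primitive_pullback (e2P p) => //.
  by move=> x y Ix Iy; apply: le_trans (kl _ _ Ix Iy) _; rewrite ler_peMl // ler1n.
have /choice[q qP] (p : G * G) : exists v, \forall M \near \oo,
    square_sum M (e2 p) - (S M p.1 + shift p.1 (S M p.2) - S M (p.1 * p.2)%g) = v.
  have kl (k : R -> R * R) : (k = fun s => (s, 0)) \/ (k = fun s => (1, s)) \/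
      (k = fun s => (s, 1)) \/ (k = fun s => (0, s)) ->
      forall s t, interval s -> interval t -> `|k s - k t| <= `|s - t|.
    by move=> [|[|[|]]] -> s t _ _; rewrite prod_normE /= subrr normr0 ge_max lexx normr_ge0.
  have cB : local_cocycle1 interval (fun s t => e2 p (s, 0) (t, 0) - e1 p.1 s t).
    apply: (side p (fun s => (s, 0))) (e1P p.1).1 _ => //; first by apply: kl; left.
    by move=> x y z Ix Iy Iz; rewrite /tri !lab2_bottom.
  have cR : local_cocycle1 interval (fun s t => e2 p (1, s) (1, t) - shift p.1 (e1 p.2 s t)).
    apply: (side p (fun s => (1, s))) (sh_prim p.1 p.2) _ => //; first by apply: kl; right; left.
    by move=> x y z Ix Iy Iz; rewrite /tri !lab2_right.
  have cT : local_cocycle1 interval (fun s t => e2 p (s, 1) (t, 1) - e1 (p.1 * p.2)%g s t).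
    apply: (side p (fun s => (s, 1))) (e1P _).1 _ => //; first by apply: kl; right; right; left.
    by move=> x y z Ix Iy Iz; rewrite /tri !lab2_top.
  have cL : local_cocycle1 interval (fun s t => e2 p (0, s) (0, t) - 0).
    apply: (side p (fun s => (0, s)) (fun _ _ => 0) (fun _ _ _ => 0)) => //.
    - by apply: kl; right; right; right.
    - exact: primitive0.
    by move=> x y z Ix Iy Iz; rewrite /tri !lab2_left // label_triangle_xxy.
  have [vB BP] := path_sum_limit cB; have [vR RP] := path_sum_limit cR.
  have [vT TP] := path_sum_limit cT; have [vL LP] := path_sum_limit cL.
  exists (vB + vR - vT - vL).
  apply: filterS (filterI (filterI BP RP) (filterI TP LP)) => M [[<- <-] [<- <-]].
  have shS : shift p.1 (S M p.2) = path_sum M (fun s t => shift p.1 (e1 p.2 s t)) id.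
    exact: boundary_path_sum.
  rewrite !path_sumB shS (_ : path_sum M (fun _ _ => 0) id = 0); last by rewrite /path_sum big1.
  rewrite /S /square_sum /path_sum; chain_ring.
apply: (@cocycle_cycles_split G P m (fun g h => q (g, h))).
- move=> g.
  have [e e0 le] := lab1_coh g.
  have [M [<- [M0 Me]]] := filter_ex (filterI (mP g) (near_frac e0)).
  rewrite boundaryB bd1_bd2 subr0 boundary_path_sum.
  rewrite (@path_sum_exact _ _ _ M _ id e (fun s => << (lab1 g s).2 >>)) ?lab1_0 ?lab1_1 //.
  by move=> s t Is It st; apply: bd_label_edge; apply: le.
- move=> g h; have u2 := edge_defect_cocycle (@lab2_coh g h) (e2P (g, h)).
  have [M [[<- sM] [[mg mh] mgh]]] := filter_ex (filterI (filterI (qP (g, h)) (square_sum_eq0 u2))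
    (filterI (filterI (mP g) (mP h)) (mP (g * h)%g))).
  pose SQ g := path_sum M (fun s t => label_edge P (lab1 g s) (lab1 g t)) id.
  have sqE : boundary bd2 (square_sum M (e2 (g, h))) = SQ g + shift g (SQ h) - SQ (g * h)%g.
    have <- : square_sum M (fun x y => label_edge P (lab2 g h x) (lab2 g h y)) =
        SQ g + shift g (SQ h) - SQ (g * h)%g.
      pose u x y := label_edge P (lab2 g h x) (lab2 g h y).
      have EB : path_sum M u (fun s => (s, 0)) = SQ g.
        by apply: eq_path_sum => s t Is It; rewrite /u !lab2_bottom.
      have ER : path_sum M u (fun s => (1, s)) = shift g (SQ h).
        rewrite [RHS]boundary_path_sum; apply: eq_path_sum => s t Is It.
        by rewrite /u !lab2_right // label_edge_translate.
      have ET : path_sum M u (fun s => (s, 1)) = SQ (g * h)%g.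
        by apply: eq_path_sum => s t Is It; rewrite /u !lab2_top.
      have EL : path_sum M u (fun s => (0, s)) = 0.
        by apply: path_sum_eq0 => s t Is It; rewrite /u !lab2_left // label_edge_xx.
      by rewrite /square_sum EB ER ET EL subr0.
    by apply/esym/eqP; rewrite boundary_square_sum -subr_eq0 -square_sumB sM.
  rewrite /= boundaryB sqE boundaryB [boundary bd2 (_ + _)]raddfD /= boundary_bd2_shift.
  by rewrite -mg -mh -mgh -/(SQ _) -/(SQ _) -/(SQ _) shiftB; chain_ring.
- move=> g h k.
  have [e3 p3 _] := label_primitive cube3_star (@lab3_coh g h k).
  (* The difference of [e3] and the primitive chosen on a face is a cocycle there, so its sum around
     the face is eventually 0. *)
  have face (f : R * R -> R * R * R) w u : (forall x, square x -> cube3 (f x)) ->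
      (forall x y, square x -> square y -> `|f x - f y| <= 2 * `|x - y|) ->
      local_primitive2 square w u ->
      (forall x y z, square x -> square y -> square z ->
        tri (lab3 g h k) (f x) (f y) (f z) = w x y z) ->
      \forall M \near \oo, square_sum M (fun x y => e3 (f x) (f y)) = square_sum M u.
    move=> fD fl wu E; have := square_sum_eq0 (primitive_diff (primitive_pullback fD fl p3) wu E).
    by apply: filterS => M /eqP; rewrite square_sumB subr_eq0 => /eqP.
  have wl (f : R * R -> R * R * R) : (f = fun p => wrap p.1 p.2 0) \/ (f = fun p => wrap p.1 p.2 1) \/
      (f = fun p => wrap p.1 0 p.2) \/ (f = fun p => wrap p.1 1 p.2) \/ (f = fun p => wrap 1 p.1 p.2) ->
      (forall x, square x -> cube3 (f x)) /\
      (forall x y, square x -> square y -> `|f x - f y| <= 2 * `|x - y|).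
    have n1 (a b c d : R) : `|a - c| <= `|(a, b) - (c, d)| by rewrite prod_normE le_max lexx.
    have n2 (a b c d : R) : `|b - d| <= `|(a, b) - (c, d)| by rewrite prod_normE le_max lexx orbT.
    have n0 (z : R) (p p' : R * R) : `|z - z| <= `|p - p'| by rewrite subrr normr0.
    move=> [|[|[|[|]]]] -> /=; split=> [[a b] [/= Ia Ib]|[a b] [c d] [/= Ia Ib] [/= Ic Id]];
      by [exact: wrap_cube | apply: wrap_dist].
  have wface f w u (ff : _) := face f w u (wl f ff).1 (wl f ff).2.
  pose X y z M := path_sum M e3 (fun s => wrap s y z).
  pose Y x z M := path_sum M e3 (fun s => wrap x s z).
  pose Z x y M := path_sum M e3 (fun s => wrap x y s).
  have F1 : \forall M \near \oo, X 0 0 M + Y 1 0 M - X 1 0 M - Y 0 0 M = square_sum M (e2 (g, h)).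
    apply: (wface (fun p => wrap p.1 p.2 0) _ _ _ (e2P (g, h))); first by left.
    by move=> [a b] [c d] [a' b'] [? ?] [? ?] [? ?]; rewrite /tri !lab3_z0.
  have F2 : \forall M \near \oo,
      X 0 1 M + Y 1 1 M - X 1 1 M - Y 0 1 M = square_sum M (e2 (g, (h * k)%g)).
    apply: (wface (fun p => wrap p.1 p.2 1) _ _ _ (e2P (g, (h * k)%g))); first by right; left.
    by move=> [a b] [c d] [a' b'] [? ?] [? ?] [? ?]; rewrite /tri !lab3_z1.
  have F3 : \forall M \near \oo,
      X 1 0 M + Z 1 1 M - X 1 1 M - Z 0 1 M = square_sum M (e2 ((g * h)%g, k)).
    apply: (wface (fun p => wrap p.1 1 p.2) _ _ _ (e2P ((g * h)%g, k))).
      by right; right; right; left.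
    by move=> [a b] [c d] [a' b'] [? ?] [? ?] [? ?]; rewrite /tri !lab3_y1.
  have F4 : \forall M \near \oo, X 0 0 M + Z 1 0 M - X 0 1 M - Z 0 0 M = 0.
    have : \forall M \near \oo, X 0 0 M + Z 1 0 M - X 0 1 M - Z 0 0 M =
        square_sum M (fun p q => e1 g p.1 q.1).
      apply: (wface (fun p => wrap p.1 0 p.2) (fun x y z => tri (lab1 g) x.1 y.1 z.1)).
      - by right; right; left.
      - apply: (primitive_pullback (k := fst) (D' := interval) _ _ (e1P g).1).
          by move=> ? [].
        move=> [a b] [c d] _ _; apply: (@le_trans _ _ `|(a, b) - (c, d)|).
          by rewrite prod_normE le_max lexx.
        by rewrite ler_peMl // ler1n.
      by move=> [a b] [c d] [a' b'] [? ?] [? ?] [? ?]; rewrite /tri !lab3_y0.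
    apply: filterS => M ->; rewrite /square_sum.
    (* The primitive sees only the coordinate x: on two sides it is evaluated at repeated points,
       where it is 0, and the other two sides cancel. *)
    rewrite [X in _ + X - _ - _]path_sum_eq0 ?[X in _ - X]path_sum_eq0 ?addr0 ?subr0; last first.
    - by move=> *; exact: (e1P g).2.
    - by move=> *; exact: (e1P g).2.
    exact: subrr.
  have F5 : \forall M \near \oo,
      Y 1 0 M + Z 1 1 M - Y 1 1 M - Z 1 0 M = shift g (square_sum M (e2 (h, k))).
    have H := primitive_map (@shift G (prel P) g) (e2P (h, k)).
    have : \forall M \near \oo, Y 1 0 M + Z 1 1 M - Y 1 1 M - Z 1 0 M =
        square_sum M (fun x y => shift g (e2 (h, k) x y)).
      apply: (wface (fun p => wrap 1 p.1 p.2) _ _ _ H); first by right; right; right; right.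
      move=> [a b] [c d] [a' b'] [? ?] [? ?] [? ?].
      by rewrite /tri !lab3_x1 // label_triangle_translate.
    by apply: filterS => M ->; rewrite [RHS]boundary_square_sum.
  have cface (f : R * R -> R * R * R) :
      (f = fun p => (p.1, 0, p.2)) \/ (f = fun p => (p.1, 1, p.2)) \/
      (f = fun p => (0, p.1, p.2)) \/ (f = fun p => (1, p.1, p.2)) \/ (f = fun p => (p.1, p.2, 1)) ->
      \forall M \near \oo, square_sum M (fun x y => e3 (f x) (f y)) = 0.
    move=> fE; have : \forall M \near \oo, square_sum M (fun x y => e3 (f x) (f y)) =
        square_sum M (fun _ _ : R * R => 0).
      apply: (face f (fun _ _ _ => 0)); last 2 first.
      - exact: primitive0.
      - have fb x : square x -> lab3 g h k (f x) = base.
          case: x => a b [/= Ia Ib].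
          by move: fE => [|[|[|[|]]]] -> /=; apply: lab3_const; tauto.
        by move=> x y z Dx Dy Dz; rewrite /tri !fb // label_triangle_xxy.
      - by move=> [a b] [/= Ia Ib]; move: fE => [|[|[|[|]]]] ->.
      move=> [a b] [c d] _ _; apply: (@le_trans _ _ `|(a, b) - (c, d)|); last by rewrite ler_peMl // ler1n.
      move: fE => [|[|[|[|]]]] -> /=; rewrite !prod_normE /= ?subrr ?normr0 !ge_max !le_max !lexx ?normr_ge0 ?orbT //=.
    by apply: filterS => M ->; rewrite /square_sum !path_sum_eq0 ?addr0 ?subr0.
  (* The face x = 0 of the wrapped cube is the whole bottom square, where the labels vary. Its
     boundary sum is shown to vanish by going over the other five faces of [cube3], where the labels
     are constant. *)
  pose Yb z M := path_sum M e3 (fun s => (s, z, 0)).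
  pose Zb y M := path_sum M e3 (fun s => (y, s, 0)).
  pose Yt z M := path_sum M e3 (fun s => (s, z, 1)).
  pose Zt y M := path_sum M e3 (fun s => (y, s, 1)).
  pose T y z M := path_sum M e3 (fun s => (y, z, s)).
  have C1 : \forall M \near \oo, Yb 0 M + T 1 0 M - Yt 0 M - T 0 0 M = 0.
    by apply: (cface (fun p => (p.1, 0, p.2))); left.
  have C2 : \forall M \near \oo, Yb 1 M + T 1 1 M - Yt 1 M - T 0 1 M = 0.
    by apply: (cface (fun p => (p.1, 1, p.2))); right; left.
  have C3 : \forall M \near \oo, Zb 0 M + T 0 1 M - Zt 0 M - T 0 0 M = 0.
    by apply: (cface (fun p => (0, p.1, p.2))); right; right; left.
  have C4 : \forall M \near \oo, Zb 1 M + T 1 1 M - Zt 1 M - T 1 0 M = 0.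
    by apply: (cface (fun p => (1, p.1, p.2))); right; right; right; left.
  have C5 : \forall M \near \oo, Yt 0 M + Zt 1 M - Yt 1 M - Zt 0 M = 0.
    by apply: (cface (fun p => (p.1, p.2, 1))); right; right; right; right.
  have wrap0 y z : wrap 0 y z = (y, z, 0).
    by rewrite /wrap mul0r subr0 !mul1r ![2^-1 + _]addrC !subrK.
  have YbE z M : Y 0 z M = Yb z M by apply: eq_path_sum => *; rewrite !wrap0.
  have ZbE y M : Z 0 y M = Zb y M by apply: eq_path_sum => *; rewrite !wrap0.
  have [M [[[[qg1 qg2] [qg3 qg4]] [[f1 f2] [f3 f4]]] [[f5 [c1 c2]] [c3 [c4 c5]]]]] := filter_ex
    (filterI (filterI (filterI (filterI (qP ((g * h)%g, k)) (qP (h, k)))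
        (filterI (qP (g, (h * k)%g)) (qP (g, h)))) (filterI (filterI F1 F2) (filterI F3 F4)))
      (filterI (filterI F5 (filterI C1 C2)) (filterI C3 (filterI C4 C5)))).
  (* What remains is linear: in the alternating sum of the faces the sums over shared edges cancel,
     and the [S] terms cancel among themselves. *)
  move: (square_sum M (e2 (h, k))) qg2 f5 => sq qg2 f5.
  rewrite -qg1 -qg2 -qg3 -qg4 /= !shiftB !shiftD -shiftM !mulgA -f1 -f2 -f3 -f5.
  move: f4 c1 c2 c3 c4 c5; rewrite !YbE !ZbE.
  move: (X 0 0 M) (X 1 0 M) (X 0 1 M) (X 1 1 M) (Y 1 0 M) (Y 1 1 M) (Z 1 0 M) (Z 1 1 M).
  move: (Yb 0 M) (Yb 1 M) (Zb 0 M) (Zb 1 M) (Yt 0 M) (Yt 1 M) (Zt 0 M) (Zt 1 M).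
  move: (T 0 0 M) (T 0 1 M) (T 1 0 M) (T 1 1 M).
  clearbody S.
  move: (S M g) (S M (g * h)%g) (S M (g * h * k)%g) (shift g (S M h))
    (shift g (S M (h * k)%g)) (shift (g * h)%g (S M k)).
  by do 26 move=> ?; chain_lin.
Qed.

End LabelledCubes.

(** * Paths and homotopies *)

Section Within.
Context {T U V : topologicalType}.

Lemma withinP (A : set T) (f : T -> U) : {within A, continuous f} <->
  forall x, A x -> forall W, nbhs (f x) W -> \forall y \near x, A y -> W (f y).
Proof. by split => [/subspace_continuousP|H]; [|apply/subspace_continuousP]. Qed.

Lemma within_comp (A : set T) (B : set U) (f : T -> U) (g : U -> V) :
  {within A, continuous f} -> {within B, continuous g} ->
  (forall x, A x -> B (f x)) -> {within A, continuous (fun x => g (f x))}.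
Proof.
move=> /withinP fc /subspace_continuousP gc AB; apply/subspace_continuousP => x Ax W gW.
have := fc x Ax _ (gc (f x) (AB x Ax) W gW).
by apply: filterS => y H Ay; apply: H => //; apply: AB.
Qed.

Lemma within_ext (A : set T) (f g : T -> U) : (forall x, A x -> f x = g x) ->
  {within A, continuous f} -> {within A, continuous g}.
Proof.
move=> fg /withinP fc; apply/withinP => x Ax W; rewrite -fg // => /(fc x Ax).
by apply: filterS => y H Ay; rewrite -fg //; exact: H.
Qed.

Lemma within_cst (A : set T) (c : U) : {within A, continuous (fun _ => c)}.
Proof. by apply: continuous_subspaceT => x; exact: cvg_cst. Qed.

Lemma within_id (A : set T) : {within A, continuous (fun x : T => x)}.
Proof. by apply: continuous_subspaceT => x; exact: cvg_id. Qed.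

Lemma within_pair (A : set T) (f : T -> U) (g : T -> V) :
  {within A, continuous f} -> {within A, continuous g} ->
  {within A, continuous (fun x => (f x, g x))}.
Proof.
move=> /subspace_continuousP fc /subspace_continuousP gc.
by apply/subspace_continuousP => x Ax; apply: cvg_pair; [exact: fc | exact: gc].
Qed.

Lemma within_fst (A : set (T * U)) : {within A, continuous fst}.
Proof. by apply: continuous_subspaceT => x; exact: cvg_fst. Qed.

Lemma within_snd (A : set (T * U)) : {within A, continuous snd}.
Proof. by apply: continuous_subspaceT => x; exact: cvg_snd. Qed.

End Within.

Section WithinNormed.
Context {R : realType} {T : topologicalType} {V : normedModType R}.

Lemma withinD (A : set T) (f g : T -> V) :
  {within A, continuous f} -> {within A, continuous g} ->
  {within A, continuous (fun x => f x + g x)}.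
Proof.
move=> /subspace_continuousP fc /subspace_continuousP gc.
by apply/subspace_continuousP => x Ax; apply: cvgD; [exact: fc | exact: gc].
Qed.

Lemma withinN (A : set T) (f : T -> V) :
  {within A, continuous f} -> {within A, continuous (fun x => - f x)}.
Proof.
move=> /subspace_continuousP fc.
by apply/subspace_continuousP => x Ax; apply: cvgN; exact: fc.
Qed.

Lemma withinZ (A : set T) (k : T -> R) (f : T -> V) :
  {within A, continuous k} -> {within A, continuous f} ->
  {within A, continuous (fun x => k x *: f x)}.
Proof.
move=> /subspace_continuousP kc /subspace_continuousP fc.
by apply/subspace_continuousP => x Ax; apply: cvgZ; [exact: kc | exact: fc].
Qed.

Lemma withinM (A : set T) (f g : T -> R) :
  {within A, continuous f} -> {within A, continuous g} ->
  {within A, continuous (fun x => f x * g x)}.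
Proof.
move=> /subspace_continuousP fc /subspace_continuousP gc.
by apply/subspace_continuousP => x Ax; apply: cvgM; [exact: fc | exact: gc].
Qed.

Lemma withinNorm (A : set T) (f : T -> R) :
  {within A, continuous f} -> {within A, continuous (fun x => `|f x|)}.
Proof.
move=> /subspace_continuousP fc.
by apply/subspace_continuousP => x Ax; apply: cvg_norm; exact: fc.
Qed.

End WithinNormed.

Section WithinMax.
Context {R : realType} {T : topologicalType}.

Lemma withinMax (A : set T) (f g : T -> R) :
  {within A, continuous f} -> {within A, continuous g} ->
  {within A, continuous (fun x => Num.max (f x) (g x))}.
Proof.
move=> fc gc; apply: (within_ext (f := fun x => (f x + g x + `|f x - g x|) * 2^-1)).
  by move=> x _; rewrite maxr_absE.
apply: withinM; last exact: within_cst.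
apply: withinD; first exact: withinD.
by apply: withinNorm; apply: withinD => //; exact: withinN.
Qed.

Lemma withinMin (A : set T) (f g : T -> R) :
  {within A, continuous f} -> {within A, continuous g} ->
  {within A, continuous (fun x => Num.min (f x) (g x))}.
Proof.
move=> fc gc; apply: (within_ext (f := fun x => (f x + g x - `|f x - g x|) * 2^-1)).
  by move=> x _; rewrite minr_absE.
apply: withinM; last exact: within_cst.
apply: withinD; first exact: withinD.
by apply/withinN/withinNorm; apply: withinD => //; exact: withinN.
Qed.

End WithinMax.

Ltac within_tac :=
  lazymatch goal with
  | |- continuous (from_subspace ?A ?f) =>
    lazymatch f with
    | (fun x => x) => exact (@within_id _ A)
    | id => exact (@within_id _ A)
    | (fun x => x.1) => exact (@within_fst _ _ A)
    | (fun x => x.2) => exact (@within_snd _ _ A)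
    | (fun _ => ?c) => exact (@within_cst _ _ A c)
    | (fun x => (@?g x, @?h x)) => refine (@within_pair _ _ _ A g h _ _); within_tac
    | (fun x => @?g x + @?h x) => refine (@withinD _ _ _ A g h _ _); within_tac
    | (fun x => - (@?g x)) => refine (@withinN _ _ _ A g _); within_tac
    | (fun x => @?g x *: @?h x) => refine (@withinZ _ _ _ A g h _ _); within_tac
    | (fun x => @?g x * @?h x) => refine (@withinM _ _ A g h _ _); within_tac
    | (fun x => Num.max (@?g x) (@?h x)) => refine (@withinMax _ _ A g h _ _); within_tac
    | (fun x => Num.min (@?g x) (@?h x)) => refine (@withinMin _ _ A g h _ _); within_tac
    | (fun x => `|@?g x|) => refine (@withinNorm _ _ A g _); within_tac
    | (fun x => (@?g x).1) =>
        refine (@within_comp _ _ _ A setT g fst _ (@within_fst _ _ _) _); [within_tac|done]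
    | (fun x => (@?g x).2) =>
        refine (@within_comp _ _ _ A setT g snd _ (@within_snd _ _ _) _); [within_tac|done]
    | _ => try assumption
    end
  | _ => try assumption
  end.

Ltac within_along pc :=
  lazymatch type of pc with
  | continuous (from_subspace ?B ?p) =>
    lazymatch goal with
    | |- continuous (from_subspace ?A (fun x => p (@?g x))) =>
        refine (@within_comp _ _ _ A B g p _ pc _); [within_tac|]
    end
  end.

Section ClosedPieces.
Context {T V X : topologicalType} (I : finType).

(** A pasting lemma for parametrized pieces, which need not be injective. The points of the pieces
    sent outside an open set form a finite union of images of compact sets, which is closed in a
    Hausdorff space. *)
Lemma within_pieces (A : set T) (f : T -> X) (K : I -> set V) (k : I -> V -> T) :
  hausdorff_space T -> (forall i, compact (K i)) ->
  (forall i, {within K i, continuous (k i)}) ->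
  (forall i, {within K i, continuous (fun v => f (k i v))}) ->
  (forall x, A x -> exists i, exists2 v, K i v & k i v = x) ->
  {within A, continuous f}.
Proof.
move=> hT cK kc fkc cov; apply/withinP => x Ax W /nbhs_interior; rewrite nbhsE => -[U0 [oU Ufx] UW].
pose B i := k i @` (K i `&` (fun v => f (k i v)) @^-1` ~` U0).
have cB i : closed (B i).
  apply: compact_closed => //; apply: continuous_compact.
    by apply: continuous_subspaceW (kc i) => v [].
  have /continuous_closedP/(_ _ (open_closedC oU))/closed_subspaceP[C' cC' C'E] := fkc i.
  by rewrite setIC -C'E setIC; apply: compact_closedI.
have nB : ~ (\bigcup_(i in [set: I]) B i) x.
  by move=> [i _ [v [Kv nO] kv]]; apply: nO; rewrite /= kv.
have : nbhs x (~` (\bigcup_(i in [set: I]) B i)).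
  apply: open_nbhs_nbhs; split => //; apply: closed_openC.
  by apply: closed_bigcup => //; exact: finite_finset.
apply: filterS => y nBy Ay; apply: interior_subset; apply: UW; apply: contrapT => nOy; apply: nBy.
by have [i [v Kv kv]] := cov y Ay; exists i => //; exists v => //; split => //=; rewrite kv.
Qed.

End ClosedPieces.

Section WithinIf.
Context {R : realType} {X : topologicalType}.

Lemma closed_lel (T : topologicalType) (f : T -> R) (c : R) :
  continuous f -> closed [set x | f x <= c].
Proof. by move=> fc; apply: (closed_comp _ (@closed_le R c)) => x _; exact: fc. Qed.

Lemma closed_ger (T : topologicalType) (f : T -> R) (c : R) :
  continuous f -> closed [set x | c <= f x].
Proof. by move=> fc; apply: (closed_comp _ (@closed_ge R c)) => x _; exact: fc. Qed.

Lemma within_if_le (T : topologicalType) (A : set T) (c : T -> R) (a : R) (f g : T -> X) :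
  closed A -> continuous c ->
  {within A `&` [set x | c x <= a], continuous f} ->
  {within A `&` [set x | a <= c x], continuous g} ->
  (forall x, A x -> c x = a -> f x = g x) ->
  {within A, continuous (fun x => if c x <= a then f x else g x)}.
Proof.
move=> cA cc fc gc fg.
rewrite (_ : A = (A `&` [set x | c x <= a]) `|` (A `&` [set x | a <= c x])).
  apply: withinU_continuous.
  - by apply: closedI => //; exact: closed_lel.
  - by apply: closedI => //; exact: closed_ger.
  - by apply: within_ext fc => x [_ /= ->].
  apply: within_ext gc => x [Ax /= ax]; case: ifPn => // xa.
  by apply/esym/fg => //; apply/eqP; rewrite eq_le xa.
rewrite -setIUr; apply/seteqP; split=> x; last by case.
by move=> Ax; split => //; case: (leP (c x) a) => [|/ltW]; [left|right].
Qed.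

End WithinIf.

Section Paths.
Context {R : realType} {X : topologicalType}.
Local Notation I := (@interval R).
Local Notation I2 := (@square R).
Implicit Types (x y z : X) (p q r : R -> X).

Lemma itv01E : [set` `[0, 1]] = I.
Proof. by apply/seteqP; split=> s; rewrite /interval /= in_itv. Qed.

Lemma is_pathP x y p : is_path x y p <-> [/\ {within I, continuous p}, p 0 = x & p 1 = y].
Proof. by rewrite /is_path itv01E. Qed.

Lemma path_homotopicP x y p q : path_homotopic x y p q <-> exists h : R * R -> X,
  [/\ {within I2, continuous h}, forall s, I s -> h (s, 0) = p s /\ h (s, 1) = q s &
      forall t, I t -> h (0, t) = x /\ h (1, t) = y].
Proof.
rewrite /path_homotopic itv01E.
by split=> -[h [hc hp ht]]; exists h; split.
Qed.

Lemma interval0 : I 0. Proof. by rewrite /interval /= lexx ler01. Qed.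
Lemma interval1 : I 1. Proof. by rewrite /interval /= lexx ler01. Qed.
Lemma intervalC (s : R) : I s -> I (1 - s).
Proof. by rewrite /interval /= => /andP[? ?]; apply/andP; split; lra. Qed.

Lemma closed_interval : closed I.
Proof. by rewrite -itv01E; exact: interval_closed. Qed.

Lemma closed_square : closed I2.
Proof.
apply: (closedI (A := fst @^-1` I) (B := snd @^-1` I)).
  by apply: closed_comp closed_interval => u _; exact: cvg_fst.
by apply: closed_comp closed_interval => u _; exact: cvg_snd.
Qed.

Lemma half_itv (s : R) : I s -> s <= 2^-1 -> I (2 * s).
Proof. by move=> /andP[? ?] ?; apply/andP; split; lra. Qed.

Lemma half_itv' (s : R) : I s -> 2^-1 <= s -> I (2 * s - 1).
Proof. by move=> /andP[? ?] ?; apply/andP; split; lra. Qed.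

Lemma concat0 p q : path_concat p q 0 = p 0.
Proof. by rewrite /path_concat invr_ge0 ler0n mulr0. Qed.

Lemma concat1 p q : path_concat p q 1 = q 1.
Proof.
rewrite /path_concat ifF; first by congr q; lra.
by apply/negbTE; rewrite -ltNge; lra.
Qed.

Lemma is_path_concat x y z p q : is_path x y p -> is_path y z q -> is_path x z (path_concat p q).
Proof.
move=> /is_pathP[pc p0 p1] /is_pathP[qc q0 q1]; apply/is_pathP.
split; [|by rewrite concat0|by rewrite concat1].
apply: (within_if_le (c := id)).
- exact: closed_interval.
- by move=> s; exact: cvg_id.
- within_along pc.
  by move=> s [Is /= sh]; exact: half_itv.
- within_along qc.
  by move=> s [Is /= sh]; exact: half_itv'.
move=> s _ /= ->; rewrite divff // p1 (_ : _ - 1 = 0) ?q0 //; lra.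
Qed.

Lemma is_path_cst x : is_path x x (fun _ : R => x).
Proof. by apply/is_pathP; split => //; exact: within_cst. Qed.

Lemma path_homotopic_sym x y p q : path_homotopic x y p q -> path_homotopic x y q p.
Proof.
move=> /path_homotopicP[h [hc hp ht]]; apply/path_homotopicP.
exists (fun u => h (u.1, 1 - u.2)); split.
- within_along hc.
  by move=> u [? ?]; split => //; exact: intervalC.
- by move=> s Is; rewrite /= subr0 subrr; have [] := hp s Is.
- by move=> t It; apply: ht; exact: intervalC.
Qed.

Lemma path_homotopic_trans x y p q r :
  path_homotopic x y p q -> path_homotopic x y q r -> path_homotopic x y p r.
Proof.
move=> /path_homotopicP[h [hc hp ht]] /path_homotopicP[k [kc kp kt]]; apply/path_homotopicP.
exists (fun u => if u.2 <= 2^-1 then h (u.1, 2 * u.2) else k (u.1, 2 * u.2 - 1)); split.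
- apply: (within_if_le (c := snd)).
  + exact: closed_square.
  + by move=> u; exact: cvg_snd.
  + within_along hc.
    by move=> u [[? ?] /= ?]; split => //; exact: half_itv.
  + within_along kc.
    by move=> u [[? ?] /= ?]; split => //; exact: half_itv'.
  move=> u [I1 _] ->; rewrite divff // (_ : _ - 1 = 0); last lra.
  by have [_ ->] := hp _ I1; have [-> _] := kp _ I1.
- move=> s Is /=; rewrite invr_ge0 ler0n mulr0; have [-> _] := hp s Is; split => //.
  rewrite ifF; last by apply/negbTE; rewrite -ltNge; lra.
  by rewrite (_ : 2 * 1 - 1 = 1); [have [_ ->] := kp s Is|lra].
- move=> t It /=; case: leP => th; first by apply: ht; exact: half_itv.
  by apply: kt; apply: half_itv' => //; exact: ltW.
Qed.

(* Any two paths with the same ends in a convex set are homotopic by straight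
   segments, so their images under a continuous map are homotopic. *)
Lemma convex_homotopic (V : normedModType R) (D : set V) (F : V -> X) (a b : R -> V) x y p q :
  (forall u v t, D u -> D v -> I t -> D (u + t *: (v - u))) ->
  {within D, continuous F} ->
  {within I, continuous a} -> {within I, continuous b} ->
  (forall s, I s -> D (a s)) -> (forall s, I s -> D (b s)) ->
  a 0 = b 0 -> a 1 = b 1 -> F (a 0) = x -> F (a 1) = y ->
  (forall s, I s -> F (a s) = p s) -> (forall s, I s -> F (b s) = q s) ->
  path_homotopic x y p q.
Proof.
move=> Dc Fc ac bc aD bD ab0 ab1 Fx Fy Fp Fq; apply/path_homotopicP.
exists (fun u => F (a u.1 + u.2 *: (b u.1 - a u.1))); split.
- have a1 : {within I2, continuous (fun u => a u.1)}.
    by within_along ac; move=> u [].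
  have b1 : {within I2, continuous (fun u => b u.1)}.
    by within_along bc; move=> u [].
  within_along Fc.
  by move=> u [? ?]; apply: Dc => //; [exact: aD | exact: bD].
- by move=> s Is; rewrite /= scale0r addr0 scale1r addrC subrK Fp // Fq.
- by move=> t It; rewrite /= -ab0 -ab1 !subrr !scaler0 !addr0.
Qed.

Lemma interval_convex (u v t : R) : I u -> I v -> I t -> I (u + t *: (v - u)).
Proof.
move=> /andP[u0 u1] /andP[v0 v1] /andP[t0 t1]; rewrite /GRing.scale /=.
by apply/andP; split; nra.
Qed.

Lemma square_convex (u v : R * R) t : I2 u -> I2 v -> I t -> I2 (u + t *: (v - u)).
Proof. by move=> [? ?] [? ?] It; split; apply: interval_convex. Qed.

Lemma path_homotopic_refl x y p q : is_path x y p -> (forall s, I s -> p s = q s) ->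
  path_homotopic x y p q.
Proof.
move=> /is_pathP[pc p0 p1] pq.
by apply: (@convex_homotopic R I p id id) => //; [exact: interval_convex|exact: within_id..].
Qed.

Lemma path_homotopic_concat x y z p p' q q' :
  path_homotopic x y p p' -> path_homotopic y z q q' ->
  path_homotopic x z (path_concat p q) (path_concat p' q').
Proof.
move=> /path_homotopicP[h [hc hp ht]] /path_homotopicP[k [kc kp kt]]; apply/path_homotopicP.
exists (fun u => if u.1 <= 2^-1 then h (2 * u.1, u.2) else k (2 * u.1 - 1, u.2)); split.
- apply: (within_if_le (c := fst)).
  + exact: closed_square.
  + by move=> u; exact: cvg_fst.
  + within_along hc.
    by move=> u [[? ?] /= ?]; split => //; exact: half_itv.
  + within_along kc.
    by move=> u [[? ?] /= ?]; split => //; exact: half_itv'.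
  move=> u [_ I2] ->; rewrite divff // (_ : _ - 1 = 0); last lra.
  by have [_ ->] := ht _ I2; have [-> _] := kt _ I2.
- move=> s Is /=; rewrite /path_concat; case: leP => sh.
    by have := hp (2 * s) (half_itv Is sh).
  by have := kp (2 * s - 1) (half_itv' Is (ltW sh)).
- move=> t It /=; rewrite invr_ge0 ler0n mulr0; have [-> _] := ht t It; split => //.
  rewrite ifF; last by apply/negbTE; rewrite -ltNge; lra.
  by rewrite (_ : 2 * 1 - 1 = 1); [have [_ ->] := kt t It|lra].
Qed.

Lemma path_concat_assoc w x y z p q r :
  is_path w x p -> is_path x y q -> is_path y z r ->
  path_homotopic w z (path_concat (path_concat p q) r) (path_concat p (path_concat q r)).
Proof.
move=> pP qP rP; have /is_pathP[Fc F0 F1] := is_path_concat pP (is_path_concat qP rP).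
have /is_pathP[_ p0 p1] := pP; have /is_pathP[_ q0 q1] := qP; have /is_pathP[_ r0 r1] := rP.
(* The concave piecewise linear reparametrization with breakpoints at 1/4 and 1/2, sent to 1/2 and
   3/4. As a minimum of affine functions its continuity is immediate. *)
pose a (s : R) := Num.min (2 * s) (Num.min (s + 4^-1) (2^-1 * s + 2^-1)).
have a1 s : s <= 4^-1 -> a s = 2 * s.
  by move=> ?; rewrite /a min_l // le_min; apply/andP; split; lra.
have a2 s : 4^-1 <= s -> s <= 2^-1 -> a s = s + 4^-1.
  by move=> ? ?; rewrite /a min_r ?min_l //; first lra; lra.
have a3 s : 2^-1 <= s -> a s = 2^-1 * s + 2^-1.
  by move=> ?; rewrite /a min_r ?min_r //; first lra; lra.
have aI s : I s -> I (a s).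
  move=> /andP[? ?]; apply/andP; case: (leP s 4^-1) => [?|?]; first by rewrite a1 //; split; lra.
  by case: (leP s 2^-1) => [?|?]; [rewrite a2 //; [split|]|rewrite a3 //; [split|]]; lra.
apply: (@convex_homotopic R I (path_concat p (path_concat q r)) a id) => //.
- exact: interval_convex.
- by rewrite /a; within_tac.
- exact: within_id.
- by rewrite a1 ?mulr0; [|lra].
- by rewrite a3 //=; lra.
- by rewrite a1 ?mulr0 ?F0; [|lra].
- have h : 2^-1 <= 1 :> R by lra.
  by rewrite (a3 _ h) (_ : 2^-1 * 1 + 2^-1 = 1) ?F1; [|lra].
move=> s /andP[? ?]; case: (leP s 4^-1) => [s4|s4].
  have h1 : 2 * s <= 2^-1 by lra.
  have h2 : s <= 2^-1 by lra.
  by rewrite a1 // /path_concat h1 h2.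
case: (leP s 2^-1) => [s2|s2].
  have h1 : (s + 4^-1 <= 2^-1) = false by apply/negbTE; rewrite -ltNge; lra.
  have h2 : 2 * (s + 4^-1) - 1 <= 2^-1 by lra.
  have h3 : (2 * s <= 2^-1) = false by apply/negbTE; rewrite -ltNge; lra.
  rewrite a2 //; last exact: ltW.
  by rewrite /path_concat h1 h2 s2 h3; congr q; lra.
have h1 : (2^-1 * s + 2^-1 <= 2^-1) = false by apply/negbTE; rewrite -ltNge; lra.
have h2 : (2 * (2^-1 * s + 2^-1) - 1 <= 2^-1) = false.
  by apply/negbTE; rewrite -ltNge; lra.
have h3 : (s <= 2^-1) = false by apply/negbTE; rewrite -ltNge.
rewrite a3; last exact: ltW.
by rewrite /path_concat h1 h2 h3; congr r; lra.
Qed.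

Lemma path_cst_concat x y p : is_path x y p ->
  path_homotopic x y (path_concat (fun _ => x) p) p.
Proof.
move=> /is_pathP[pc p0 p1].
have m0 : Num.max 0 (2 * 0 - 1) = 0 :> R by apply/max_l; lra.
have m1 : Num.max 0 (2 * 1 - 1) = 1 :> R.
  by rewrite (_ : 2 * 1 - 1 = 1); [exact/max_r/ler01|lra].
apply: (@convex_homotopic R I p (fun s => Num.max 0 (2 * s - 1)) id).
- exact: interval_convex.
- exact: pc.
- by within_tac.
- exact: within_id.
- move=> s /andP[? ?]; rewrite /interval /= le_max ge_max ler01 lexx /=; lra.
- by [].
- exact: m0.
- exact: m1.
- by rewrite m0.
- by rewrite m1.
- move=> s /andP[? ?]; rewrite /path_concat; case: (leP s 2^-1) => ?.
    by rewrite (max_l (_ : 2 * s - 1 <= 0)) ?p0 //; lra.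
  by rewrite (max_r (_ : 0 <= 2 * s - 1)) //; lra.
by [].
Qed.

End Paths.

(** The two ways around the square have the same ends, and the square is convex. *)
Lemma square_homotopic (R : realType) (X : topologicalType) (H : R * R -> X) :
  {within square, continuous H} ->
  path_homotopic (H (0, 0)) (H (1, 1))
    (path_concat (fun s => H (s, 0)) (fun s => H (1, s)))
    (path_concat (fun s => H (0, s)) (fun s => H (s, 1))).
Proof.
move=> Hc; have I0 := @interval0 R; have I1 := @interval1 R.
have e1 : is_path ((0, 0) : R * R) (1, 0) (fun s => (s, 0)).
  by apply/is_pathP; split => //; within_tac.
have e2 : is_path ((1, 0) : R * R) (1, 1) (fun s => (1, s)).
  by apply/is_pathP; split => //; within_tac.
have e3 : is_path ((0, 0) : R * R) (0, 1) (fun s => (0, s)).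
  by apply/is_pathP; split => //; within_tac.
have e4 : is_path ((0, 1) : R * R) (1, 1) (fun s => (s, 1)).
  by apply/is_pathP; split => //; within_tac.
have /is_pathP[ac a0 a1] := is_path_concat e1 e2.
have /is_pathP[bc b0 b1] := is_path_concat e3 e4.
apply: (@convex_homotopic R X (R * R)%type square H _ _ _ _ _ _ _ Hc ac bc).
- exact: square_convex.
- move=> s Is; rewrite /path_concat; case: leP => sh; split => //=.
    exact: half_itv.
  by apply: half_itv' => //; exact: ltW.
- move=> s Is; rewrite /path_concat; case: leP => sh; split => //=.
    exact: half_itv.
  by apply: half_itv' => //; exact: ltW.
- by rewrite a0 b0.
- by rewrite a1 b1.
- by rewrite a0.
- by rewrite a1.
- by move=> s _; rewrite /path_concat; case: ifP.
- by move=> s _; rewrite /path_concat; case: ifP.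
Qed.

(** * Labellings of aspherical spaces *)

Section Labellings.
Context {R : realType} {X : topologicalType}.
Local Notation I := (@interval R).

(* A labelling of the points by dimension, and by a class of paths to [x], which
   is locally constant as long as the dimension does not change: this is the
   form in which dimension two enters. *)
Definition flat_labelling (x : X) (ty : X -> cell_dim) (pi : X -> R -> X) : Prop :=
  (forall y, is_path y x (pi y)) /\
  forall y : X, exists2 N, nbhs y N & forall z z' a, N z -> N z' -> ty z = ty z' ->
    is_path z z' a -> (forall s, I s -> N (a s)) ->
    path_homotopic z x (path_concat a (pi z')) (pi z).

Variables (x : X) (G : groupType) (phi : (R -> X) -> G).
Hypothesis phi_eq : forall p q, is_path x x p -> is_path x x q ->
  phi p = phi q <-> path_homotopic x x p q.
Hypothesis phiM : forall p q, is_path x x p -> is_path x x q ->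
  phi (path_concat p q) = (phi p * phi q)%g.
Variables (ty : X -> cell_dim) (pi : X -> R -> X).
Hypothesis flat : flat_labelling x ty pi.

Let piP y : is_path y x (pi y). Proof. exact: flat.1. Qed.

Lemma phi_homotopic p q : is_path x x p -> is_path x x q -> path_homotopic x x p q ->
  phi p = phi q.
Proof. by move=> pP qP; apply: (phi_eq pP qP).2. Qed.

Lemma is_path_ext y z (p q : R -> X) : is_path y z p -> (forall s, I s -> p s = q s) ->
  is_path y z q.
Proof.
move=> /is_pathP[pc p0 p1] pq; apply/is_pathP; split; first exact: within_ext pq pc.
  by rewrite -pq //; exact: interval0.
by rewrite -pq //; exact: interval1.
Qed.

Lemma phi_ext p q : is_path x x p -> (forall s, I s -> p s = q s) -> phi p = phi q.
Proof.
move=> pP pq; apply: phi_homotopic => //; first exact: is_path_ext pP pq.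
exact: path_homotopic_refl.
Qed.

Lemma phi_cst : phi (fun _ => x) = 1%g.
Proof.
have cP := is_path_cst (R := R) x.
have : phi (path_concat (fun _ => x) (fun _ => x)) = phi (fun _ => x).
  by apply: phi_ext => [|s _]; [exact: (is_path_concat cP cP) | rewrite /path_concat if_same].
by rewrite phiM // -[RHS]mulg1 => /mulgI.
Qed.

(** The image of the segment from 0 to [v], continued by [pi], is a loop at [x] when [F 0 = x].
    Since [pi x] may be a nontrivial loop, its class is divided out, which gives the base point the
    group element 1. *)
Definition path_label (V : lmodType R) (F : V -> X) (v : V) : cell_dim * G :=
  (ty (F v), (phi (path_concat (fun s => F (s *: v)) (pi (F v))) * (phi (pi x))^-1)%g).

Definition convex_dom (V : normedModType R) (D : set V) :=
  D 0 /\ forall u v t, D u -> D v -> I t -> D (u + t *: (v - u)).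

Lemma convex_domZ (V : normedModType R) (D : set V) v t : convex_dom D -> D v -> I t -> D (t *: v).
Proof. by move=> [D0 Dc] Dv It; have := Dc 0 v t D0 Dv It; rewrite add0r subr0. Qed.

Section Domain.
Variables (V : normedModType R) (D : set V) (F : V -> X).
Hypothesis Dc : convex_dom D.
Hypothesis Fc : {within D, continuous F}.
Hypothesis F0 : F 0 = x.

Lemma is_path_comp (b : R -> V) : {within I, continuous b} -> (forall s, I s -> D (b s)) ->
  is_path (F (b 0)) (F (b 1)) (fun s => F (b s)).
Proof. by move=> bc bD; apply/is_pathP; split => //; apply: (within_comp bc Fc). Qed.

Lemma within_seg (u v : V) : {within I, continuous (fun s : R => u + s *: (v - u))}.
Proof. by within_tac. Qed.

Lemma ray_path v : D v -> is_path x (F v) (fun s => F (s *: v)).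
Proof.
move=> Dv; have := @is_path_comp (fun s => s *: v); rewrite scale0r scale1r F0; apply.
  by within_tac.
by move=> s Is; exact: convex_domZ.
Qed.

(** In a convex domain the straight segment is homotopic to any path [b] with the same ends. This
    allows a path to be chosen on which [F] is known. *)
Lemma label_along (b : R -> V) v : {within I, continuous b} -> (forall s, I s -> D (b s)) ->
  b 0 = 0 -> b 1 = v ->
  path_label F v = (ty (F v), (phi (path_concat (fun s => F (b s)) (pi (F v))) * (phi (pi x))^-1)%g).
Proof.
move=> bc bD b0 b1; have Dv : D v by rewrite -b1; apply: bD; exact: interval1.
rewrite /path_label; congr (_, (_ * _)%g).
have bP := is_path_comp bc bD; rewrite b0 b1 F0 in bP.
apply: phi_homotopic; [exact: is_path_concat (ray_path Dv) (piP _)|exact: is_path_concat bP (piP _)|].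
apply: path_homotopic_concat (path_homotopic_refl (piP _) (fun _ _ => erefl)).
apply: (@convex_homotopic _ _ V D F (fun s => s *: v) b) => //.
- exact: Dc.2.
- by within_tac.
- by move=> s Is; exact: convex_domZ.
- by rewrite scale0r b0.
- by rewrite scale1r b1.
- by rewrite scale0r.
- by rewrite scale1r.
Qed.

Lemma label_const (b : R -> V) v : {within I, continuous b} -> (forall s, I s -> D (b s)) ->
  b 0 = 0 -> b 1 = v -> (forall s, I s -> F (b s) = x) -> path_label F v = (ty x, 1%g).
Proof.
move=> bc bD b0 b1 bx; have Fv : F v = x by rewrite -b1; apply: bx; exact: interval1.
rewrite (label_along bc bD b0 b1) Fv; congr (_, _).
have bP : is_path x x (fun s => F (b s)).
  by apply: is_path_ext (is_path_cst x) _ => s /bx.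
rewrite phiM // (_ : phi (fun s => F (b s)) = 1%g) ?mul1g ?mulgV //.
by rewrite -phi_cst; apply: phi_ext => // s /bx.
Qed.

(** For close [u] and [v] the image of the segment between them stays in a neighborhood where
    flatness applies; so [pi (F u)] may be replaced by this segment followed by [pi (F v)]. In the
    convex domain, the ray to [u] followed by the segment is homotopic to the ray to [v]. *)
Lemma label_coherent : compact D -> coherent D (path_label F).
Proof.
move=> Dcpt.
pose good (N : set X) := forall z z' a, N z -> N z' -> ty z = ty z' ->
    is_path z z' a -> (forall s, I s -> N (a s)) ->
    path_homotopic z x (path_concat a (pi z')) (pi z).
(* A Lebesgue number for the cover of the compact [D] by preimages of the neighborhoods in
   [flat]. *)
have [e e0 eP] : exists2 e : R, 0 < e & forall v, D v ->
    exists2 N, good N & forall w, D w -> `|v - w| < e -> N (F w).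
  have /near_covering_withinP/(_ _ (0^'+ : set_system R) (fun e v => exists2 N, good N &
      forall w, D w -> `|v - w| < e -> N (F w))) := (compact_near_coveringP D).1 Dcpt.
  case.
    move=> v Dv; have [N Nv Ngood] := flat.2 (F v).
    have /withinP/(_ v Dv N Nv)/nbhs_ballP[r r0 rN] := Fc.
    exists (ball v (r / 2), [set e | 0 < e < r / 2]).
      split; first by apply: nbhsx_ballx; rewrite /= divr_gt0.
      near=> e; apply/andP; split => //.
      by near: e; apply: nbhs_right_lt; rewrite divr_gt0.
    move=> [v' e] /= [vv' /andP[e0 er]] Dv'; exists N => // w Dw v'w; apply: rN => //.
    rewrite -ball_normE /= in vv' *; apply: le_lt_trans (ler_distD v' _ _) _.
    by rewrite [r]splitr ltrD //; exact: lt_trans v'w er.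
  move=> r /= r0 rP; exists (r / 2); first by rewrite divr_gt0.
  apply: rP; rewrite ?divr_gt0 //= sub0r normrN gtr0_norm ?divr_gt0 //.
  by rewrite ltr_pdivrMr // ltr_pMr // ltr1n.
exists e => // u v Du Dv uv tyE; rewrite /path_label /=; congr (_ * _)%g.
have [N Ngood NP] := eP u Du.
have segD s : I s -> D (u + s *: (v - u)) by move=> Is; exact: Dc.2.
have segN s : I s -> N (F (u + s *: (v - u))).
  move=> Is; apply: NP; first exact: segD.
  rewrite opprD addrA subrr sub0r normrN normrZ; apply: le_lt_trans uv.
  by rewrite distrC ler_piMl // interval_norm.
have aP : is_path (F u) (F v) (fun s => F (u + s *: (v - u))).
  have := is_path_comp (@within_seg u v) segD.
  by rewrite scale0r addr0 scale1r addrC subrK.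
have NFu : N (F u) by have := segN 0 interval0; rewrite scale0r addr0.
have NFv : N (F v) by have := segN 1 interval1; rewrite scale1r addrC subrK.
have H := Ngood _ _ _ NFu NFv tyE aP segN.
have ruP := ray_path Du; have rvP := ray_path Dv.
have aPi := is_path_concat aP (piP (F v)).
apply: (etrans (y := phi (path_concat (fun s => F (s *: u))
    (path_concat (fun s => F (u + s *: (v - u))) (pi (F v)))))).
  apply: phi_homotopic; [exact: (is_path_concat ruP (piP _)) | exact: (is_path_concat ruP aPi) |].
  exact: (path_homotopic_concat (path_homotopic_refl ruP (fun _ _ => erefl))
    (path_homotopic_sym H)).
apply: phi_homotopic; [exact: (is_path_concat ruP aPi) | exact: (is_path_concat rvP (piP _)) |].
apply: path_homotopic_trans (path_homotopic_sym (path_concat_assoc ruP aP (piP _))) _.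
apply: path_homotopic_concat (path_homotopic_refl (piP _) (fun _ _ => erefl)).
have rayD w s : D w -> I s -> D (s *: w) by exact: convex_domZ.
have b1P : is_path (0 : V) u (fun s => s *: u).
  by apply/is_pathP; rewrite scale0r scale1r; split => //; within_tac.
have b2P : is_path u v (fun s => u + s *: (v - u)).
  apply/is_pathP; rewrite scale0r scale1r addr0 [u + _]addrC subrK; split => //.
  exact: (@within_seg u v).
have /is_pathP[bc b0 b1] := is_path_concat b1P b2P.
apply: (@convex_homotopic _ _ V D F _ (fun s => s *: v) _ _ _ _ Dc.2 Fc bc).
- by within_tac.
- move=> s Is; rewrite /path_concat; case: leP => sh.
    by apply: rayD => //; exact: half_itv.
  by apply: segD; apply: half_itv' => //; exact: ltW.
- by move=> s; exact: rayD.
- by rewrite b0 scale0r.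
- by rewrite b1 scale1r.
- by rewrite b0.
- by rewrite b1.
- by move=> s _; rewrite /path_concat; case: ifP.
- by [].
Unshelve. all: by end_near. Qed.

End Domain.

Lemma label_ext (V : normedModType R) (D : set V) (F F' : V -> X) v :
  convex_dom D -> {within D, continuous F} -> F 0 = x ->
  (forall u, D u -> F u = F' u) -> D v -> path_label F v = path_label F' v.
Proof.
move=> Dc Fc F0 FF' Dv; rewrite /path_label -FF' //; congr (_, (_ * _)%g).
apply: phi_ext; first exact: (is_path_concat (ray_path Dc Fc F0 Dv) (piP _)).
by move=> s Is; rewrite /path_concat; case: leP => sh //; rewrite FF' //;
  apply: convex_domZ => //; exact: half_itv.
Qed.

(** Labels read in the coordinates of a face start from the corner [k 0] instead of the origin. The
    path [b] between the two is sent to a loop, whose class is the discrepancy. *)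
Lemma label_translate (V V' : normedModType R) (D : set V) (D' : set V')
    (F : V -> X) (k : V' -> V) (b : R -> V) v :
  convex_dom D -> {within D, continuous F} -> F 0 = x ->
  convex_dom D' -> {within D', continuous k} -> (forall u, D' u -> D (k u)) ->
  {within I, continuous b} -> (forall s, I s -> D (b s)) -> b 0 = 0 -> b 1 = k 0 ->
  F (k 0) = x -> D' v ->
  path_label F (k v) = translate (phi (fun s => F (b s))) (path_label (fun u => F (k u)) v).
Proof.
move=> Dc Fc F0 D'c kc kD bc bD b0 b1 Fk0 D'v.
have rayD s : I s -> D' (s *: v) by move=> Is; exact: convex_domZ.
have cP : is_path (k 0) (k v) (fun s => k (s *: v)).
  apply/is_pathP; rewrite scale0r scale1r; split => //.
  by within_along kc; exact: rayD.
have bP : is_path 0 (k 0) b by apply/is_pathP.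
have /is_pathP[bcc bc0 bc1] := is_path_concat bP cP.
have FbP : is_path x x (fun s => F (b s)).
  by have := is_path_comp Fc bc bD; rewrite b0 b1 F0 Fk0.
have FcP : is_path x (F (k v)) (fun s => F (k (s *: v))).
  have := @is_path_comp V D F Fc (fun s => k (s *: v)); rewrite scale0r scale1r Fk0; apply.
    by have /is_pathP[] := cP.
  by move=> s Is; exact/kD/rayD.
rewrite (label_along Dc Fc F0 bcc _ bc0 bc1); last first.
  move=> s Is; rewrite /path_concat; case: leP => sh; first by apply: bD; exact: half_itv.
  by apply/kD/rayD; apply: half_itv' => //; exact: ltW.
rewrite /path_label /translate /=; congr (_, _); rewrite mulgA; congr (_ * _)%g.
have FcpiP := is_path_concat FcP (piP (F (k v))).
rewrite -phiM //; apply: phi_homotopic.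
- have := is_path_concat (is_path_concat FbP FcP) (piP (F (k v))).
  move=> /is_path_ext; apply=> s _; rewrite /path_concat; by case: ifP => // _; case: ifP.
- exact: (is_path_concat FbP FcpiP).
apply: path_homotopic_trans (path_concat_assoc FbP FcP (piP _)).
apply: path_homotopic_refl.
  have := is_path_concat (is_path_concat FbP FcP) (piP (F (k v))).
  move=> /is_path_ext; apply=> s _; rewrite /path_concat; by case: ifP => // _; case: ifP.
by move=> s _; rewrite /path_concat; case: ifP => // _; case: ifP.
Qed.

End Labellings.

(** * Spheres assembled from five faces of a cube *)

Section Spheres.
Context {R : realType} {X : topologicalType}.
Local Notation I := (@interval R).
Local Notation I2 := (@square R).

Lemma compact_interval : compact I.
Proof. by rewrite -itv01E; exact: segment_compact. Qed.

Lemma compact_square : compact I2.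
Proof. exact: (compact_setX compact_interval compact_interval). Qed.

Lemma compact_cube3 : compact (@cube3 R).
Proof. exact: (compact_setX compact_square compact_interval). Qed.

Definition boundary_point (y z : R) := [\/ y = 0, y = 1, z = 0 | z = 1].

(** Maps on the faces of the unit cube: [A] on x = 1, [B0] and [B1] on z = 0 and z = 1, [C0] and
    [C1] on y = 0 and y = 1, where [C0] depends on x alone. The face x = 0 is constant with value
    [x0], and the hypotheses are agreement along edges. *)
Variables (A B0 B1 C1 : R * R -> X) (C0 : R -> X) (x0 : X).
Hypothesis Ac : {within I2, continuous A}.
Hypothesis B0c : {within I2, continuous B0}.
Hypothesis B1c : {within I2, continuous B1}.
Hypothesis C1c : {within I2, continuous C1}.
Hypothesis C0c : {within I, continuous C0}.
Hypothesis A_B0 : forall s, I s -> A (s, 0) = B0 (1, s).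
Hypothesis A_B1 : forall s, I s -> A (s, 1) = B1 (1, s).
Hypothesis A_C0 : forall s, I s -> A (0, s) = C0 1.
Hypothesis A_C1 : forall s, I s -> A (1, s) = C1 (1, s).
Hypothesis B0_C0 : forall s, I s -> B0 (s, 0) = C0 s.
Hypothesis B1_C0 : forall s, I s -> B1 (s, 0) = C0 s.
Hypothesis B0_C1 : forall s, I s -> B0 (s, 1) = C1 (s, 0).
Hypothesis B1_C1 : forall s, I s -> B1 (s, 1) = C1 (s, 1).
Hypothesis B0_0 : forall s, I s -> B0 (0, s) = x0.
Hypothesis B1_0 : forall s, I s -> B1 (0, s) = x0.
Hypothesis C1_0 : forall s, I s -> C1 (0, s) = x0.
Hypothesis C0_0 : C0 0 = x0.

Definition sphere_side (x y z : R) : X :=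
  if z == 0 then B0 (x, y) else if z == 1 then B1 (x, y)
  else if y == 0 then C0 x else C1 (x, z).

Definition center_dist (v : R * R) : R := Num.max `|v.1 - 2^-1| `|v.2 - 2^-1|.

(* The inverse of [wrap] on the faces of the cube other than x = 0. *)
Definition wrapped_sphere (v : R * R) : X :=
  let n := 2 * center_dist v in
  if n <= 2^-1 then A (2^-1 + 2 * (v.1 - 2^-1), 2^-1 + 2 * (v.2 - 2^-1))
  else sphere_side (2 * (1 - n)) (2^-1 + (v.1 - 2^-1) / n) (2^-1 + (v.2 - 2^-1) / n).

Lemma halfK (w : R) : 2^-1 + w - 2^-1 = w.
Proof. by rewrite addrAC subrr add0r. Qed.

Lemma center_dist_wrap x y z : I x ->
  center_dist (wrap x y z).1 = (1 - x / 2) * center_dist (y, z).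
Proof.
move=> /andP[? ?]; rewrite /center_dist /wrap /= !halfK !normrM.
by rewrite ger0_norm ?maxr_pMr //; lra.
Qed.

Lemma abs_half (y : R) : I y -> `|y - 2^-1| <= 2^-1.
Proof. by move=> /andP[? ?]; rewrite ler_norml; apply/andP; split; lra. Qed.

Lemma center_dist_le y z : I y -> I z -> center_dist (y, z) <= 2^-1.
Proof. by move=> Iy Iz; rewrite ge_max !abs_half. Qed.

Lemma center_dist_boundary y z : I y -> I z -> boundary_point y z ->
  center_dist (y, z) = 2^-1.
Proof.
move=> Iy Iz bd; apply/eqP; rewrite eq_le center_dist_le //= le_max.
have h0 : 2^-1 <= `|0 - 2^-1 : R| by rewrite sub0r normrN ger0_norm ?invr_ge0.
have h1 : 2^-1 <= `|1 - 2^-1 : R| by rewrite ger0_norm; lra.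
by case: bd => ->; rewrite ?h0 ?h1 ?orbT.
Qed.

Lemma sphere_side1 y z : I y -> I z -> boundary_point y z -> sphere_side 1 y z = A (y, z).
Proof.
move=> Iy Iz; have I0 := @interval0 R; have I1 := @interval1 R.
rewrite /sphere_side; case: eqP => [-> _|z0]; first by rewrite A_B0.
case: eqP => [-> _|z1]; first by rewrite A_B1.
case: eqP => [-> _|y0]; first by rewrite A_C0.
by case => // ->; rewrite A_C1.
Qed.

Lemma wrapped_sphere_inner y z : I y -> I z -> wrapped_sphere (wrap 1 y z).1 = A (y, z).
Proof.
move=> Iy Iz; rewrite /wrapped_sphere center_dist_wrap; last exact: interval1.
have := center_dist_le Iy Iz; set d := center_dist _ => d2.
rewrite ifT; last by lra.
by rewrite /wrap /=; congr (A (_, _)); lra.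
Qed.

Lemma wrapped_sphere_outer x y z : I x -> I y -> I z -> boundary_point y z ->
  wrapped_sphere (wrap x y z).1 = sphere_side x y z.
Proof.
move=> Ix Iy Iz bd; have [->|x1] := eqVneq x 1.
  by rewrite wrapped_sphere_inner // sphere_side1.
rewrite /wrapped_sphere center_dist_wrap // center_dist_boundary //.
have {x1} /andP[x_0 x_1] : (0 <= x) && (x < 1).
  by move: Ix => /andP[-> ?] /=; rewrite lt_neqAle x1.
have -> : 2 * ((1 - x / 2) * 2^-1) = 1 - x / 2 by lra.
rewrite ifF; last by apply/negbTE; rewrite -ltNge; lra.
have n0 : 1 - x / 2 != 0 by apply/lt0r_neq0; lra.
rewrite /wrap /= !halfK ![(1 - x / 2) * _ / _]mulrAC !divff // !mul1r.
by congr sphere_side; lra.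
Qed.

Lemma wrap_cover (v : R * R) : I2 v ->
  (exists y z, [/\ I y, I z & v = (wrap 1 y z).1]) \/
  (exists x y z, [/\ I x, I y, I z, boundary_point y z & v = (wrap x y z).1]).
Proof.
case: v => v1 v2 [/= Iv1 Iv2]; pose n := 2 * center_dist (v1, v2).
have [a1 a2] : `|v1 - 2^-1| <= n / 2 /\ `|v2 - 2^-1| <= n / 2.
  by rewrite /n mulrC mulKf // /center_dist !le_max /= !lexx orbT.
move: a1 a2; rewrite !ler_norml => /andP[? ?] /andP[? ?].
case: (leP n 2^-1) => nh; [left|right].
  exists (2^-1 + 2 * (v1 - 2^-1)), (2^-1 + 2 * (v2 - 2^-1)); split.
  - by apply/andP; split; lra.
  - by apply/andP; split; lra.
  by rewrite /wrap /=; congr (_, _); lra.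
have n0 : 0 < n by lra.
have n1 : n <= 1 by have := center_dist_le Iv1 Iv2; rewrite /n; lra.
have nK w : n * ((w - 2^-1) / n) = w - 2^-1 by rewrite mulrC mulfVK // lt0r_neq0.
have half w : - (n / 2) <= w - 2^-1 -> w - 2^-1 <= n / 2 -> I (2^-1 + (w - 2^-1) / n).
  move=> ? ?; have ? : (w - 2^-1) / n <= 2^-1 by rewrite ler_pdivrMr //; lra.
  have ? : - 2^-1 <= (w - 2^-1) / n by rewrite ler_pdivlMr //; lra.
  by apply/andP; split; lra.
(* The point lies on the concentric square of half-side [n / 2], and the parameter x of that square
   solves 1 - x / 2 = n. *)
exists (2 * (1 - n)), (2^-1 + (v1 - 2^-1) / n), (2^-1 + (v2 - 2^-1) / n).
split; [by apply/andP; split; lra|exact: half|exact: half| |].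
  have sgn w : `|w - 2^-1| = n / 2 -> 2^-1 + (w - 2^-1) / n = 0 \/ 2^-1 + (w - 2^-1) / n = 1.
    move=> wn; have nV : n / 2 / n = 2^-1 by rewrite mulrAC divff ?mul1r // lt0r_neq0.
    case: (leP 0 (w - 2^-1)) => w0; [right|left].
      by rewrite -(ger0_norm w0) wn nV; lra.
    by rewrite -[w - _]opprK -(ltr0_norm w0) wn mulNr nV subrr.
  have : n / 2 = `|v1 - 2^-1| \/ n / 2 = `|v2 - 2^-1|.
    rewrite /n mulrC mulKf // /center_dist /=; case: leP => _; by [right|left].
  by move=> [/esym/sgn[->|->]|/esym/sgn[->|->]]; [constructor 1|constructor 2|constructor 3|constructor 4].
by rewrite /wrap /= (_ : 1 - 2 * (1 - n) / 2 = n) ?halfK ?nK; [congr (_, _)|]; lra.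
Qed.

End Spheres.

Section SphereFilling.
Context {R : realType} {X : topologicalType}.
Local Notation I := (@interval R).
Local Notation I2 := (@square R).

Variables (A B0 B1 C1 : R * R -> X) (C0 : R -> X) (x0 : X).
Hypothesis Ac : {within I2, continuous A}.
Hypothesis B0c : {within I2, continuous B0}.
Hypothesis B1c : {within I2, continuous B1}.
Hypothesis C1c : {within I2, continuous C1}.
Hypothesis C0c : {within I, continuous C0}.
Hypothesis A_B0 : forall s, I s -> A (s, 0) = B0 (1, s).
Hypothesis A_B1 : forall s, I s -> A (s, 1) = B1 (1, s).
Hypothesis A_C0 : forall s, I s -> A (0, s) = C0 1.
Hypothesis A_C1 : forall s, I s -> A (1, s) = C1 (1, s).
Hypothesis B0_C0 : forall s, I s -> B0 (s, 0) = C0 s.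
Hypothesis B1_C0 : forall s, I s -> B1 (s, 0) = C0 s.
Hypothesis B0_C1 : forall s, I s -> B0 (s, 1) = C1 (s, 0).
Hypothesis B1_C1 : forall s, I s -> B1 (s, 1) = C1 (s, 1).
Hypothesis B0_0 : forall s, I s -> B0 (0, s) = x0.
Hypothesis B1_0 : forall s, I s -> B1 (0, s) = x0.
Hypothesis C1_0 : forall s, I s -> C1 (0, s) = x0.
Hypothesis C0_0 : C0 0 = x0.

Local Notation S := (wrapped_sphere A B0 B1 C1 C0).
Let I0 := @interval0 R.
Let I1 := @interval1 R.
Let n10 : (1 == 0 :> R) = false. Proof. exact: oner_eq0. Qed.

Let S_inner y z : I y -> I z -> S (wrap 1 y z).1 = A (y, z).
Proof. exact: wrapped_sphere_inner. Qed.

Let S_outer x y z : I x -> I y -> I z -> boundary_point y z ->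
  S (wrap x y z).1 = sphere_side B0 B1 C1 C0 x y z.
Proof. exact: wrapped_sphere_outer. Qed.

Let S_z0 x y : I x -> I y -> S (wrap x y 0).1 = B0 (x, y).
Proof.
by move=> Ix Iy; rewrite S_outer //; [rewrite /sphere_side eqxx | constructor 3].
Qed.

Let S_z1 x y : I x -> I y -> S (wrap x y 1).1 = B1 (x, y).
Proof.
by move=> Ix Iy; rewrite S_outer //; [rewrite /sphere_side n10 eqxx | constructor 4].
Qed.

Let S_y0 x z : I x -> I z -> S (wrap x 0 z).1 = C0 x.
Proof.
move=> Ix Iz; rewrite S_outer //; last by constructor 1.
rewrite /sphere_side eqxx; case: eqP => _; first exact: B0_C0.
by case: eqP => _; [exact: B1_C0|].
Qed.

Let S_y1 x z : I x -> I z -> S (wrap x 1 z).1 = C1 (x, z).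
Proof.
move=> Ix Iz; rewrite S_outer //; last by constructor 2.
rewrite /sphere_side n10; case: eqP => [->|_]; first exact: B0_C1.
by case: eqP => [->|_]; [exact: B1_C1|].
Qed.

(** The quotients by [n] need not be examined: composing with [wrap] on each of the five faces gives
    back one of the given continuous maps, and these faces cover the square. *)
Lemma wrapped_sphere_continuous : {within I2, continuous S}.
Proof.
pose k (i : option (bool * bool)) (p : R * R) : R * R := match i with
  | None => (wrap 1 p.1 p.2).1
  | Some (false, b) => (wrap p.1 p.2 b%:R).1
  | Some (true, b) => (wrap p.1 b%:R p.2).1
  end.
apply: (@within_pieces _ _ _ _ I2 S (fun _ : option (bool * bool) => I2) k).
- exact: norm_hausdorff.
- by move=> _; exact: compact_square.
- by move=> [[[] b]|]; rewrite /k /wrap /=; within_tac.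
- move=> [[[] []]|]; rewrite /k.
  + by apply: within_ext C1c => -[a b] [/= ? ?]; rewrite S_y1.
  + have C0c' : {within I2, continuous (fun p : R * R => C0 p.1)}.
      by within_along C0c; move=> p [].
    by apply: within_ext C0c' => -[a b] [/= ? ?]; rewrite S_y0.
  + by apply: within_ext B1c => -[a b] [/= ? ?]; rewrite S_z1.
  + by apply: within_ext B0c => -[a b] [/= ? ?]; rewrite S_z0.
  by apply: within_ext Ac => -[a b] [/= ? ?]; rewrite S_inner.
move=> v /wrap_cover[[y [z [Iy Iz ->]]]|[x [y [z [Ix Iy Iz bd ->]]]]].
  by exists None; exists (y, z).
case: bd => ->.
- by exists (Some (true, false)); exists (x, z).
- by exists (Some (true, true)); exists (x, z).
- by exists (Some (false, false)); exists (x, y).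
by exists (Some (false, true)); exists (x, y).
Qed.

Lemma wrap0E (y z : R) : wrap 0 y z = (y, z, 0).
Proof. by rewrite /wrap mul0r subr0 !mul1r ![2^-1 + _]addrC !subrK. Qed.

Let S_boundary y z : I y -> I z -> boundary_point y z -> S (y, z) = x0.
Proof.
move=> Iy Iz bd; rewrite -[(y, z)]/(y, z, 0 : R).1 -wrap0E S_outer //.
rewrite /sphere_side; do 3![case: eqP => _; rewrite ?B0_0 ?B1_0 ?C0_0 ?C1_0 //].
Qed.

(** The boundary of the square comes from the constant face x = 0, so [wrapped_sphere] represents an
    element of pi_2. Its null homotopy is [F], with time as third coordinate. *)
Lemma sphere_filling : trivial_homotopy_group R 2 x0 -> exists F : R * R * R -> X,
  [/\ {within @cube3 R, continuous F},
      [/\ forall y z, I y -> I z -> F (wrap 1 y z) = A (y, z),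
        forall x y, I x -> I y -> F (wrap x y 0) = B0 (x, y),
        forall x y, I x -> I y -> F (wrap x y 1) = B1 (x, y),
        forall x z, I x -> I z -> F (wrap x 0 z) = C0 x &
        forall x z, I x -> I z -> F (wrap x 1 z) = C1 (x, z)] &
      forall y z t, I y -> I z -> I t ->
        [\/ y = 0, y = 1, z = 0 | z = 1] \/ t = 1 -> F (y, z, t) = x0].
Proof.
move=> /(_ (fun v : 'rV[R]_2 => S (v 0 0, v 0 1)))[].
- have coordc (j : 'I_2) : {within @cube R 2, continuous (fun v : 'rV[R]_2 => v 0 j)}.
    by apply: continuous_subspaceT => v; exact: coord_continuous.
  have c01 := within_pair (coordc 0) (coordc 1).
  by apply: (within_comp c01 wrapped_sphere_continuous) => v vc; split; exact: vc.
- move=> v [vc [i vi]]; apply: S_boundary; [exact: vc..|].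
  case: (unliftP 0 i) vi => [j ->|->]; last by case=> ->; [constructor 1|constructor 2].
  by rewrite ord1 (_ : lift _ _ = 1) //=; [case=> ->; [constructor 3|constructor 4]|exact: val_inj].
move=> h [hc h01 hbd].
pose vec (y z : R) : 'rV[R]_2 := y *: delta_mx 0 0 + z *: delta_mx 0 1.
have vec0 y z : vec y z 0 0 = y by rewrite !mxE /= mulr1 mulr0 addr0.
have vec1 y z : vec y z 0 1 = z by rewrite !mxE /= mulr1 mulr0 add0r.
have veccube y z : I y -> I z -> @cube R 2 (vec y z).
  move=> Iy Iz i; case: (unliftP 0 i) => [j ->|->]; last by rewrite vec0.
  by rewrite ord1 (_ : lift _ _ = 1) ?vec1 //; exact: val_inj.
have vecbd y z : I y -> I z -> boundary_point y z -> @cube_boundary R 2 (vec y z).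
  move=> Iy Iz bd; split; first exact: veccube.
  by case: bd => ->; [exists 0; left|exists 0; right|exists 1; left|exists 1; right];
    rewrite ?vec0 ?vec1.
exists (fun p => h (vec p.1.1 p.1.2, p.2)).
have hS y z : I y -> I z -> h (vec y z, 0) = S (y, z).
  by move=> Iy Iz; have [-> _] := h01 _ (veccube _ _ Iy Iz); rewrite vec0 vec1.
have wI x y z : I x -> I y -> I z -> I (wrap x y z).1.1 /\ I (wrap x y z).1.2.
  by move=> Ix Iy Iz; have [[]] := wrap_cube Ix Iy Iz.
have hw x y z : I x -> I y -> I z ->
    h (vec (wrap x y z).1.1 (wrap x y z).1.2, (wrap x y z).2) = S (wrap x y z).1.
  by move=> Ix Iy Iz; have [? ?] := wI _ _ _ Ix Iy Iz; rewrite hS.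
split.
- have hc' : {within [set q | @cube R 2 q.1 /\ I q.2], continuous h}.
    by move: hc; rewrite itv01E.
  by rewrite /vec; within_along hc'; move=> p [[? ?] ?]; split => //; exact: veccube.
- split=> [y z|x y|x y|x z|x z] ? ?; rewrite hw //; [exact: S_inner|exact: S_z0|exact: S_z1|exact: S_y0|exact: S_y1].
move=> y z t Iy Iz It [bd|->] /=; last by have [_] := h01 _ (veccube _ _ Iy Iz).
by apply: hbd; [exact: vecbd | rewrite in_itv].
Qed.

End SphereFilling.

(** * Labelled squares and cubes in an aspherical space *)

Section Assembly.
Context {R : realType} {X : topologicalType}.
Local Notation I := (@interval R).
Local Notation I2 := (@square R).

(** The domain of the homotopy is reparametrized so that the right side of the new square runs along
    the second half of the old bottom, tracing [q], and then up the old constant right side. This is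
    the origin of the constant tail after [q]. *)
Lemma triangle_exists (x : X) (p q r : R -> X) :
  is_path x x p -> is_path x x q -> is_path x x r ->
  path_homotopic x x (path_concat p q) r ->
  exists D : R * R -> X, [/\ {within I2, continuous D},
    forall s, I s -> D (s, 0) = p s,
    forall s, I s -> D (1, s) = path_concat q (fun _ => x) s,
    forall s, I s -> D (s, 1) = r s &
    forall s, I s -> D (0, s) = x].
Proof.
move=> /is_pathP[pc p0 p1] /is_pathP[qc q0 q1] /is_pathP[rc r0 r1] /path_homotopicP[h [hc hp ht]].
pose R1 (y : R) := Num.min (2^-1 + y) 1.
pose R2 (y : R) := Num.max 0 (2 * y - 1).
have R1I y : I y -> I (R1 y).
  move=> /andP[? ?]; rewrite /interval /= /R1 le_min ge_min lexx orbT ler01 !andbT; lra.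
have R2I y : I y -> I (R2 y).
  move=> /andP[? ?]; rewrite /interval /= /R2 le_max ge_max lexx ler01 /=; lra.
have R11 : R1 1 = 1 by apply/min_r; lra.
have R10 : R1 0 = 2^-1 by rewrite /R1 addr0; apply/min_l; lra.
have R21 : R2 1 = 1 by rewrite /R2 (_ : 2 * 1 - 1 = 1); [exact/max_r/ler01|lra].
have R20 : R2 0 = 0 by apply/max_l; lra.
exists (fun u => h (u.1 * R1 u.2, (1 - u.1) * u.2 + u.1 * R2 u.2)); split.
- rewrite /R1 /R2; within_along hc => -[a b] [/= Ia Ib]; split => /=.
    by apply: intervalM => //; exact: R1I.
  have := R2I _ Ib; rewrite /R2; move: (Num.max _ _) => c /andP[? ?].
  move: Ia Ib => /andP[? ?] /andP[? ?]; apply/andP; split; nra.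
- move=> s Is /=; rewrite R10 R20 !mulr0 addr0.
  have Is2 : I (s * 2^-1) by move: Is => /andP[? ?]; apply/andP; split; lra.
  have [-> _] := hp _ Is2; rewrite /path_concat ifT; first by rewrite mulrC mulfVK.
  by move: Is => /andP[? ?]; lra.
- move=> s Is /=; rewrite subrr mul0r add0r !mul1r /path_concat.
  case: (leP s 2^-1) => sh.
    have -> : R2 s = 0 by apply/max_l; lra.
    have -> : R1 s = 2^-1 + s by apply/min_l; lra.
    have Is2 : I (2^-1 + s) by move: Is => /andP[? ?]; apply/andP; split; lra.
    have [-> _] := hp _ Is2; rewrite /path_concat; case: leP => sh'; last by congr q; lra.
    have -> : s = 0 by move: Is => /andP[? ?]; lra.
    by rewrite addr0 divff // p1 mulr0 q0.
  have -> : R1 s = 1 by apply/min_r; lra.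
  by have [_ ->] := ht _ (R2I _ Is).
- move=> s Is /=; rewrite R11 R21 !mulr1 subrK.
  by have [_ ->] := hp _ Is.
by move=> s Is /=; rewrite !mul0r addr0 subr0 mul1r; have [-> _] := ht _ Is.
Qed.

Variables (x : X) (G : groupType) (P : finite_presentation G).

Lemma translate1 (l : cell_dim * G) : translate 1%g l = l.
Proof. by case: l => t a; rewrite /translate /= mul1g. Qed.

Lemma convex_interval : convex_dom I.
Proof. by split; [exact: interval0 | exact: interval_convex]. Qed.

Lemma convex_square : convex_dom I2.
Proof. by split; [split; exact: interval0 | exact: square_convex]. Qed.

Lemma convex_cube3 : convex_dom (@cube3 R).
Proof.
split; first by split; [exact: convex_square.1|exact: interval0].
move=> u v t [? ?] [? ?] It; split; last exact: interval_convex.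
exact: convex_square.2.
Qed.

Theorem aspherical_cycles_split (ty : X -> cell_dim) (pi : X -> R -> X) :
  fundamental_group_isom R x G -> trivial_homotopy_group R 2 x ->
  flat_labelling x ty pi -> cycles_split P.
Proof.
move=> [phi [phi_eq phiM phi_surj]] pi2 flat.
have I0 := @interval0 R; have I1 := @interval1 R.
have ci := convex_interval; have cs := convex_square; have cc := convex_cube3.
have phi1 : phi (fun _ => x) = 1%g := phi_cst phi_eq phiM.
have cP := is_path_cst (R := R) x.
have /choice[lp lpP] (g : G) : exists p, is_path x x p /\ phi p = g.
  by have [p pP pg] := phi_surj g; exists p.
(* The constant tail is the one that [triangle_exists] puts on right sides; with it built into the
   loops, all sides of all squares are of the form [ga]. *)
pose ga g := path_concat (lp g) (fun _ => x).
have gaP g : is_path x x (ga g) by exact: (is_path_concat (lpP g).1 cP).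
have ga_phi g : phi (ga g) = g by rewrite (phiM _ _ (lpP g).1 cP) (lpP g).2 phi1 mulg1.
have gac g : {within I, continuous (ga g)} by have /is_pathP[] := gaP g.
have ga0 g : ga g 0 = x by have /is_pathP[] := gaP g.
have ga1 g : ga g 1 = x by have /is_pathP[] := gaP g.
have /choice[De DeP] (gh : G * G) : exists D : R * R -> X, [/\ {within I2, continuous D},
    forall s, I s -> D (s, 0) = ga gh.1 s,
    forall s, I s -> D (1, s) = ga gh.2 s,
    forall s, I s -> D (s, 1) = ga (gh.1 * gh.2)%g s &
    forall s, I s -> D (0, s) = x].
  apply: triangle_exists => //; first exact: (lpP _).1.
  apply/phi_eq => //; first exact: (is_path_concat (gaP _) (lpP _).1).
  by rewrite (phiM _ _ (gaP _) (lpP _).1) !ga_phi (lpP _).2.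
have Dc gh : {within I2, continuous (De gh)} by have [] := DeP gh.
have Db gh s : I s -> De gh (s, 0) = ga gh.1 s by have [_ + _ _ _] := DeP gh; apply.
have Dr gh s : I s -> De gh (1, s) = ga gh.2 s by have [_ _ + _ _] := DeP gh; apply.
have Dt gh s : I s -> De gh (s, 1) = ga (gh.1 * gh.2)%g s by have [_ _ _ + _] := DeP gh; apply.
have Dl gh s : I s -> De gh (0, s) = x by have [_ _ _ _] := DeP gh; apply.
have /choice[F3 F3P] (t : G * G * G) : exists F : R * R * R -> X,
  [/\ {within @cube3 R, continuous F},
      [/\ forall y z, I y -> I z -> F (wrap 1 y z) = De (t.1.2, t.2) (y, z),
        forall x y, I x -> I y -> F (wrap x y 0) = De (t.1.1, t.1.2) (x, y),
        forall x y, I x -> I y -> F (wrap x y 1) = De (t.1.1, (t.1.2 * t.2)%g) (x, y),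
        forall x z, I x -> I z -> F (wrap x 0 z) = ga t.1.1 x &
        forall x z, I x -> I z -> F (wrap x 1 z) = De ((t.1.1 * t.1.2)%g, t.2) (x, z)] &
      forall y z s, I y -> I z -> I s ->
        [\/ y = 0, y = 1, z = 0 | z = 1] \/ s = 1 -> F (y, z, s) = x].
  case: t => -[g h] k /=; apply: sphere_filling => // s Is.
  - by rewrite Db // Dr.
  - by rewrite Dt // Dr.
  - by rewrite Dl // ga1.
  - by rewrite !Dr.
  - by rewrite Db.
  - by rewrite Db.
  - by rewrite Dt // Db.
  - by rewrite !Dt // mulgA.
  - exact: Dl.
  - exact: Dl.
  - exact: Dl.
pose lab (V : normedModType R) (F : V -> X) := @path_label R X x G phi ty pi V F.
(* The common form of the face conditions: [k] parametrizes the face, [b] leads to its corner, and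
   the class of the image of [b] is the translating element. *)
have lab_face (V V' : normedModType R) (D : set V) (D' : set V') (F : V -> X) (F' : V' -> X)
    (k : V' -> V) (b : R -> V) g v : convex_dom D -> {within D, continuous F} -> F 0 = x ->
    convex_dom D' -> {within D', continuous k} -> (forall u, D' u -> D (k u)) ->
    {within I, continuous b} -> (forall s, I s -> D (b s)) -> b 0 = 0 -> b 1 = k 0 ->
    phi (fun s => F (b s)) = g -> F (k 0) = x -> (forall u, D' u -> F (k u) = F' u) -> D' v ->
    lab V F (k v) = translate g (lab V' F' v).
  move=> Dc' Fc F0 D'c kc kD bc bD b0 b1 bg Fk0 FF' D'v.
  rewrite /lab (label_translate phi_eq phiM flat Dc' Fc F0 D'c kc kD bc bD b0 b1) // bg.
  congr (translate _ _); apply: (label_ext phi_eq flat D'c _ Fk0 FF' D'v).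
  exact: within_comp kc Fc kD.
apply: (@labelled_cycles_split R G P (ty x) (fun g => lab R (ga g))
  (fun g h => lab _ (De (g, h))) (fun g h k => lab _ (F3 (g, h, k)))).
- by move=> g; apply: (label_coherent phi_eq flat ci (gac g) (ga0 g) compact_interval).
- move=> g h; apply: (label_coherent phi_eq flat cs (Dc (g, h)) _ compact_square).
  exact: Dl.
- move=> g h k; have [Fc _ Fb] := F3P (g, h, k).
  apply: (label_coherent phi_eq flat cc Fc _ compact_cube3).
  by apply: Fb => //; left; constructor 1.
- move=> g; apply: (label_const phi_eq phiM flat ci (gac g) (ga0 g) (b := fun _ => 0)) => //.
  by within_tac.
- move=> g; rewrite /lab /path_label ga1; congr (_, _).
  rewrite (_ : phi _ = (g * phi (pi x))%g) ?mulgK // -[in RHS](ga_phi g) -phiM //; last exact: flat.1.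
  by congr phi; apply/funext => s; rewrite /path_concat /GRing.scale /= mulr1.
- move=> g h s Is; rewrite -[lab R _ s]translate1.
  apply: (@lab_face _ _ I2 I _ _ (fun u => (u, 0)) (fun _ => 0)) => //.
  + exact: Dl.
  + by within_tac.
  + by within_tac.
  + by rewrite /= -phi1; congr phi; apply/funext => ?; exact: Dl.
  + exact: Dl.
  by move=> u Iu; rewrite Db.
- move=> g h s Is.
  apply: (@lab_face _ _ I2 I _ _ (fun u => (1, u)) (fun u => (u, 0))) => //.
  + exact: Dl.
  + by within_tac.
  + by within_tac.
  + rewrite -[RHS]ga_phi; apply/esym/(phi_ext phi_eq (gaP _)) => u Iu.
    by rewrite Db.
  + by rewrite Db.
  by move=> u Iu; rewrite Dr.
- move=> g h s Is; rewrite -[lab R _ s]translate1.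
  apply: (@lab_face _ _ I2 I _ _ (fun u => (u, 1)) (fun u => (0, u))) => //.
  + exact: Dl.
  + by within_tac.
  + by within_tac.
  + rewrite -phi1; apply/esym/(phi_ext phi_eq cP) => u Iu.
    by rewrite Dl.
  + exact: Dl.
  by move=> u Iu; rewrite Dt.
- move=> g h s Is; apply: (label_const phi_eq phiM flat cs (Dc (g, h)) _ (b := fun u => (0, u * s))) => //.
  + exact: Dl.
  + by within_tac.
  + by move=> u Iu; split => //; exact: intervalM.
  + by rewrite mul0r.
  + by rewrite mul1r.
  by move=> u Iu; apply: Dl; exact: intervalM.
- move=> g h k y z Iy Iz; have [Fc [Fa Fb0 Fb1 Fc0 Fc1] Fbd] := F3P (g, h, k).
  (* The path to the corner of this face follows the wrapped edge y = z = 0, on which [F3] traces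
     [ga g]; hence the translation by [g]. *)
  apply: (@lab_face _ _ (@cube3 R) I2 _ _ (fun u => wrap 1 u.1 u.2) (fun u => wrap u 0 0) _ (y, z)) => //.
  + by apply: Fbd => //; left; constructor 1.
  + by rewrite /wrap; within_tac.
  + by move=> u [? ?]; exact: wrap_cube.
  + by rewrite /wrap; within_tac.
  + by move=> u Iu; exact: wrap_cube.
  + by rewrite wrap0E.
  + rewrite -[RHS]ga_phi; apply/esym/(phi_ext phi_eq (gaP _)) => u Iu.
    by rewrite Fc0.
  + by rewrite Fa // Db.
  by move=> [u v] [/= Iu Iv]; rewrite Fa.
- move=> g h k u v Iu Iv; have [Fc [Fa Fb0 Fb1 Fc0 Fc1] Fbd] := F3P (g, h, k).
  rewrite -[lab _ _ (u, v)]translate1.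
  apply: (@lab_face _ _ (@cube3 R) I2 _ _ (fun w => wrap w.1 w.2 0) (fun _ => 0) _ (u, v)) => //.
  + by apply: Fbd => //; left; constructor 1.
  + by rewrite /wrap; within_tac.
  + by move=> w [? ?]; exact: wrap_cube.
  + by within_tac.
  + by rewrite wrap0E.
  + by rewrite -phi1; congr phi; apply/funext => ?; apply: Fbd => //; left; constructor 1.
  + by rewrite Fb0 // Dl.
  by move=> [w w'] [/= ? ?]; rewrite Fb0.
- move=> g h k u v Iu Iv; have [Fc [Fa Fb0 Fb1 Fc0 Fc1] Fbd] := F3P (g, h, k).
  rewrite -[lab _ _ (u, v)]translate1.
  apply: (@lab_face _ _ (@cube3 R) I2 _ _ (fun w => wrap w.1 w.2 1) (fun w => (0, w, 0)) _ (u, v)) => //.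
  + by apply: Fbd => //; left; constructor 1.
  + by rewrite /wrap; within_tac.
  + by move=> w [? ?]; exact: wrap_cube.
  + by within_tac.
  + by rewrite wrap0E.
  + rewrite -phi1; apply/esym/(phi_ext phi_eq cP) => w Iw.
    by rewrite Fbd //; left; constructor 1.
  + by rewrite Fb1 // Dl.
  by move=> [w w'] [/= ? ?]; rewrite Fb1.
- move=> g h k u v Iu Iv; have [Fc [Fa Fb0 Fb1 Fc0 Fc1] Fbd] := F3P (g, h, k).
  rewrite -[lab R _ u]translate1.
  apply: (@lab_face _ _ (@cube3 R) I _ _ (fun w => wrap w 0 v) (fun w => (0, w * v, 0)) _ u) => //.
  + by apply: Fbd => //; left; constructor 1.
  + by rewrite /wrap; within_tac.
  + by move=> w ?; exact: wrap_cube.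
  + by within_tac.
  + by move=> w Iw; split => //; split => //; exact: intervalM.
  + by rewrite mul0r.
  + by rewrite mul1r wrap0E.
  + rewrite -phi1; apply/esym/(phi_ext phi_eq cP) => w Iw.
    by rewrite Fbd //; [exact: intervalM | left; constructor 1].
  + by rewrite Fc0.
  by move=> w Iw; rewrite Fc0.
- move=> g h k u v Iu Iv; have [Fc [Fa Fb0 Fb1 Fc0 Fc1] Fbd] := F3P (g, h, k).
  rewrite -[lab _ _ (u, v)]translate1.
  apply: (@lab_face _ _ (@cube3 R) I2 _ _ (fun w => wrap w.1 1 w.2) (fun w => (w, 0, 0)) _ (u, v)) => //.
  + by apply: Fbd => //; left; constructor 1.
  + by rewrite /wrap; within_tac.
  + by move=> w [? ?]; exact: wrap_cube.
  + by within_tac.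
  + by rewrite wrap0E.
  + rewrite -phi1; apply/esym/(phi_ext phi_eq cP) => w Iw.
    by rewrite Fbd //; left; constructor 3.
  + by rewrite Fc1 // Dl.
  by move=> [w w'] [/= ? ?]; rewrite Fc1.
move=> g h k y z t Iy Iz It bd; have [Fc _ Fbd] := F3P (g, h, k).
have F0 : F3 (g, h, k) (0, 0, 0) = x by apply: Fbd => //; left; constructor 1.
have {}bd : boundary_point y z \/ t = 1.
  by move: bd => [|[|[|[|]]]] ->; [left; constructor 1|left; constructor 2|
    left; constructor 3|left; constructor 4|right].
(* [F3] need not be constant on the straight segment from the origin. The detour up the edge y = z =
   0, across the top and down to the point stays where it equals [x]. *)
pose up (s : R) : R * R * R := (0, 0, s).
pose across (s : R) : R * R * R := (s * y, s * z, 1).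
pose down (s : R) : R * R * R := (y, z, 1 - s * (1 - t)).
have upP : is_path (up 0) (up 1) up by apply/is_pathP; split => //; rewrite /up; within_tac.
have acP : is_path (up 1) (across 1) across.
  by apply/is_pathP; rewrite /across !mul0r; split => //; within_tac.
have doP : is_path (across 1) (y, z, t) down.
  apply/is_pathP; rewrite /down /across mul0r !mul1r subr0 subKr; split => //.
  by within_tac.
have /is_pathP[bc b0 b1] := is_path_concat upP (is_path_concat acP doP).
have prop (Q : R * R * R -> Prop) : (forall s, I s -> Q (up s)) -> (forall s, I s -> Q (across s)) ->
    (forall s, I s -> Q (down s)) -> forall s, I s -> Q (path_concat up (path_concat across down) s).
  move=> Q1 Q2 Q3 s Is; rewrite /path_concat; case: leP => sh; first by apply: Q1; exact: half_itv.
  have Is' := half_itv' Is (ltW sh); case: leP => sh'; first by apply: Q2; exact: half_itv.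
  by apply: Q3; apply: half_itv' => //; exact: ltW.
have Idown s : I s -> I (1 - s * (1 - t)).
  by move=> Is; apply: intervalC; apply: intervalM => //; exact: intervalC.
apply: (label_const phi_eq phiM flat cc Fc F0 bc _ b0 b1).
  apply: prop => s Is; rewrite /up /across /down; split => //=.
    by split; exact: intervalM.
  exact: Idown.
apply: (prop (fun p => F3 (g, h, k) p = x)) => s Is; rewrite /up /across /down.
- by apply: Fbd => //; left; constructor 1.
- by apply: Fbd; [exact: intervalM|exact: intervalM| |right].
apply: Fbd => //; first exact: Idown.
by case: bd => [bd|->]; [left|right; rewrite subrr mulr0 subr0].
Qed.

End Assembly.

(** * Pushing a CW complex off the centers of its cells *)

Section EuclideanNorm.
Context {R : realType} {n : nat}.
Implicit Types x y : 'rV[R]_n.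

Definition eucl x : R := Num.sqrt (\sum_(i < n) x 0 i ^+ 2).

Lemma sumsq_ge0 x : 0 <= \sum_(i < n) x 0 i ^+ 2.
Proof. by apply: sumr_ge0 => i _; exact: sqr_ge0. Qed.

Lemma eucl_ge0 x : 0 <= eucl x. Proof. exact: sqrtr_ge0. Qed.

Lemma diskE x : disk x <-> eucl x <= 1.
Proof. by rewrite /disk /eucl /= -{2}sqrtr1 ler_sqrt. Qed.

Lemma open_diskE x : open_disk x <-> eucl x < 1.
Proof. by rewrite /open_disk /eucl /= -{2}sqrtr1 ltr_sqrt. Qed.

Lemma sphereE x : sphere x <-> eucl x = 1.
Proof.
rewrite /sphere /eucl /=; split => [->|]; first by rewrite sqrtr1.
by move=> /(congr1 (fun r => r ^+ 2)); rewrite sqr_sqrtr ?sumsq_ge0 // expr1n.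
Qed.

Lemma euclZ a x : eucl (a *: x) = `|a| * eucl x.
Proof.
rewrite /eucl -sqrtr_sqr -sqrtrM ?sqr_ge0 //; congr Num.sqrt.
by rewrite mulr_sumr; apply: eq_bigr => i _; rewrite mxE exprMn.
Qed.

Lemma eucl0 : eucl 0 = 0.
Proof. by rewrite -[0](scale0r 0) euclZ normr0 mul0r. Qed.

Lemma eucl_eq0 x : eucl x = 0 -> x = 0.
Proof.
move=> /eqP; rewrite sqrtr_eq0 => x0.
have /eqP : \sum_(i < n) x 0 i ^+ 2 = 0 by apply/eqP; rewrite eq_le x0 sumsq_ge0.
rewrite psumr_eq0 => [/allP x0'|i _]; last exact: sqr_ge0.
apply/rowP => i; rewrite mxE; apply/eqP; rewrite -sqrf_eq0.
exact: (x0' i (mem_index_enum _)).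
Qed.

Lemma eucl_gt0 x : x != 0 -> 0 < eucl x.
Proof.
by move=> x0; rewrite lt_def eucl_ge0 andbT; apply: contra x0 => /eqP/eucl_eq0/eqP.
Qed.

Lemma eucl_coord x i : `|x 0 i| <= eucl x.
Proof.
rewrite -sqrtr_sqr ler_sqrt ?sumsq_ge0 // (bigD1 i) //= lerDl.
by apply: sumr_ge0 => j _; exact: sqr_ge0.
Qed.

Lemma eucl_continuous : continuous eucl.
Proof.
move=> x; apply: (@continuous_comp _ _ _ (fun x => \sum_(i < n) x 0 i ^+ 2) Num.sqrt).
  have sum_continuous : continuous (fun y : 'rV[R]_n => \sum_(i < n) y 0 i ^+ 2).
    apply: continuous_big => [|i _ y]; first exact: add_continuous.
    apply: (@continuous_comp _ _ _ (fun y : 'rV[R]_n => y 0 i) (fun r => r ^+ 2)).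
      exact: coord_continuous.
    exact: exprn_continuous.
  exact: sum_continuous.
exact: sqrt_continuous.
Qed.

Lemma closed_eucl_le c : closed [set x | eucl x <= c].
Proof. by apply: closed_lel => x; exact: eucl_continuous. Qed.

Lemma closed_eucl_ge c : closed [set x | c <= eucl x].
Proof. by apply: closed_ger => x; exact: eucl_continuous. Qed.

Lemma disk_closed : closed (@disk R n).
Proof.
rewrite (_ : disk (n:=n) = [set x | eucl x <= 1]); first exact: closed_eucl_le.
by apply/seteqP; split => x /diskE.
Qed.

Lemma disk0 : disk (0 : 'rV[R]_n). Proof. by apply/diskE; rewrite eucl0. Qed.

Lemma disk_compact : compact (@disk R n).
Proof.
apply: bounded_closed_compact disk_closed.
apply/ex_bound; first exact: globally_properfilter disk0.
exists 1 => x /diskE x1; rewrite /= [leLHS]/Num.Def.normr /= mx_normrE.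
apply/bigmax_leP; split => // -[i j] _ /=; rewrite ord1.
exact: le_trans (eucl_coord x j) x1.
Qed.

Definition radial x : 'rV[R]_n := (eucl x)^-1 *: x.

Lemma eucl_radial x : x != 0 -> eucl (radial x) = 1.
Proof.
move=> /eucl_gt0 x0; rewrite euclZ ger0_norm ?invr_ge0 ?eucl_ge0 //.
by rewrite mulVf // lt0r_neq0.
Qed.

Lemma radial_within : {within [set x | x != 0], continuous radial}.
Proof.
apply: withinZ; last exact: within_id.
apply/subspace_continuousP => x /eucl_gt0 x0; apply: cvgV; first exact: lt0r_neq0.
by apply: cvg_within_filter; exact: eucl_continuous.
Qed.

Definition push x (u : R) : 'rV[R]_n := (1 - u) *: x + u *: radial x.

Lemma pushE x u : push x u = (1 - u + u / eucl x) *: x.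
Proof. by rewrite /push /radial scalerA -scalerDl. Qed.

Lemma eucl_push x u : x != 0 -> @interval R u -> eucl (push x u) = (1 - u) * eucl x + u.
Proof.
move=> x0 /andP[u0 u1]; have ex := eucl_gt0 x0; rewrite pushE euclZ ger0_norm.
  by rewrite mulrDl mulfVK ?lt0r_neq0.
by rewrite addr_ge0 ?subr_ge0 // divr_ge0 // ltW.
Qed.

Lemma push0 x : push x 0 = x.
Proof. by rewrite /push subr0 scale1r scale0r addr0. Qed.

Lemma push1 x : push x 1 = radial x.
Proof. by rewrite /push subrr scale0r add0r scale1r. Qed.

Lemma push_id x u : eucl x = 1 -> push x u = x.
Proof. by move=> x1; rewrite pushE x1 divr1 subrK scale1r. Qed.

Lemma push_disk x u : x != 0 -> disk x -> @interval R u -> disk (push x u).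
Proof.
move=> x0 /diskE x1 Iu; apply/diskE; rewrite eucl_push //.
by move: Iu => /andP[? ?]; have := eucl_ge0 x; nra.
Qed.

Lemma push_within : {within [set p : 'rV[R]_n * R | p.1 != 0], continuous (fun p => push p.1 p.2)}.
Proof.
have r1 : {within [set p : 'rV[R]_n * R | p.1 != 0], continuous (fun p => radial p.1)}.
  by apply: (within_comp (@within_fst _ _ _) radial_within).
by rewrite /push; within_tac.
Qed.

End EuclideanNorm.

Lemma closed_within_preimage {T U : topologicalType} (A : set T) (f : T -> U) (C : set U) :
  closed A -> {within A, continuous f} -> closed C -> closed (A `&` f @^-1` C).
Proof.
move=> cA /continuous_closedP/(_ _) fc cC.
have /closed_subspaceP[C' cC' C'E] := fc _ cC.
by rewrite setIC -C'E; exact: closedI.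
Qed.

Section Skeleta.
Context {R : realType} {X : topologicalType} (K : cw_structure R X).

Lemma cell_exists z : exists n (e : cell K n) x, open_disk x /\ char_map e x = z.
Proof.
have [[n e] [[x xd xz] _]] := cw_partition K z.
by exists n, e, x.
Qed.

Lemma cell_inj n m (e : cell K n) (e' : cell K m) x x' : open_disk x -> open_disk x' ->
  char_map e x = char_map e' x' -> existT (cell K) n e = existT (cell K) m e'.
Proof.
move=> xd xd' exx'; have [c [_ cu]] := cw_partition K (char_map e x).
rewrite -(cu (existT _ n e)); last by exists x.
by apply: cu; exists x'.
Qed.

Lemma cell_inj_dim n m (e : cell K n) (e' : cell K m) x x' : open_disk x -> open_disk x' ->
  char_map e x = char_map e' x' -> n = m.
Proof. by move=> xd xd' exx'; have /(congr1 (@projT1 _ _)) := cell_inj xd xd' exx'. Qed.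

Lemma cell_inj_pos n (e e' : cell K n) x x' : open_disk x -> open_disk x' ->
  char_map e x = char_map e' x' -> e = e' /\ x = x'.
Proof.
move=> xd xd' exx'; have ee' : e = e'.
  by apply: (Eqdep_dec.inj_pair2_eq_dec _ PeanoNat.Nat.eq_dec (cell K)); exact: cell_inj exx'.
by split => //; subst e'; apply: char_map_inj exx'; exact/mem_set.
Qed.

Definition skel k : set X :=
  [set z | exists n (e : cell K n) x, [/\ (n <= k)%N, open_disk x & char_map e x = z]].

Lemma skel_inv k n (e : cell K n) x : open_disk x -> skel k (char_map e x) -> (n <= k)%N.
Proof. by move=> xd [m [e' [x' [mk x'd xx']]]]; rewrite -(cell_inj_dim x'd xd xx'). Qed.

Lemma skelW k l : (k <= l)%N -> skel k `<=` skel l.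
Proof. by move=> kl z [n [e [x [nk]]]]; exists n, e, x; split => //; exact: leq_trans kl. Qed.

Lemma skel_sphere n (e : cell K n.+1) x : sphere x -> skel n (char_map e x).
Proof.
move=> xs; have [S [_ Sn]] := cw_closure_finite e.
move=> /(_ (char_map e x) (imageP _ xs))[[m e'] /Sn /= mn [x' x'd x'E]].
by exists m, e', x'.
Qed.

Lemma disk_sphereVopen n (x : 'rV[R]_n) : disk x -> sphere x \/ open_disk x.
Proof.
move=> /diskE; rewrite le_eqVlt => /orP[/eqP|]; first by move=> /sphereE; left.
by move=> /open_diskE; right.
Qed.

Lemma open_disk_disk n (x : 'rV[R]_n) : open_disk x -> disk x.
Proof. by move=> /open_diskE x1; apply/diskE; exact: ltW. Qed.

Lemma sphere_gt0 n (x : 'rV[R]_n) : sphere x -> (0 < n)%N.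
Proof.
case: n x => // x /sphereE; rewrite (_ : x = 0) ?eucl0; last by apply/rowP => -[].
by move=> /esym/eqP; rewrite oner_eq0.
Qed.

Lemma skel_disk n (e : cell K n) x : disk x -> skel n (char_map e x).
Proof.
move=> /disk_sphereVopen[xs|xd]; last by exists n, e, x.
by case: n e x xs (sphere_gt0 xs) => // n e x xs _; apply: skelW (skel_sphere e xs).
Qed.

Lemma skel_dim k z : cw_dim_le K k -> skel k z.
Proof.
move=> Kk; have [n [e [x [xd xz]]]] := cell_exists z; exists n, e, x; split => //.
by rewrite leqNgt; apply/negP => /Kk/(_ e).
Qed.

(** Closedness is tested on all cells. A cell of dimension above [k] meets [C] only along its
    boundary sphere, which lies in finitely many lower open cells; there [C] is replaced by a finite
    union of images of compact sets. *)
Lemma closed_in_skel k (C : set X) : C `<=` skel k ->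
  (forall n (e : cell K n), (n <= k)%N -> closed (@disk R n `&` char_map e @^-1` C)) ->
  closed C.
Proof.
move=> Ck cC; apply: (@cw_weak_topology _ _ K) => n e.
have [nk|kn] := leqP n k; first exact: cC.
have [S [finS _ Se]] := cw_closure_finite e.
pose piece (c : {m & cell K m}) : set X :=
  char_map (projT2 c) @` (@disk R _ `&` char_map (projT2 c) @^-1` C).
pose D := \bigcup_(c in S `&` [set c | (projT1 c <= k)%N]) piece c.
have cD : closed D.
  apply: (@closed_bigcup X {classic {m & cell K m}}); first by apply: sub_finite_set finS => c [].

  move=> [m c] [_ /= mk]; apply: compact_closed; first exact: cw_hausdorff K.
  apply: continuous_compact.
    by apply: continuous_subspaceW (@char_map_continuous _ _ _ _ c) => v [].
  by apply: (subclosed_compact (cC _ _ mk) disk_compact) => v [].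
rewrite (_ : _ `&` _ = @disk R n `&` char_map e @^-1` D).
  by apply: closed_within_preimage => //; [exact: disk_closed|exact: char_map_continuous].
apply/seteqP; split => x [xd /= xC]; split => //=; last by have [c _ [y [_ yC] <-]] := xC.
have [xs|xo] := disk_sphereVopen xd; last first.
  by have := skel_inv xo (Ck _ xC); rewrite leqNgt kn.
have [[m c] Sc [y yo yx]] := Se _ (imageP _ xs).
exists (existT _ m c); last by exists y => //=; split; [exact: open_disk_disk|rewrite /= yx].
by split=> //=; apply: (@skel_inv k m c y) => //=; rewrite yx; exact: Ck.
Qed.

End Skeleta.

Lemma closed_near {T : topologicalType} (C : set T) :
  (forall x, ~ C x -> \forall y \near x, ~ C y) -> closed C.
Proof. by move=> H x cx; apply: contrapT => /H nx; have [y [Cy]] := cx _ nx; apply. Qed.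

Section SkeletonContinuity.
Context {R : realType} {X T : topologicalType} (K : cw_structure R X).

(* The tube lemma replaces the product of the weak topology with an interval. *)
Lemma skel_within k (O : set X) (Q : X -> R -> T) :
  (forall n (e : cell K n), (n <= k)%N ->
     closed (@disk R n `&` [set x | ~ O (char_map e x)])) ->
  (forall n (e : cell K n), (n <= k)%N ->
     {within [set p : 'rV[R]_n * R | [/\ disk p.1, O (char_map e p.1) & interval p.2]],
       continuous (fun p => Q (char_map e p.1) p.2)}) ->
  {within [set p | [/\ skel K k p.1, O p.1 & interval p.2]], continuous (fun p => Q p.1 p.2)}.
Proof.
move=> cO Qc; apply/withinP => -[z u] /= [zk Oz Iu] W0 /nbhs_interior WQ.
pose W := W0^°%classic.
have [n [e [x [nk xo xz]]]] := zk.
have [d d0 dW] : exists2 d : R, 0 < d & forall v, `|v - u| <= d -> interval v -> W (Q z v).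
  have := (iffLR (withinP _ _)) (Qc n e nk) (x, u).
  rewrite /= xz => /(_ (And3 (open_disk_disk xo) Oz Iu) _ WQ).
  move=> /(nbhs_ballP (x, u))[d /= d0 dW].
  exists (d / 2) => [|v vu Iv]; first exact: divr_gt0.
  rewrite -xz; apply: (dW (x, v)); last by split => //=; [exact: open_disk_disk|rewrite xz].
  split; first exact: ballxx.
  by apply: (@le_lt_trans _ _ (d / 2)); [rewrite distrC|lra].
pose J := @interval R `&` [set v | `|v - u| <= d].
have cJ : compact J.
  apply: (subclosed_compact _ compact_interval); last by move=> v [].
  apply: closedI; first exact: closed_interval.
  by apply: closed_lel => v; apply: cvg_norm; apply: cvgB; [exact: cvg_id|exact: cvg_cst].
(* The points where the tube over the compact interval [J] leaves [O] or [W]. Its closedness is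
   checked on cells, where joint continuity and compactness of [J] give a uniform neighborhood. *)
pose B := [set y | skel K k y /\ ~ (O y /\ forall v, J v -> W (Q y v))].
have cB : closed B.
  refine (@closed_in_skel _ _ K k _ _ _) => [y []//|m f mk]; refine (closed_near _) => y nB.
  have [yd|nyd] := pselect (disk y); last first.
    have : \forall w \near y, ~ disk w by apply: open_nbhs_nbhs; split; [exact/closed_openC/disk_closed|].
    by apply: filterS => w nw [].
  have yk : skel K k (char_map f y) by apply: skelW (skel_disk f yd).
  have [Oy Wy] : O (char_map f y) /\ forall v, J v -> W (Q (char_map f y) v).
    by apply: contrapT => H; apply: nB.
  have nO : \forall w \near y, disk w -> O (char_map f w).
    have : \forall w \near y, ~ (@disk R m `&` [set x | ~ O (char_map f x)]) w.
      by apply: open_nbhs_nbhs; split; [exact/closed_openC/cO|case].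
    by apply: filterS => w nw wd; apply: contrapT => nOw; exact: nw.
  have nW : \forall w \near y, J `<=` (fun v => disk w -> O (char_map f w) -> interval v -> W (Q (char_map f w) v)).
    have /compact_near_coveringP cJ' := cJ.
    apply: (cJ' _ (nbhs y) (fun w v => disk w -> O (char_map f w) -> interval v -> W (Q (char_map f w) v))) => v Jv.
    have Iv : interval v by case: Jv.
    have := (iffLR (withinP _ _)) (Qc m f mk) (y, v) (And3 yd Oy Iv) W.
    have nbW : nbhs (Q (char_map f y) v) W.
      by apply: open_nbhs_nbhs; split; [exact: open_interior|exact: Wy].
    move=> /(_ nbW) [[A1 A2] /= [yA1 vA2] AW].
    by exists (A2, A1) => // -[v' w] [/= v'A wA] wd Ow Iv'; apply: (AW (w, v')).
  move: nO nW; apply: filterS2 => w Ow Ww [/= wd [_]]; apply.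
  by split=> [|v Jv]; [exact: Ow|apply: Ww => //; [exact: Ow|case: Jv]].
have nB : \forall y \near z, ~ B y.
  by apply: open_nbhs_nbhs; split; [exact: closed_openC|move=> [_]; apply; split=> // v [? ?]; exact: dW].
exists (~` B, [set v | `|v - u| <= d]) => /=.
  by split=> //; apply/nbhs_ballP; exists d => //= v /ltW; rewrite /= distrC.
move=> [y v] [/= nBy vd] [yk Oy Iv]; apply: interior_subset.
by have /not_andP[//|/contrapT[_]] := nBy; apply; split.
Qed.

End SkeletonContinuity.

Section RadialMaps.
Context {R : realType} {X : topologicalType} (K : cw_structure R X).

(** The chosen cell and coordinates are unique by [cell_inj_pos], so the choice does not affect the
    value. *)
Definition on_cell n (A : Type) (g : cell K n -> 'rV[R]_n -> A) (d : A) (z : X) : A :=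
  if pselect (exists p : cell K n * 'rV[R]_n, open_disk p.2 /\ char_map p.1 p.2 = z)
  is left h then g (projT1 (cid h)).1 (projT1 (cid h)).2 else d.

Lemma on_cellE n A (g : cell K n -> 'rV[R]_n -> A) d e x :
  open_disk x -> on_cell g d (char_map e x) = g e x.
Proof.
move=> xo; rewrite /on_cell; case: pselect => [h|[]]; last by exists (e, x).
by case: (cid h) => -[e' x'] /= [xo' /(cell_inj_pos xo' xo)[-> ->]].
Qed.

Lemma on_cell_low n A (g : cell K n -> 'rV[R]_n -> A) d k z :
  (k < n)%N -> skel K k z -> on_cell g d z = d.
Proof.
move=> kn zk; rewrite /on_cell; case: pselect => // h; exfalso.
by case: h zk => -[e x] /= [xo <-] /(skel_inv xo); rewrite leqNgt kn.
Qed.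

(** The default 1 is also the limit at the boundary of an [n]-cell; this makes the function
    continuous on the whole [n]-skeleton. *)
Definition radius n : X -> R := on_cell (fun (e : cell K n) x => eucl x) 1.

Definition rad n (z : X) (u : R) : X := on_cell (fun (e : cell K n) x => char_map e (push x u)) z z.

(** Contraction of a cell to its center. In contrast to [rad], it does not match its default at the
    boundary, so continuity is claimed only where the radius is below 1. *)
Definition con n (z : X) (u : R) : X := on_cell (fun (e : cell K n) x => char_map e ((1 - u) *: x)) z z.

Lemma radiusE n (e : cell K n) x : disk x -> radius n (char_map e x) = eucl x.
Proof.
move=> /disk_sphereVopen[xs|xo]; last by rewrite /radius on_cellE.
case: n e x xs (sphere_gt0 xs) => // n e x xs _.
by rewrite /radius (on_cell_low _ _ (ltnSn n)) ?(iffLR (sphereE x)) //; exact: skel_sphere.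
Qed.

Lemma radius_low n k z : (k < n)%N -> skel K k z -> radius n z = 1.
Proof. exact: on_cell_low. Qed.

Lemma radE n (e : cell K n) x u : disk x -> rad n (char_map e x) u = char_map e (push x u).
Proof.
move=> /disk_sphereVopen[xs|xo]; last by rewrite /rad on_cellE.
have x1 := iffLR (sphereE x) xs; rewrite push_id //.
case: n e x xs (sphere_gt0 xs) x1 => // n e x xs _ _.
by rewrite /rad (on_cell_low _ _ (ltnSn n)) //; exact: skel_sphere.
Qed.

Lemma rad_low n k z u : (k < n)%N -> skel K k z -> rad n z u = z.
Proof. exact: on_cell_low. Qed.

Lemma conE n (e : cell K n) x u : open_disk x -> con n (char_map e x) u = char_map e ((1 - u) *: x).
Proof. by move=> xo; rewrite /con on_cellE. Qed.

Lemma skelP n z : skel K n z ->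
  (exists (e : cell K n) x, open_disk x /\ z = char_map e x) \/ (exists2 k, (k < n)%N & skel K k z).
Proof.
move=> [m [e [x [mn xo xz]]]]; move: mn; rewrite leq_eqVlt => /orP[/eqP mn|mn].
  by subst m; left; exists e, x.
by right; exists m => //; exists m, e, x.
Qed.

Lemma rad0 n z : skel K n z -> rad n z 0 = z.
Proof.
move=> /skelP[[e [x [xo ->]]]|[k kn /(rad_low _ kn)->//]].
by rewrite radE ?push0 //; exact: open_disk_disk.
Qed.

Lemma con0 n z : skel K n z -> con n z 0 = z.
Proof.
move=> /skelP[[e [x [xo ->]]]|[k kn zk]]; last by rewrite /con (on_cell_low _ _ kn).
by rewrite conE // subr0 scale1r.
Qed.

Lemma rad1_skel n z : skel K n.+1 z -> 0 < radius n.+1 z -> skel K n (rad n.+1 z 1).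
Proof.
move=> /skelP[[e [x [xo ->]]]|[k kn zk]] => [|_]; last by rewrite (rad_low _ kn) //; apply: skelW zk.
have xd := open_disk_disk xo; rewrite radiusE // => x0.
rewrite radE // push1; apply: skel_sphere; apply/sphereE; apply: eucl_radial.
by apply: contraTneq x0 => ->; rewrite eucl0 ltxx.
Qed.

Lemma radius_within n : {within skel K n, continuous (radius n)}.
Proof.
suff H : {within [set p : X * R | [/\ skel K n p.1, True & interval p.2]], continuous (fun p => radius n p.1)}.
  apply: (@within_comp _ _ _ (skel K n) _ (fun z => (z, 0 : R)) _ _ H); first by within_tac.
  by move=> z zn; split=> //; exact: interval0.
apply: (@skel_within _ _ _ K n (fun _ => True) (fun z _ => radius n z)) => m e mn.
  by rewrite (_ : [set x | _] = set0) ?setI0; [exact: closed0|apply/seteqP; split=> // x []].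
have [mn'|mn'|mn'] := ltngtP m n; last 1 first.
- subst m; apply: (@within_ext _ _ _ (fun p => eucl p.1)) => [[x u] /= [xd _ _]|].
    by rewrite radiusE.
  apply: (@within_comp _ _ _ _ setT fst eucl (@within_fst _ _ _)) => //.
  by apply: continuous_subspaceT; exact: eucl_continuous.
- apply: (@within_ext _ R _ (fun _ : 'rV[R]_m * R => 1)) => [[x u] /= [xd _ _]|]; last exact: within_cst.
  by rewrite (radius_low mn') //; exact: skel_disk.
- by move: mn; rewrite leqNgt mn'.
Qed.

Lemma radius_near_gt n c z : skel K n z -> c < radius n z ->
  \forall y \near z, skel K n y -> c < radius n y.
Proof.
move=> zn cz; apply: (iffLR (withinP _ _) (@radius_within n) z zn [set r | c < r]).
exact: lt_nbhsr.
Qed.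

Lemma radius_near_lt n c z : skel K n z -> radius n z < c ->
  \forall y \near z, skel K n y -> radius n y < c.
Proof.
move=> zn cz; apply: (iffLR (withinP _ _) (@radius_within n) z zn [set r | r < c]).
exact: lt_nbhsl.
Qed.

Lemma closed_radius_pos n m (e : cell K m) : (m <= n)%N ->
  closed (@disk R m `&` [set x | ~ 0 < radius n (char_map e x)]).
Proof.
rewrite leq_eqVlt => /orP[/eqP mn|mn].
  subst m; rewrite (_ : _ `&` _ = @disk R n `&` [set x | eucl x <= 0]).
    by apply: closedI; [exact: disk_closed|exact: closed_eucl_le].
  apply/seteqP; split=> x [xd /= x0]; split=> //=.
    by move: x0; rewrite radiusE // => /negP; rewrite -leNgt.
  by rewrite radiusE //; apply/negP; rewrite -leNgt.
rewrite (_ : _ `&` _ = set0); first exact: closed0.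
apply/seteqP; split=> // x [xd /=]; apply.
by rewrite (radius_low mn) //; exact: skel_disk.
Qed.

Lemma closed_radius_lt1 n m (e : cell K m) : (m <= n)%N ->
  closed (@disk R m `&` [set x | ~ radius n (char_map e x) < 1]).
Proof.
rewrite leq_eqVlt => /orP[/eqP mn|mn].
  subst m; rewrite (_ : _ `&` _ = @disk R n `&` [set x | 1 <= eucl x]).
    by apply: closedI; [exact: disk_closed|exact: closed_eucl_ge].
  apply/seteqP; split=> x [xd /= x0]; split=> //=.
    by move: x0; rewrite radiusE // => /negP; rewrite -leNgt.
  by rewrite radiusE //; apply/negP; rewrite -leNgt.
rewrite (_ : _ `&` _ = @disk R m); first exact: disk_closed.
apply/seteqP; split=> x //= => [[]//|xd]; split=> //.
by rewrite (radius_low mn) ?ltxx //; exact: skel_disk.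
Qed.

Lemma rad_within n :
  {within [set p : X * R | [/\ skel K n p.1, 0 < radius n p.1 & interval p.2]],
    continuous (fun p => rad n p.1 p.2)}.
Proof.
apply: (@skel_within _ _ _ K n (fun z => 0 < radius n z)) => m e; first exact: closed_radius_pos.
rewrite leq_eqVlt => /orP[/eqP mn|mn].
  subst m; apply: (@within_ext _ _ _ (fun p => char_map e (push p.1 p.2))) => [[x u] /= [xd _ _]|].
    by rewrite radE.
  have nz (p : 'rV[R]_n * R) : [/\ disk p.1, 0 < radius n (char_map e p.1) & interval p.2] -> p.1 != 0.
    by move=> [xd]; rewrite radiusE // => + _; apply: contraTneq => ->; rewrite eucl0 ltxx.
  apply: (@within_comp _ _ _ _ _ (fun p => push p.1 p.2) _ _ (@char_map_continuous _ _ _ _ e)).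
    by apply: continuous_subspaceW push_within => p; exact: nz.
  by move=> p pn; have := nz p pn; move: pn => [? ? ?] ?; exact: push_disk.
apply: (@within_ext _ _ _ (fun p => char_map e p.1)) => [[x u] /= [xd _ _]|].
  by rewrite (rad_low _ mn) //; exact: skel_disk.
by apply: (@within_comp _ _ _ _ _ _ _ (@within_fst _ _ _) (@char_map_continuous _ _ _ _ e)) => p [].
Qed.

Lemma con_within n :
  {within [set p : X * R | [/\ skel K n p.1, radius n p.1 < 1 & interval p.2]],
    continuous (fun p => con n p.1 p.2)}.
Proof.
apply: (@skel_within _ _ _ K n (fun z => radius n z < 1)) => m e; first exact: closed_radius_lt1.
rewrite leq_eqVlt => /orP[/eqP mn|mn].
  subst m; apply: (@within_ext _ _ _ (fun p : 'rV[R]_n * R => char_map e ((1 - p.2) *: p.1))) => [[x u] /= [xd + _]|].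
    by rewrite radiusE // => /open_diskE xo; rewrite conE.
  apply: (@within_comp _ _ _ _ _ (fun p : 'rV[R]_n * R => (1 - p.2) *: p.1) _ _ (@char_map_continuous _ _ _ _ e)).
    by within_tac.
  move=> [x u] /= [/diskE xd _ /andP[u0 u1]]; apply/diskE; rewrite euclZ ger0_norm ?subr_ge0 //.
  by have := eucl_ge0 x; nra.
apply/withinP => -[x u] /= [xd + _].
by rewrite (radius_low mn) ?ltxx //; exact: skel_disk.
Qed.

(** An open cell of top dimension is open in the skeleton. In any closed disk of dimension at most
    [n], a point sent into the open cell cannot be on the sphere and belongs to the same cell, so
    nearby points of the disk are sent there too. *)
Lemma open_cell_near n (e : cell K n) x : open_disk x ->
  \forall z \near char_map e x, skel K n z -> exists2 x', open_disk x' & z = char_map e x'.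
Proof.
move=> xo; pose B := [set z | skel K n z /\ ~ exists2 x', open_disk x' & z = char_map e x'].
have cB : closed B.
  refine (@closed_in_skel _ _ K n _ _ _) => [y []//|m f mn]; refine (closed_near _) => y nB.
  have [yd|nyd] := pselect (disk y); last first.
    have : \forall w \near y, ~ disk w by apply: open_nbhs_nbhs; split; [exact/closed_openC/disk_closed|].
    by apply: filterS => w nw [].
  have [x' xo' fy] : exists2 x', open_disk x' & char_map f y = char_map e x'.
    by apply: contrapT => H; apply: nB; split => //; split=> //; apply: skelW (skel_disk f yd).
  have [ys|yo] := disk_sphereVopen yd.
    case: m f mn y ys {nB yd} fy (sphere_gt0 ys) => // m f mn y ys fy _.
    by have := skel_sphere f ys; rewrite fy => /(skel_inv xo'); rewrite leqNgt mn.
  have nm := cell_inj_dim yo xo' fy; subst m.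
  have [ef _] := cell_inj_pos yo xo' fy; subst f.
  have : \forall w \near y, ~ [set x | 1 <= eucl x] w.
    apply: open_nbhs_nbhs; split; first exact/closed_openC/closed_eucl_ge.
    by move: yo => /open_diskE; rewrite ltNge => /negP.
  apply: filterS => w /negP; rewrite -ltNge => /open_diskE wo [_ [_]]; apply.
  by exists w.
have : \forall z \near char_map e x, ~ B z.
  by apply: open_nbhs_nbhs; split; [exact: closed_openC|move=> [_]; apply; exists x].
by apply: filterS => z nB zn; apply: contrapT => H; exact: nB.
Qed.

End RadialMaps.

Section Transport.
Context {R : realType} {X : topologicalType}.
Variables (A : set (X * R)) (Q : X -> R -> X).
Hypothesis Qc : {within A, continuous (fun p => Q p.1 p.2)}.

Lemma is_path_track z : (forall u, interval u -> A (z, u)) -> Q z 0 = z -> is_path z (Q z 1) (Q z).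
Proof.
move=> Az Q0; apply/is_pathP; split=> //.
by apply: (@within_comp _ _ _ interval _ (fun u => (z, u)) _ _ Qc) => //; within_tac.
Qed.

(** The tracks of [Q] over [a] sweep out a square, which compares [a] with its image at time 1. A
    relation between paths after the deformation thus lifts to one before it. *)
Lemma path_transport x z z' (a q q' : R -> X) : is_path z z' a ->
  (forall s u, interval s -> interval u -> A (a s, u)) ->
  (forall s, interval s -> Q (a s) 0 = a s) ->
  is_path (Q z 1) x q -> is_path (Q z' 1) x q' ->
  path_homotopic (Q z 1) x (path_concat (fun s => Q (a s) 1) q') q ->
  path_homotopic z x (path_concat a (path_concat (Q z') q')) (path_concat (Q z) q).
Proof.
move=> az Aa Qa pq pq' bq.
have [ac a0 a1] := iffLR (is_pathP _ _ _) az.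
have Az u : interval u -> A (z, u) by move=> Iu; rewrite -a0; apply: Aa => //; exact: interval0.
have Az' u : interval u -> A (z', u) by move=> Iu; rewrite -a1; apply: Aa => //; exact: interval1.
have Qz : Q z 0 = z by rewrite -a0 Qa //; exact: interval0.
have Qz' : Q z' 0 = z' by rewrite -a1 Qa //; exact: interval1.
have pz := is_path_track Az Qz; have pz' := is_path_track Az' Qz'.
have Hc : {within square, continuous (fun p : R * R => Q (a p.1) p.2)}.
  apply: (@within_comp _ _ _ square _ (fun p => (a p.1, p.2)) _ _ Qc); last by move=> p [? ?]; exact: Aa.
  apply: within_pair; last exact: within_snd.
  by apply: (@within_comp _ _ _ _ _ fst a (@within_fst _ _ _) ac) => p [].
have := square_homotopic Hc; rewrite /= a0 a1 Qz => sq.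
have bz : is_path (Q z 1) (Q z' 1) (fun s => Q (a s) 1).
  apply/is_pathP; rewrite a0 a1; split=> //.
  apply: (@within_comp _ _ _ interval _ (fun s => (a s, 1 : R)) _ _ Qc).
    by apply: within_pair => //; exact: within_cst.
  by move=> s Is; apply: Aa => //; exact: interval1.
have sq' : path_homotopic z (Q z' 1) (path_concat a (Q z')) (path_concat (Q z) (fun s => Q (a s) 1)).
  apply: path_homotopic_trans sq; apply: path_homotopic_sym.
  apply: path_homotopic_refl.
    apply: (is_path_concat (is_path_ext az _)); last exact: pz'.
    by move=> s Is; rewrite Qa.
  move=> s /andP[s0 s1]; rewrite /path_concat; case: ifPn => // s2.
  by rewrite Qa //; apply/andP; split; lra.
apply: path_homotopic_trans (path_homotopic_sym (path_concat_assoc az pz' pq')) _.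
apply: path_homotopic_trans (path_homotopic_concat sq' (path_homotopic_refl pq' (fun _ _ => erefl))) _.
apply: path_homotopic_trans (path_concat_assoc pz bz pq') _.
exact: path_homotopic_concat (path_homotopic_refl pz (fun _ _ => erefl)) bq.
Qed.

End Transport.

(** * Descent through the skeleta *)

Section Descent.
Context {R : realType} {X : topologicalType} (K : cw_structure R X).
Variables (x : X) (om : X -> R -> X).
Hypothesis om_path : forall y, is_path y x (om y).

(** A point close to the center of its cell keeps the dimension of that cell; any other point is
    pushed to the next lower skeleton. The threshold 1/2 is inside the ranges of radii where [con]
    and [rad] are continuous, so either can be used slightly beyond it. *)
Fixpoint descent_type n (z : X) : nat :=
  if n is k.+1 then
    if radius K n z <= 2^-1 then n else descent_type k (rad K n z 1)
  else 0.

Fixpoint descent n (z : X) : R -> X :=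
  if n is k.+1 then
    if radius K n z <= 2^-1 then path_concat (con K n z) (om (con K n z 1))
    else path_concat (rad K n z) (descent k (rad K n z 1))
  else om z.

Lemma descent_type_le n z : (descent_type n z <= n)%N.
Proof. by elim: n z => //= n IH z; case: ifP => // _; exact: leq_trans (IH _) _. Qed.

Let half_lt1 : (2^-1 : R) < 1. Proof. lra. Qed.
Lemma is_path_con n z : skel K n z -> radius K n z < 1 -> is_path z (con K n z 1) (con K n z).
Proof. by move=> zn z1; apply: (is_path_track (@con_within _ _ K n)); [|exact: con0]. Qed.

Lemma is_path_rad n z : skel K n z -> 0 < radius K n z -> is_path z (rad K n z 1) (rad K n z).
Proof. by move=> zn z1; apply: (is_path_track (@rad_within _ _ K n)); [|exact: rad0]. Qed.

Lemma descent_path n z : skel K n z -> is_path z x (descent n z).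
Proof.
elim: n z => [|n IH] z zn /=; first exact: om_path.
case: ifPn => [z1|]; last rewrite -ltNge => z1.
  apply: is_path_concat (om_path _); apply: is_path_con => //.
  exact: le_lt_trans half_lt1.
have z0 : 0 < radius K n.+1 z by exact: lt_trans z1.
by apply: is_path_concat (IH _ _); [exact: is_path_rad|exact: rad1_skel].
Qed.

(** The induction is over skeleta, so neighborhoods are relative to [skel K n] and paths are kept
    inside it. *)
Definition flat_skel n : Prop := forall y, skel K n y ->
  exists N : set X, (\forall z \near y, skel K n z -> N z) /\
  forall z z' a, descent_type n z = descent_type n z' -> is_path z z' a ->
    (forall s, interval s -> skel K n (a s) /\ N (a s)) ->
    path_homotopic z x (path_concat a (descent n z')) (descent n z).

Lemma flat_skel0 : flat_skel 0.
Proof.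
move=> y y0; exists [set y]; split.
  have [n [e [v [n0 vo ev]]]] := y0.
  have := open_cell_near e vo; rewrite ev; apply: filterS => z + z0.
  move: n0; rewrite leqn0 => /eqP n0; subst n.
  move=> /(_ z0)[w wo ->] /=; rewrite -ev.
  by congr char_map; apply/rowP => -[].
move=> z z' a _ az ay /=; have [_ a0 a1] := iffLR (is_pathP _ _ _) az.
have zy : z = y by rewrite -a0; apply: (ay 0 _).2; exact: interval0.
have zy' : z' = y by rewrite -a1; apply: (ay 1 _).2; exact: interval1.
rewrite zy zy'; apply: path_homotopic_trans (path_cst_concat (om_path y)).
apply: path_homotopic_concat (path_homotopic_refl (om_path y) (fun _ _ => erefl)).
apply: path_homotopic_refl; first by rewrite zy zy' in az.
by move=> s /ay[].
Qed.

(** Contraction takes every point of [a] to the same center at time 1, so the deformed path is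
    constant there. *)
Lemma con_flat n z z' a e :
  radius K n z <= 2^-1 -> radius K n z' <= 2^-1 -> is_path z z' a ->
  (forall s, interval s -> exists2 v, open_disk v & a s = char_map (e : cell K n) v) ->
  path_homotopic z x (path_concat a (path_concat (con K n z') (om (con K n z' 1))))
    (path_concat (con K n z) (om (con K n z 1))).
Proof.
move=> z1 z1' az ae; have [_ a0 a1] := iffLR (is_pathP _ _ _) az.
have con1 s : interval s -> con K n (a s) 1 = char_map e 0.
  by move=> /ae[v vo ->]; rewrite conE // subrr scale0r.
have c0 : con K n z 1 = char_map e 0 by rewrite -a0 con1 //; exact: interval0.
have c1 : con K n z' 1 = char_map e 0 by rewrite -a1 con1 //; exact: interval1.
have ask s : interval s -> skel K n (a s).
  by move=> /ae[v /open_disk_disk vd ->]; exact: skel_disk.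
apply: (path_transport (@con_within _ _ K n)) => //=.
- move=> s u Is Iu; split => //=; first exact: ask.
  by have [v vo ->] := ae _ Is; rewrite radiusE; [exact/open_diskE|exact: open_disk_disk].
- by move=> s /ask; exact: con0.
rewrite c0 c1; apply: path_homotopic_trans (path_cst_concat (om_path _)).
apply: path_homotopic_concat (path_homotopic_refl (om_path _) (fun _ _ => erefl)).
apply: path_homotopic_sym; apply: path_homotopic_refl (is_path_cst _) _.
by move=> s Is; rewrite con1.
Qed.

(** Two points of equal type are either both contracted or both pushed. The contracted ones are
    compared in a single cell, the pushed ones by transporting the statement for the lower skeleton
    along [rad]. *)
Lemma flat_skelS n : flat_skel n -> flat_skel n.+1.
Proof.
move=> IH y yn.
have cellN : radius K n.+1 y < 1 -> exists (e : cell K n.+1) (L : set X),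
    (\forall z \near y, skel K n.+1 z -> L z) /\
    forall z, L z -> exists2 v, open_disk v & z = char_map e v.
  move=> y1; have [[e [v [vo yv]]]|[k kn /(radius_low kn) y1']] := skelP yn; last by rewrite y1' ltxx in y1.
  exists e, [set z | exists2 v, open_disk v & z = char_map e v]; split=> //.
  by rewrite yv; exact: open_cell_near.
have [y0|] := ltP (radius K n.+1 y) 2^-1.
  have [e [L [yL Le]]] := cellN (lt_trans y0 half_lt1).
  exists [set z | L z /\ radius K n.+1 z < 2^-1]; split.
    move: yL (radius_near_lt yn y0); apply: filterS2 => z H1 H2 zn.
    by split; [exact: H1|exact: H2].
  move=> z z' a _ az aL; have [_ a0 a1] := iffLR (is_pathP _ _ _) az.
  have z1 : radius K n.+1 z <= 2^-1.
    by rewrite -a0; apply: ltW; case: (aL 0 interval0) => _ [].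
  have z1' : radius K n.+1 z' <= 2^-1.
    by rewrite -a1; apply: ltW; case: (aL 1 interval1) => _ [].
  rewrite /= z1 z1'; apply: (con_flat (e := e)) => // s Is.
  by apply: Le; case: (aL s Is) => _ [].
move=> yhalf; have y0 : 0 < radius K n.+1 y by exact: lt_le_trans yhalf.
(* Around a point of radius at least 1/2 there may still be points of type [n.+1]. The neighborhood
   either avoids them, when the radius is 1 or more, or lies in one open cell, where they can be
   compared. *)
have [L [yL Le]] : exists L : set X, (\forall z \near y, skel K n.+1 z -> L z) /\
    ((forall z, L z -> 2^-1 < radius K n.+1 z) \/
     exists e : cell K n.+1, forall z, L z -> exists2 v, open_disk v & z = char_map e v).
  have [/cellN[e [L [yL Le]]]|y1] := ltP (radius K n.+1 y) 1.
    by exists L; split=> //; right; exists e.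
  exists [set z | 2^-1 < radius K n.+1 z]; split; last by left.
  by apply: radius_near_gt => //; exact: lt_le_trans half_lt1 y1.
have [N [yN NP]] := IH _ (rad1_skel yn y0).
exists [set z | [/\ L z, 0 < radius K n.+1 z & N (rad K n.+1 z 1)]]; split.
  have rc := iffLR (withinP _ _) (@rad_within _ _ K n.+1) (y, 1) (And3 yn y0 interval1) _ yN.
  have := rc; move=> [[A1 A2] /= [yA1 A21] AN].
  move: yL (radius_near_gt yn y0) yA1; apply: filterS3 => z H1 H2 H3 zn.
  have z0 := H2 zn.
  split=> //; first exact: H1.
  apply: (AN (z, 1)); first by split=> //; exact: nbhs_singleton.
    by split=> //; exact: interval1.
  exact: rad1_skel.
move=> z z' a tz az aL; have [_ a0 a1] := iffLR (is_pathP _ _ _) az.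
have [zn [Lz z0 _]] : skel K n.+1 z /\ [/\ L z, 0 < radius K n.+1 z & N (rad K n.+1 z 1)].
  by rewrite -a0; exact: (aL 0 interval0).
have [zn' [_ z0' _]] : skel K n.+1 z' /\ [/\ L z', 0 < radius K n.+1 z' & N (rad K n.+1 z' 1)].
  by rewrite -a1; exact: (aL 1 interval1).
move: tz; rewrite /=; case: ifPn => [z1|z1]; case: ifPn => [z1'|z1'] //.
- move=> _; have [Lout|[e Le']] := Le.
    by have := Lout z Lz; rewrite ltNge z1.
  apply: (con_flat (e := e)) => // s Is.
  by apply: Le'; case: (aL s Is) => _ [].
(* A pushed point has type at most [n], so it never shares the type [n.+1] of a contracted one. *)
- by move=> H; have := descent_type_le n (rad K n.+1 z' 1); rewrite -H ltnn.
- by move=> H; have := descent_type_le n (rad K n.+1 z 1); rewrite H ltnn.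
move=> tz; have rs s : interval s -> skel K n (rad K n.+1 (a s) 1).
  by move=> /aL[sk [_ s0 _]]; exact: rad1_skel.
apply: (path_transport (@rad_within _ _ K n.+1)) => //=.
- by move=> s u /aL[sk [_ s0 _]] Iu; split.
- by move=> s /aL[sk _]; exact: rad0.
- by apply: descent_path; exact: rad1_skel.
- by apply: descent_path; exact: rad1_skel.
apply: NP tz _ _ => [|s Is]; last by split; [exact: rs|case: (aL s Is) => _ []].
apply/is_pathP; rewrite a0 a1; split=> //.
have [ac _ _] := iffLR (is_pathP _ _ _) az.
apply: (@within_comp _ _ _ interval _ (fun s => (a s, 1 : R)) _ _ (@rad_within _ _ K n.+1)).
  by apply: within_pair => //; exact: within_cst.
by move=> s /aL[sk [_ s0 _]]; split=> //; exact: interval1.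
Qed.

Lemma flat_skel_all n : flat_skel n.
Proof. by elim: n => [|n]; [exact: flat_skel0|exact: flat_skelS]. Qed.

End Descent.

Lemma cw_flat_labelling {R : realType} {X : topologicalType} (K : cw_structure R X) (x : X) :
  path_connected_space R X -> cw_dim_le K 2 -> exists ty (pi : X -> R -> X), flat_labelling x ty pi.
Proof.
move=> pcX K2; have [om om_path] := boolp.choice (fun y => pcX y x).
(* By [descent_type_le] the last case is reached only for 2, so equal values of [dim] mean equal
   types. *)
pose dim k := match k with 0 => Dim0 | 1 => Dim1 | _ => Dim2 end.
have sk z : skel K 2 z := skel_dim z K2.
exists (fun z => dim (descent_type K 2 z)), (descent K om 2); split=> [y|y].
  exact: descent_path.
have [N [yN NP]] := flat_skel_all om_path (sk y).
exists N; first by apply: filterS yN => z; apply.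
move=> z z' a _ _ tz az aN; apply: NP az _ => [|s /aN//].
move: (descent_type_le K 2 z) (descent_type_le K 2 z') tz.
by case: descent_type => [|[|[|//]]] _; case: descent_type => [|[|[|//]]] _.
Qed.

Theorem theorem4p2 (R : realType) (G H : groupType)
    (PG : finite_presentation G) (PH : finite_presentation H)
    (hdim : geometric_dimension R G 2)
    (A : seq G) (hA : generating_set A)
    (B : seq H) (hB : generating_set B)
    (f : H -> G)
    (hf : coarse_embedding (word_dist B R) (word_dist A R) f) :
  fill_prec (group_Fill2 PH) (group_Fill2 PG).
Proof.
apply: coarse_fill_prec (coarse_expansion hA hf) (coarse_proper hB hf) _.
have [[X [K [[pcX [x [pi1 pin]]] K2]]] _] := hdim.
have [ty [pi flat]] := cw_flat_labelling x pcX K2.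
exact: (aspherical_cycles_split PG pi1 (pin 2 isT) flat).
Qed.
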